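(* Let $\mathcal{N}\subset|T_0|$ be the set of surfaces $Z\in|T_0|$ such that (a) $Z$ is in general position with respect to the fixed loci of the elements of $G$ (each nonidentity element of $G_0$ has $8$ fixed points on $Z$ and the elements of $G\setminus G_0$ act freely on $Z$), and (b) $Z$ has exactly $8$ singular points, which are nodes forming a single $G$-orbit. Then $\mathcal{N}$ is a smooth, irreducible, unirational quasi-projective variety of dimension $3$.
   Context: Let $e_1,e_2$ be the automorphisms of $\mathbb{P}^1$ given by $e_1(x_0:x_1)=(x_0:-x_1)$, $e_2(x_0:x_1)=(x_1:x_0)$; $G\cong\mathbb{Z}_2^3$ is the group of automorphisms of $\mathbb{P}^1\times\mathbb{P}^1\times\mathbb{P}^1$ generated by $(e_1,e_1,1)$, $(e_1,1,e_1)$, $(e_2,e_2,e_2)$, and $G_0$ the subgroup generated by the first two. With coordinates $x=(x_0,x_1),y,z$ on the factors, $s(x)=x_0^2+x_1^2$, $d(x)=x_0^2-x_1^2$, $p(x)=x_0x_1$, and $T_0\subset H^0(\mathcal{O}_{\mathbb{P}^1\times\mathbb{P}^1\times\mathbb{P}^1}(2,2,2))$ is the span of $s(x)s(y)s(z)$, $s(x)d(y)d(z)$, $d(x)s(y)d(z)$, $d(x)d(y)s(z)$, $p(x)p(y)p(z)$; $|T_0|$ is the corresponding linear system of surfaces. *)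

(* Defs.v *)
From HB Require Import structures.
From mathcomp Require Import all_boot all_order all_algebra.
From mathcomp Require Import mpoly.
Set Implicit Arguments. Unset Strict Implicit. Unset Printing Implicit Defensive.
Import Order.TTheory GRing.Theory Num.Theory.
Local Open Scope ring_scope.

Section Defs.
Variable C : numClosedFieldType.

(* Generic classical projective geometry in P^(m-1) = (C^m \ 0)/C^*.     *)
(* A subset of P^(m-1) is given by a predicate on representative vectors *)
(* (only nonzero vectors matter; all predicates used are scale-invariant).*)

Definition nzv m (a : 'I_m -> C) : Prop := exists i, a i != 0.

(* f vanishes at the projective point [a] (i.e. on the whole line C a);   *)
(* for homogeneous f this is just f(a) = 0.                               *)
Definition pvanish m (f : {mpoly C[m]}) (a : 'I_m -> C) : Prop :=
  forall l : C, f.@[fun i => l * a i] = 0.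

Definition psub m (X Y : ('I_m -> C) -> Prop) : Prop :=
  forall a, nzv a -> X a -> Y a.

Definition zclosed m (X : ('I_m -> C) -> Prop) : Prop :=
  exists fs : seq {mpoly C[m]},
    forall a, nzv a -> (X a <-> (forall f, f \in fs -> pvanish f a)).

Definition quasi_projective m (S : ('I_m -> C) -> Prop) : Prop :=
  exists X Y, zclosed X /\ zclosed Y /\
    forall a, nzv a -> (S a <-> (X a /\ ~ Y a)).

Definition irreducible m (S : ('I_m -> C) -> Prop) : Prop :=
  (exists a, nzv a /\ S a) /\
  forall X Y, zclosed X -> zclosed Y ->
    psub S (fun a => X a \/ Y a) -> psub S X \/ psub S Y.

Definition relclosed m (S T : ('I_m -> C) -> Prop) : Prop :=
  exists X, zclosed X /\ forall a, nzv a -> (T a <-> (S a /\ X a)).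

Definition has_chain m (S : ('I_m -> C) -> Prop) (k : nat) : Prop :=
  exists Y : nat -> ('I_m -> C) -> Prop,
    (forall i, (i <= k)%N -> irreducible (Y i) /\ relclosed S (Y i)) /\
    (forall i, (i < k)%N -> psub (Y i) (Y i.+1) /\ ~ psub (Y i.+1) (Y i)).

Definition has_dim m (S : ('I_m -> C) -> Prop) (d : nat) : Prop :=
  has_chain S d /\ ~ has_chain S d.+1.

Definition in_ideal m (S : ('I_m -> C) -> Prop) (f : {mpoly C[m]}) : Prop :=
  forall a, nzv a -> S a -> pvanish f a.

Definition grad m (f : {mpoly C[m]}) (a : 'I_m -> C) : 'rV[C]_m :=
  \row_j (mderiv j f).@[a].

Definition gradmx m (fs : seq {mpoly C[m]}) (a : 'I_m -> C)
  : 'M[C]_(size fs, m) :=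
  \matrix_(i, j) (mderiv j (nth 0 fs i)).@[a].

(* S (of dimension d) is smooth: at every point of S the Zariski tangent  *)
(* space of the affine cone, i.e. the common kernel of the differentials  *)
(* of all f in I(S), has dimension d+1; equivalently the differentials    *)
(* of I(S) at a span a space of dimension m - 1 - d.                      *)
Definition smooth_of_dim m (S : ('I_m -> C) -> Prop) (d : nat) : Prop :=
  forall a, nzv a -> S a ->
    exists fs : seq {mpoly C[m]},
      (forall f, f \in fs -> in_ideal S f) /\
      \rank (gradmx fs a) = (m - 1 - d)%N /\
      (forall f, in_ideal S f -> (grad f a <= gradmx fs a)%MS).

(* unirational: there is a dominant rational map P^n --> S, given by m    *)
(* homogeneous polynomials of a common degree, defined somewhere, whose   *)
(* image has the same Zariski closure as S.                               *)
Definition unirational m (S : ('I_m -> C) -> Prop) : Prop :=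
  exists (n deg : nat) (phi : 'I_m -> {mpoly C[n.+1]}),
    let ev := fun t : 'I_n.+1 -> C => fun i => (phi i).@[t] in
    (forall i, phi i \is deg.-homog) /\
    (exists t, nzv (ev t)) /\
    (forall f : {mpoly C[m]},
       (forall t, nzv (ev t) -> pvanish f (ev t)) <-> in_ideal S f).

(* The specific situation: P^1 x P^1 x P^1 with coordinates              *)
(* x0 x1 y0 y1 z0 z1 = indices 0..5.                                      *)

Definition pt := 'I_6 -> C.
Definition ix (k : nat) : 'I_6 := inord k.

(* a representative of a point of P^1 x P^1 x P^1 *)
Definition valid (p : pt) : Prop :=
  forall k, (k < 3)%N -> (p (ix (2*k)) != 0) || (p (ix (2*k).+1) != 0).

Definition peq (p q : pt) : Prop :=
  forall k, (k < 3)%N ->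
    p (ix (2*k)) * q (ix (2*k).+1) = p (ix (2*k).+1) * q (ix (2*k)).

Definition Xv (k : nat) : {mpoly C[6]} := 'X_(ix k).
Definition sP (k : nat) : {mpoly C[6]} := Xv (2*k) ^+ 2 + Xv (2*k).+1 ^+ 2.
Definition dP (k : nat) : {mpoly C[6]} := Xv (2*k) ^+ 2 - Xv (2*k).+1 ^+ 2.
Definition pP (k : nat) : {mpoly C[6]} := Xv (2*k) * Xv (2*k).+1.

(* the member of |T_0| with coefficient vector a *)
Definition Fa (a : 'I_5 -> C) : {mpoly C[6]} :=
  a (inord 0) *: (sP 0 * sP 1 * sP 2) + a (inord 1) *: (sP 0 * dP 1 * dP 2)
  + a (inord 2) *: (dP 0 * sP 1 * dP 2) + a (inord 3) *: (dP 0 * dP 1 * sP 2)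
  + a (inord 4) *: (pP 0 * pP 1 * pP 2).

Definition onZ (a : 'I_5 -> C) (p : pt) : Prop := (Fa a).@[p] = 0.

Definition singZ (a : 'I_5 -> C) (p : pt) : Prop :=
  onZ a p /\ forall i : 'I_6, (mderiv i (Fa a)).@[p] = 0.

(* auxiliary direction q_k not proportional to p_k, giving the affine   *)
(* chart t |-> p_k + t q_k of the k-th factor P^1 around p_k            *)
Definition qdir (p : pt) (i : nat) : C :=
  let k := i./2 in
  if p (ix (2*k).+1) != 0 then (if odd i then 0 else 1)
  else (if odd i then 1 else 0).

(* Hessian of f(u,v,w) = F(p_x + u q_x, p_y + v q_y, p_z + w q_z) at 0 *)
Definition hess (a : 'I_5 -> C) (p : pt) : 'M[C]_3 :=
  \matrix_(r, s) \sum_(i < 2) \sum_(j < 2)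
     qdir p (2*r + i) * qdir p (2*s + j) *
     (mderiv (ix (2*r + i)) (mderiv (ix (2*s + j)) (Fa a))).@[p].

Definition nodeZ (a : 'I_5 -> C) (p : pt) : Prop :=
  singZ a p /\ \det (hess a p) != 0.

(* The group G: g = (b1, b2, e) acts by e1^b1 e2^e on x, e1^b2 e2^e on y, *)
(* e1^(b1 xor b2) e2^e on z; G_0 = {e = false}.                          *)
Definition e1 (b : bool) (u : C * C) : C * C := if b then (u.1, - u.2) else u.
Definition e2 (b : bool) (u : C * C) : C * C := if b then (u.2, u.1) else u.

Definition gelt := (bool * bool * bool)%type.
Definition gbit (g : gelt) (k : nat) : bool :=
  if k == 0%N then g.1.1 else if k == 1%N then g.1.2 else g.1.1 (+) g.1.2.

Definition act (g : gelt) (p : pt) : pt := fun i =>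
  let k := (i : nat)./2 in
  let u := e2 g.2 (e1 (gbit g k) (p (ix (2*k)), p (ix (2*k).+1))) in
  if odd i then u.2 else u.1.

Definition in_G0 (g : gelt) : bool := ~~ g.2.
Definition gid : gelt := (false, false, false).

Definition exactly (n : nat) (P : pt -> Prop) : Prop :=
  exists f : 'I_n -> pt,
    (forall i, valid (f i) /\ P (f i)) /\
    (forall i j, peq (f i) (f j) -> i = j) /\
    (forall x, valid x -> P x -> exists i, peq x (f i)).

Definition gen_pos (a : 'I_5 -> C) : Prop :=
  (forall g, in_G0 g -> g != gid ->
     exactly 8 (fun p => onZ a p /\ peq (act g p) p)) /\
  (forall g, ~~ in_G0 g -> forall p, valid p -> onZ a p -> ~ peq (act g p) p).

Definition eight_nodes (a : 'I_5 -> C) : Prop :=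
  exactly 8 (singZ a) /\
  (forall p, valid p -> singZ a p -> nodeZ a p) /\
  (exists p0, valid p0 /\ singZ a p0 /\
     forall p, valid p -> singZ a p -> exists g, peq p (act g p0)).

Definition Nset (a : 'I_5 -> C) : Prop :=
  nzv a /\ gen_pos a /\ eight_nodes a.

End Defs.

(* Main.v *)
(** In terms of s, d, p the form F is a sum of five monomials, one in each of the
    five slots, so its singular points are governed by b_i = 8 a_i / w (w = a_4).
    Scaling the representatives to p = 1, a singular point with w <> 0 amounts to
    angles theta_i with b_i = sin(theta_i) and theta_0 + ... + theta_3 = 0; such
    angles exist iff a satisfies
      Phi = w^2 L_1 L_2 L_3 L_4 - 256 M_1 M_2 M_3 = 0,
    where L_1, ..., L_4 are the sums of a_0, ..., a_3 with an even number of signs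
    and M_1 = a_0 a_1 - a_2 a_3, M_2, M_3 are the other 2 x 2 minors.  General
    position is Psi = L_1 L_2 L_3 L_4 (64 a_0^2 - w^2) ... (64 a_3^2 - w^2) <> 0,
    and N turns out to be {Phi = 0, Psi <> 0}; for w = 0 exactly one M_i vanishes.
    Phi has a nonzero differential on N, and the half angles parametrize N by a
    torus.  Pseudo-division by Phi, a quadratic polynomial in w, shows that every
    f vanishing on N satisfies L^k f = Phi q, which yields density of the
    parametrization and the tangent spaces.  For the dimension, polynomials
    separating the members of a chain of irreducible subsets are algebraically
    independent, so counting monomials bounds the length of the chain. *)

Require Import Defs.
From mathcomp Require Import all_boot all_order all_algebra.
From mathcomp Require Import mpoly.
From Stdlib Require Import Classical ClassicalChoice.
From mathcomp Require Import ring zify.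
Set Implicit Arguments. Unset Strict Implicit. Unset Printing Implicit Defensive.
Import Order.TTheory GRing.Theory Num.Theory.
Local Open Scope ring_scope.

(** The constants come from one computation. On representatives with p = 1 the operator u d/du
    exchanges s and d. With G, H the coefficients of s, d in F, the equations s G + d H = - w, d G +
    s H = 0 and s^2 - d^2 = 4 give G = - w s / 4 and H = w d / 4; b_i = 8 a_i / w then absorbs w.
    The four terms of F, normalized to t_0, ..., t_3 with sum 4, satisfy b_i^2 (4 t_i^2 + e_3) = 4
    t_i^2, where e_3 is their third elementary symmetric function. So tan(theta_i) = 2 t_i /
    sqrt(e_3), and the addition formula for the tangent of theta_0 + ... + theta_3 turns e_1 = 4
    into the vanishing of this tangent. This is also why there is only one orbit: b determines the
    cosines up to a common sign, hence the t_i, hence all s^2 and d^2, and the eight remaining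
    choices of signs are permuted simply transitively by G. The hyperplane w = 0 escapes this
    scaling: there the singular points lie over a fixed point of e_1 in exactly one factor, and they
    are found by hand. *)

Section Evaluation.
Variable C : numClosedFieldType.

(** * Polynomials as functions *)

Lemma poly_all_roots (p : {poly C}) : (forall x, p.[x] = 0) -> p = 0.
Proof.
move=> p0; apply/eqP; apply: contraT => pn0.
(* In characteristic zero these are [size p] distinct roots, one too many. *)
have := @max_poly_roots _ p [seq i%:R | i <- iota 0 (size p)] pn0.
rewrite size_map size_iota ltnn => -> //.
  by apply/allP => x _; rewrite /root p0.
by rewrite map_inj_uniq ?iota_uniq // => i j /eqP; rewrite eqr_nat => /eqP.
Qed.

(** The value of the last variable is split off because [muni] and [mwiden] both single out
    [ord_max]. *)
Definition snoc n (v : 'I_n -> C) (x : C) : 'I_n.+1 -> C :=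
  fun i => if unlift ord_max i is Some j then v j else x.

Lemma snoc_max n (v : 'I_n -> C) x : snoc v x ord_max = x.
Proof. by rewrite /snoc unlift_none. Qed.

Lemma snoc_widen n (v : 'I_n -> C) x (i : 'I_n) :
  snoc v x (widen_ord (leqnSn n) i) = v i.
Proof.
rewrite /snoc; have -> : widen_ord (leqnSn n) i = lift ord_max i.
  by apply: val_inj => /=; rewrite /bump leqNgt ltn_ord.
by rewrite liftK.
Qed.

Lemma meval_snoc n (p : {mpoly C[n.+1]}) v x :
  p.@[snoc v x] = (map_poly (meval v) (muni p)).[x].
Proof.
rewrite mevalE muniE rmorph_sum /= horner_sum; apply: eq_bigr => m _.
rewrite -mul_polyC rmorphM /= map_polyC /= map_polyXn hornerM hornerC hornerXn.
rewrite mevalZ mevalX -mulrA; congr (_ * _).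
rewrite big_ord_recr /= snoc_max; congr (_ * _).
by apply: eq_bigr => i _; rewrite snoc_widen mnmE.
Qed.

Lemma muni_eq0 n (p : {mpoly C[n.+1]}) : muni p = 0 -> p = 0.
Proof.
move=> p0; apply/mpolyP => m; rewrite mcoeff0.
have := congr1 (fun q : {poly _} =>
  (q`_(m ord_max))@_[multinom m (widen_ord (leqnSn n) i) | i < n]) p0.
rewrite muniE coef0 mcoeff0 coef_sum raddf_sum /=.
rewrite (eq_bigr (fun m' => p@_m' * (m' == m)%:R)); last first.
  move=> m' _; rewrite coefZ coefXn; case: (eqVneq m' m) => [->|ne].
    by rewrite eqxx mulr1 mcoeffZ mcoeffX eqxx.
  have [e|_] := eqVneq (m ord_max); last by rewrite !mulr0 mcoeff0.
  rewrite mulr1 mcoeffZ mcoeffX; case: eqP => //= e'.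
  case/eqP: ne; apply/mnmP => i.
  case: (unliftP ord_max i) => [j ->|-> //].
  have := congr1 (fun u : 'X_{1.. n} => u j) e'; rewrite /= !mnmE.
  have -> // : widen_ord (leqnSn n) j = lift ord_max j.
  by apply: val_inj => /=; rewrite /bump leqNgt ltn_ord.
have [mp|mp] := boolP (m \in msupp p); last by rewrite (memN_msupp_eq0 mp).
rewrite (bigD1_seq m) ?msupp_uniq //= eqxx mulr1 big1 ?addr0 // => i /negbTE->.
by rewrite mulr0.
Qed.

Lemma meval_eq0 n (p : {mpoly C[n]}) : (forall v, p.@[v] = 0) -> p = 0.
Proof.
elim: n p => [|n IH] p p0.
  apply/mpolyP => m; have := p0 (fun=> 0).
  have [mp|mp] := boolP (m \in msupp p); last by rewrite (memN_msupp_eq0 mp) mcoeff0.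
  rewrite mevalE (bigD1_seq m) ?msupp_uniq //= big_ord0 mulr1 big1 ?addr0 ?mcoeff0 //.
  by move=> i /eqP[]; apply/mnmP => -[].
apply: muni_eq0; apply/polyP => k; rewrite coef0; apply: IH => v.
have : map_poly (meval v) (muni p) = 0.
  by apply: poly_all_roots => x; rewrite -meval_snoc.
by move=> /(congr1 (fun q : {poly C} => q`_k)); rewrite coef0 coef_map.
Qed.

Lemma meval_neq0 n (p : {mpoly C[n]}) : p != 0 -> exists v, p.@[v] != 0.
Proof.
move=> p0; apply: NNPP => nv; case/eqP: p0; apply: meval_eq0 => v.
by apply/eqP; apply: contraT => h; case: nv; exists v.
Qed.

Definition compm n m (f : {mpoly C[m]}) (phi : 'I_m -> {mpoly C[n]}) : {mpoly C[n]} :=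
  f \mPo [tuple phi i | i < m].

Lemma meval_comp n m (f : {mpoly C[m]}) (phi : 'I_m -> {mpoly C[n]}) t :
  (compm f phi).@[t] = f.@[fun i => (phi i).@[t]].
Proof.
by rewrite comp_mpoly_meval; apply: meval_eq => i; rewrite tnth_mktuple.
Qed.

Lemma neq0_of_meval n (p : {mpoly C[n]}) v : p.@[v] != 0 -> p != 0.
Proof. by apply: contra_neq => ->; rewrite meval0. Qed.

End Evaluation.

(** * Vanishing ideals and irreducibility *)

Section Geometry.
Variable C : numClosedFieldType.

(** Since f need not be homogeneous, [pvanish] speaks of the whole line through a. Restricted to
    this line, f and g are polynomials in one variable, and these form a domain. *)
Lemma pvanishM m (f g : {mpoly C[m]}) a :
  pvanish (f * g) a -> pvanish f a \/ pvanish g a.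
Proof.
move=> fg; apply: NNPP => /not_or_and[/not_all_ex_not[l1 h1] /not_all_ex_not[l2 h2]].
pose ln : 'I_m -> {mpoly C[1]} := fun i => a i *: 'X_ord0.
have E (f' : {mpoly C[m]}) l : (compm f' ln).@[fun=> l] = f'.@[fun i => l * a i].
  by rewrite meval_comp; apply: meval_eq => i; rewrite mevalZ mevalXU mulrC.
have n0 (f' : {mpoly C[m]}) l : f'.@[fun i => l * a i] <> 0 -> compm f' ln != 0.
  by move=> /eqP; rewrite -E; apply: neq0_of_meval.
have [v] := meval_neq0 (mulf_neq0 (n0 _ _ h1) (n0 _ _ h2)).
have Ev (f' : {mpoly C[m]}) : (compm f' ln).@[v] = f'.@[fun i => v ord0 * a i].
  by rewrite meval_comp; apply: meval_eq => i; rewrite mevalZ mevalXU mulrC.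
by rewrite mevalM !Ev -mevalM fg eqxx.
Qed.

Lemma zclosed1 m (f : {mpoly C[m]}) : zclosed (pvanish f).
Proof.
exists [:: f] => a _; split=> [h g|]; first by rewrite inE => /eqP->.
by apply; rewrite inE.
Qed.

Lemma in_ideal_prime m (S : ('I_m -> C) -> Prop) f g :
  irreducible S -> in_ideal S (f * g) -> in_ideal S f \/ in_ideal S g.
Proof.
move=> [_ irr] fg; apply: (irr _ _ (zclosed1 f) (zclosed1 g)) => a na Sa.
exact: pvanishM (fg a na Sa).
Qed.

(* The closure of the image of [phi] is irreducible; the density hypothesis
   says that S lies in the closure of the image of the locus [psi <> 0]. *)
Lemma irreducible_image n m (phi : 'I_m -> {mpoly C[n]}) (psi : {mpoly C[m]})
    (S : ('I_m -> C) -> Prop) :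
  let ev := fun t i => (phi i).@[t] in
  (forall t, psi.@[ev t] != 0 -> nzv (ev t) /\ S (ev t)) ->
  (exists t, psi.@[ev t] != 0) ->
  (forall f, (forall t, psi.@[ev t] != 0 -> pvanish f (ev t)) -> in_ideal S f) ->
  irreducible S.
Proof.
move=> ev inS [t0 ht0] dense; split; first by exists (ev t0); apply: inS.
move=> X Y [fX hX] [fY hY] cov; apply: NNPP => /not_or_and[nX nY].
(* A closed set that does not contain S misses the image off a hypersurface of the parameter space:
   one of its equations, rescaled by some l, is not identically zero along [phi]. *)
have key (Z : ('I_m -> C) -> Prop) (fZ : seq {mpoly C[m]}) :
    (forall a, nzv a -> (Z a <-> (forall f, f \in fZ -> pvanish f a))) ->
    ~ psub S Z ->
    exists f l, compm f (fun i => l *: phi i) != 0 /\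
      (forall t, (compm f (fun i => l *: phi i)).@[t] != 0 -> nzv (ev t) -> ~ Z (ev t)).
  move=> hZ nZ; have [f [fin nf]] : exists f, f \in fZ /\ ~ in_ideal S f.
    apply: NNPP => nex; apply: nZ => a na Sa; apply/(hZ a na) => f fin.
    by have [h|h] := classic (in_ideal S f); [exact: h | case: nex; exists f].
  have [t [l [psit fl]]] :
      exists t l, psi.@[ev t] != 0 /\ f.@[fun i => l * ev t i] != 0.
    apply: NNPP => nex; apply: nf; apply: dense => t psit l.
    by apply/eqP; apply: contraT => h; case: nex; exists t, l.
  have E t' : (compm f (fun i => l *: phi i)).@[t'] = f.@[fun i => l * ev t' i].
    by rewrite meval_comp; apply: meval_eq => i; rewrite mevalZ.
  exists f, l; split; first by apply: (@neq0_of_meval _ _ _ t); rewrite E.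
  by move=> t' h nt Zt; move: h; rewrite E (proj1 (hZ _ nt) Zt f fin l) eqxx.
have [f [l [fn0 hf]]] := key X fX hX nX.
have [g [l' [gn0 hg]]] := key Y fY hY nY.
have psin0 : compm psi phi != 0 by apply: (@neq0_of_meval _ _ _ t0); rewrite meval_comp.
(* A parameter off all three hypersurfaces gives a point of S outside both X and Y. *)
have [t] := meval_neq0 (mulf_neq0 (mulf_neq0 fn0 gn0) psin0).
rewrite !mevalM !mulf_eq0 !negb_or => /andP[/andP[ft gt] pt].
rewrite meval_comp in pt; have [nt St] := inS t pt.
by have [Xt|Yt] := cov _ nt St; [apply: (hf t ft nt) | apply: (hg t gt nt)].
Qed.

End Geometry.

(** * Bounding the length of chains of irreducible subsets *)

Section Dimension.
Variable C : numClosedFieldType.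
Variable m : nat.

Section Tower.
Variables (N : nat) (fs : nat -> {mpoly C[m]}).

(** Exponent vectors with i + 1 entries below N, as nested pairs, so that the induction in
    [tmon_free] splits off the last exponent. *)
Fixpoint tidx (i : nat) : finType :=
  if i is i'.+1 then (tidx i' * 'I_N)%type : finType else 'I_N : finType.

Fixpoint tmon (i : nat) : tidx i -> {mpoly C[m]} :=
  match i return tidx i -> {mpoly C[m]} with
  | 0 => fun e => fs 0 ^+ (e : 'I_N)
  | i'.+1 => fun e => tmon e.1 * fs i'.+1 ^+ (e.2 : 'I_N)
  end.

Lemma card_tidx i : #|tidx i| = (N ^ i.+1)%N.
Proof.
by elim: i => [|i IH] /=; rewrite ?card_ord ?expn1 // card_prod IH card_ord -expnSr.
Qed.

Lemma msizeM_pred (p q : {mpoly C[m]}) : (msize (p * q) <= (msize p + msize q).-1)%N.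
Proof.
have [->|p0] := eqVneq p 0; first by rewrite mul0r msize0.
have [->|q0] := eqVneq q 0; first by rewrite mulr0 msize0.
by rewrite msizeM.
Qed.

Lemma msize_expr_le (f : {mpoly C[m]}) D j :
  (msize f <= D.+1)%N -> (msize (f ^+ j) <= (D * j).+1)%N.
Proof.
move=> hf; elim: j => [|j IH]; first by rewrite expr0 msize1 muln0.
by rewrite exprS; apply: leq_trans (msizeM_pred _ _) _; lia.
Qed.

Lemma msize_tmon D i : (forall j, (j <= i)%N -> (msize (fs j) <= D.+1)%N) ->
  forall e, (msize (@tmon i e) <= (i.+1 * (D * N)).+1)%N.
Proof.
have pw j (e : 'I_N) : (msize (fs j) <= D.+1 -> msize (fs j ^+ e) <= (D * N).+1)%N.
  move=> h; apply: leq_trans (msize_expr_le e h) _.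
  by rewrite ltnS leq_mul2l (ltnW (ltn_ord e)) orbT.
elim: i => [|i IH] h e /=; first by rewrite mul1n; apply: pw; apply: h.
apply: leq_trans (msizeM_pred _ _) _.
have := leq_add (IH (fun j hj => h j (leqW hj)) e.1) (pw i.+1 e.2 (h _ (leqnn _))).
by rewrite [(i.+2 * _)%N]mulSn -subn1 leq_subLR => /leq_trans; apply; rewrite addSn addnS add1n addnC.
Qed.

Variable P : nat -> {mpoly C[m]} -> Prop.
Variable k : nat.
Hypothesis P_add : forall i f g, P i f -> P i g -> P i (f + g).
Hypothesis P_mul : forall i f g, P i f -> P i (f * g).
Hypothesis P_prime : forall i f g, (i <= k)%N -> P i (f * g) -> P i f \/ P i g.
Hypothesis P_sub : forall i f, (i < k)%N -> P i.+1 f -> P i f.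
Hypothesis P_in : forall i, (i < k)%N -> P i (fs i.+1).
Hypothesis P_out : forall i, (i < k)%N -> ~ P i.+1 (fs i.+1).
Hypothesis P_base : forall c : 'I_N -> C, P 0 (\sum_e c e *: fs 0 ^+ e) ->
  forall e, c e = 0.

(** The [P i] stand for a descending sequence of primes, with f = [fs i.+1] in [P i] but not in
    [P i.+1]. Expand a relation modulo [P i.+1] in powers of f. The lowest power splits off because
    f is not in the prime; what remains is the lowest coefficient plus a multiple of f, so this
    coefficient lies in [P i], and induction applies to it. *)
Lemma tmon_free i : (i <= k)%N -> forall c : tidx i -> C,
  P i (\sum_e c e *: tmon e) -> forall e, c e = 0.
Proof.
elim: i => [|i IH] ik c; first exact: P_base.
set f := fs i.+1 => Pc [e j] /=.
have main : forall (j : nat) (hj : (j < N)%N) (e : tidx i), c (e, Ordinal hj) = 0; last first.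
  by case: j => j hj; apply: main.
move=> {e j} j; elim/ltn_ind: j => j IHj hj.
pose G (b : 'I_N) := \sum_e c (e, b) *: tmon e.
have Gt (b : 'I_N) : (b < j)%N -> G b = 0.
  by case: b => b hb bj; rewrite /G big1 // => e _; rewrite IHj // scale0r.
have eq1 : \sum_e c e *: tmon e = \sum_(b : 'I_N) G b * f ^+ b.
  transitivity (\sum_(e : tidx i) \sum_(b : 'I_N) c (e, b) *: (tmon e * f ^+ b)).
    by rewrite pair_bigA; apply: eq_bigr => -[e b].
  rewrite exchange_big /=; apply: eq_bigr => b _; rewrite mulr_suml.
  by apply: eq_bigr => e _; rewrite -scalerAl.
have eq2 : \sum_e c e *: tmon e =
    f ^+ j * (G (Ordinal hj) + f * \sum_(b : 'I_N | (j < b)%N) G b * f ^+ (b - j.+1)).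
  rewrite eq1 (bigID (fun b : 'I_N => (b < j)%N)) /= big1 ?add0r; last first.
    by move=> b /Gt->; rewrite mul0r.
  rewrite (bigD1 (Ordinal hj)) /= ?ltnn // mulrDr mulrC; congr (_ + _).
  rewrite mulrA -exprSr mulr_sumr; apply: eq_big => [b|b].
    by rewrite -leqNgt ltn_neqAle andbC eq_sym -val_eqE /= eq_sym.
  rewrite -leqNgt => /andP[jb nb]; rewrite mulrCA -exprD subnKC //.
  by rewrite ltn_neqAle jb andbT; apply: contra nb => /eqP h; rewrite -val_eqE /= h.
have nP0 : ~ (P i.+1 1).
  by move=> h; apply: (P_out ik); rewrite -[fs _]mul1r; apply: P_mul.
have nPf q : ~ P i.+1 (f ^+ q).
  by elim: q => [|q IHq]; [rewrite expr0 | rewrite exprS => /(P_prime ik)[/(P_out ik)//|]].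
have Pg : P i.+1 (G (Ordinal hj) + f * \sum_(b : 'I_N | (j < b)%N) G b * f ^+ (b - j.+1)).
  by rewrite eq2 in Pc; have [/nPf|] := P_prime ik Pc.
have Pf : P i (- (f * \sum_(b : 'I_N | (j < b)%N) G b * f ^+ (b - j.+1))).
  by rewrite -mulrN; apply: P_mul; apply: P_in.
have := P_add (P_sub ik Pg) Pf; rewrite addrK => PG e.
exact: (IH (ltnW ik) (fun e => c (e, Ordinal hj)) PG).
Qed.

End Tower.

(** [msize] exceeds the degree by one, so every exponent that occurs is below B. The coefficients
    fill a matrix with B^m columns, and independence makes it row free. *)
Lemma lin_indep_card (I : finType) (F : I -> {mpoly C[m]}) B :
  (forall e, (msize (F e) <= B)%N) ->
  (forall c : I -> C, \sum_e c e *: F e = 0 -> forall e, c e = 0) ->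
  (#|I| <= B ^ m)%N.
Proof.
move=> hB free.
pose mn (g : {ffun 'I_m -> 'I_B}) : 'X_{1..m} := [multinom (g i : nat) | i < m].
pose M : 'M[C]_(#|I|, #|{: {ffun 'I_m -> 'I_B}}|) :=
  \matrix_(i, j) (F (enum_val i))@_(mn (enum_val j)).
suff : row_free M.
  by rewrite /row_free => /eqP<-; apply: leq_trans (rank_leq_col _) _; rewrite card_ffun !card_ord.
rewrite -kermx_eq0; apply/rowV0P => v /sub_kermxP vM.
pose c e := v 0 (enum_rank e).
suff c0 : forall e, c e = 0.
  by apply/rowP => i; rewrite mxE -[i]enum_valK; apply: c0.
apply: free; apply/mpolyP => u; rewrite mcoeff0 raddf_sum /=.
have [hu|/existsP[i hi]] := boolP [forall i, (u i < B)%N]; last first.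
  apply: big1 => e _; rewrite mcoeffZ memN_msupp_eq0 ?mulr0 //.
  apply: msize_mdeg_ge; apply: leq_trans (hB e) _; rewrite -leqNgt in hi.
  by apply: leq_trans hi _; rewrite mdegE (bigD1 i) //= leq_addr.
pose g : {ffun 'I_m -> 'I_B} := [ffun i => Ordinal (forallP hu i)].
have -> : u = mn g by apply/mnmP => i; rewrite mnmE ffunE.
have := congr1 (fun w : 'rV[C]_(_) => w 0 (enum_rank g)) vM; rewrite !mxE => vM0.
rewrite -[RHS]vM0.
rewrite (reindex (@enum_val I predT)) /=; last by apply: onW_bij; apply: enum_val_bij.
by apply: eq_bigr => i _; rewrite mcoeffZ /M mxE enum_rankK /c enum_valK.
Qed.

(** A coordinate that is nonzero at a point of [Y 0], the k polynomials separating consecutive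
    members, and f0 are k + 2 algebraically independent polynomials in m variables. *)
Lemma chain_length (S : ('I_m -> C) -> Prop) k (f0 : {mpoly C[m]}) :
  f0 != 0 -> in_ideal S f0 -> has_chain S k -> (k.+1 < m)%N.
Proof.
move=> f0n0 f0S [Y [irrY incl]].
have [a0 [[i0 na0] Ya0]] := proj1 (proj1 (irrY 0 (leq0n k))).
have step i : (i < k)%N -> exists f, in_ideal (Y i) f /\ ~ in_ideal (Y i.+1) f.
  move=> ik; have [ss nss] := incl i ik.
  have [_ [X [[fX hX] hYX]]] := irrY i (ltnW ik).
  have [_ [X' [_ hYX']]] := irrY i.+1 ik.
  apply: NNPP => nex; apply: nss => a na Ya.
  apply/(hYX a na); split; first by case/(hYX' a na): Ya.
  apply/(hX a na) => f fin.
  have [h|h] := classic (in_ideal (Y i.+1) f); first exact: h.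
  case: nex; exists f; split=> // b nb Yb.
  by have [_ Xb] := proj1 (hYX b nb) Yb; apply: (proj1 (hX b nb) Xb).
have [F hF] : exists F : nat -> {mpoly C[m]}, forall i, (i < k)%N ->
    in_ideal (Y i) (F i) /\ ~ in_ideal (Y i.+1) (F i).
  apply: (choice (fun i f => (i < k)%N -> in_ideal (Y i) f /\ ~ in_ideal (Y i.+1) f)) => i.
  by case: (boolP (i < k)%N) => [/step[f hf]|_]; [exists f | exists 0].
(* The tower is prolonged by the zero ideal [P k.+1]: f0 lies in the ideal of [Y k] but is not
   zero. *)
pose fs j : {mpoly C[m]} :=
  if j is i.+1 then (if (i < k)%N then F i else f0) else 'X_i0.
pose P i f := if (i <= k)%N then in_ideal (Y i) f else f = 0.
pose D := \max_(j < k.+2) msize (fs j).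
pose E := (k.+2 * D).+1.
(* The monomials [tmon] have size at most E N, so N^(k+2) <= (E N)^m; because N > E^m, this fails
   when m <= k + 1. *)
pose N := (E ^ m).+1.
have szD j : (j <= k.+1)%N -> (msize (fs j) <= D.+1)%N.
  move=> jk; apply: leqW.
  by have := @leq_bigmax _ (fun j : 'I_k.+2 => msize (fs j)) (Ordinal (jk : (j < k.+2)%N)).
have ind := @tmon_free N fs P k.+1.
have [] : [/\ forall i f g, P i f -> P i g -> P i (f + g),
    forall i f g, P i f -> P i (f * g) &
    forall i f g, (i <= k.+1)%N -> P i (f * g) -> P i f \/ P i g].
  split=> i f g; rewrite /P; case: ifP => ik.
  - by move=> hf hg a na Sa l; rewrite mevalD hf // hg // addr0.
  - by move=> -> ->; rewrite addr0.
  - by move=> hf a na Sa l; rewrite mevalM hf // mul0r.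
  - by move=> ->; rewrite mul0r.
  - by move=> _; apply: in_ideal_prime; case: (irrY i ik).
  - by move=> _ /eqP; rewrite mulf_eq0 => /orP[]/eqP; [left|right].
move=> PD PM Pp; move: ind => /(_ PD PM Pp) ind.
have {}ind : forall c : tidx N k.+1 -> C,
    \sum_e c e *: tmon fs e = 0 -> forall e, c e = 0.
  move=> c sc; apply: (ind _ _ _ _ k.+1 (leqnn _)).
  - move=> i f; rewrite ltnS /P => ik; rewrite ik; case: ifP => [ik1 h a na Ya|_ ->].
      by apply: h => //; apply: (proj1 (incl i ik1)).
    by move=> a _ _ l; rewrite meval0.
  - move=> i; rewrite ltnS /P /fs => ik; rewrite ik; case: ifP => ik1.
      by case: (hF i ik1).
    have -> : i = k by apply/eqP; rewrite eqn_leq ik leqNgt ik1.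
    move=> a na Ya; apply: f0S => //.
    by have [_ [X [_ /(_ a na)[/(_ Ya)[]]]]] := irrY k (leqnn k).
  - move=> i; rewrite ltnS /P /fs => ik; case: ifP => ik1.
      by rewrite ik1; case: (hF i ik1).
    by rewrite ik1; apply/eqP.
  (* On the line through a0 the coordinate [i0] takes every value, so a polynomial in it that
     vanishes there has zero coefficients. *)
  - move=> c'; rewrite /P leq0n => /(_ a0 (ex_intro _ i0 na0) Ya0) h.
    pose p : {poly C} := \poly_(e < N) (if insub e is Some e' then c' e' else 0).
    have p0 : p = 0.
      apply: poly_all_roots => x; rewrite horner_poly.
      transitivity ((\sum_e c' e *: fs 0 ^+ e).@[fun i => (x / a0 i0) * a0 i]); last exact: h.
      rewrite rmorph_sum /=; apply: eq_bigr => e _.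
      by rewrite mevalZ rmorphXn /= mevalXU divfK // valK.
    move=> e; have := congr1 (fun q : {poly C} => q`_e) p0.
    by rewrite coef0 coef_poly ltn_ord valK.
  - by rewrite /P ltnn.
have := lin_indep_card (@msize_tmon N fs D k.+1 szD) ind.
rewrite card_tidx => bnd; rewrite ltnNge; apply/negP => mk.
have hE : ((k.+2 * (D * N)).+1 <= E * N)%N.
  by rewrite mulnA /E [((_ * _).+1 * _)%N]mulSn -add1n leq_add2r.
have : (N ^ m.+1 <= E ^ m * N ^ m)%N.
  apply: leq_trans (leq_pexp2l (isT : (0 < N)%N) (mk : (m.+1 <= k.+2)%N)) _.
  apply: leq_trans bnd _; rewrite -expnMn; case: (m) => [|m'] //.
  by rewrite leq_exp2r.
by rewrite expnS leq_pmul2r ?expn_gt0 // ltnn.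
Qed.

End Dimension.

(** * Partial derivatives and Hessian of F *)

Section Equations.
Variable C : numClosedFieldType.
Implicit Types (a : 'I_5 -> C) (p : pt C).

Definition sv (u v : C) := u ^+ 2 + v ^+ 2.
Definition dv (u v : C) := u ^+ 2 - v ^+ 2.

(* With (i, j, k) a cyclic permutation of the three factors and [c], [e], [f]
   the coefficients a_i, a_j, a_k, the differential of F in the i-th factor
   (u, v) is determined by [gv], [hv] and the coefficient w p_j p_k of p_i. *)
Definition gv (a0 c s1 d1 s2 d2 : C) := a0 * s1 * s2 + c * d1 * d2.
Definition hv (e f s1 d1 s2 d2 : C) := e * s1 * d2 + f * d1 * s2.

(** The two partial derivatives of g s + h d + q p, which is F as a quadratic form in one factor. *)
Definition crit (g h q u v : C) :=
  2 * u * (g + h) + v * q = 0 /\ 2 * v * (g - h) + u * q = 0.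

(** The three factors are listed cyclically, a1, a2, a3 rotating along with them, so that rotating
    the factors only permutes the conjuncts. *)
Definition sing6 (a0 a1 a2 a3 w x0 x1 y0 y1 z0 z1 : C) :=
  [/\ crit (gv a0 a1 (sv y0 y1) (dv y0 y1) (sv z0 z1) (dv z0 z1))
           (hv a2 a3 (sv y0 y1) (dv y0 y1) (sv z0 z1) (dv z0 z1))
           (w * (y0 * y1) * (z0 * z1)) x0 x1,
      crit (gv a0 a2 (sv z0 z1) (dv z0 z1) (sv x0 x1) (dv x0 x1))
           (hv a3 a1 (sv z0 z1) (dv z0 z1) (sv x0 x1) (dv x0 x1))
           (w * (z0 * z1) * (x0 * x1)) y0 y1 &
      crit (gv a0 a3 (sv x0 x1) (dv x0 x1) (sv y0 y1) (dv y0 y1))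
           (hv a1 a2 (sv x0 x1) (dv x0 x1) (sv y0 y1) (dv y0 y1))
           (w * (x0 * x1) * (y0 * y1)) z0 z1].

Lemma ix_eq i j : (i < 6)%N -> (j < 6)%N -> (ix i == ix j) = (i == j).
Proof. by move=> hi hj; rewrite -val_eqE /ix /= !inordK. Qed.

Lemma mderivXU n (i j : 'I_n) : mderiv i ('X_j : {mpoly C[n]}) = (j == i)%:R.
Proof.
rewrite mderivX mnm1E; case: eqVneq => [->|_]; last by rewrite scale0r.
rewrite scale1r; have -> : (U_(i) - U_(i) = 0)%MM by apply/mnmP => k; rewrite mnmBE mnm0E subnn.
by rewrite mpolyX0.
Qed.

Lemma m22 : (2 * 2)%N = 4%N. Proof. by []. Qed.

Lemma mderiv_Xv i j : (i < 6)%N -> (j < 6)%N ->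
  mderiv (ix i) (Xv C j) = if j == i then 1 else 0.
Proof. by move=> hi hj; rewrite mderivXU ix_eq //; case: (j == i). Qed.

Lemma mderiv_sP i k : (i < 6)%N -> (k < 3)%N ->
  mderiv (ix i) (sP C k) = if i./2 == k then 2%:R *: Xv C i else 0.
Proof.
move=> hi hk; rewrite /sP mderivD !expr2 !mderivM !mderiv_Xv //; try lia.
by case: k hk => [|[|[|]]] // hk; case: i hi => [|[|[|[|[|[|?]]]]]] // hi;
  rewrite ?m22 ?muln0 ?muln1 /= ?mul1r ?mulr1 ?mul0r ?mulr0 ?addr0 ?add0r // scaler_nat mulr2n.
Qed.

Lemma mderiv_dP i k : (i < 6)%N -> (k < 3)%N ->
  mderiv (ix i) (dP C k) =
  if i./2 == k then (if odd i then - (2%:R *: Xv C i) else 2%:R *: Xv C i) else 0.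
Proof.
move=> hi hk; rewrite /dP mderivB !expr2 !mderivM !mderiv_Xv //; try lia.
by case: k hk => [|[|[|]]] // hk; case: i hi => [|[|[|[|[|[|?]]]]]] // hi;
  rewrite ?m22 ?muln0 ?muln1 /= ?mul1r ?mulr1 ?mul0r ?mulr0 ?addr0 ?add0r ?oppr0 // ?sub0r;
  rewrite ?addr0 // scaler_nat mulr2n.
Qed.

Lemma mderiv_pP i k : (i < 6)%N -> (k < 3)%N ->
  mderiv (ix i) (pP C k) =
  if i./2 == k then (if odd i then Xv C i.-1 else Xv C i.+1) else 0.
Proof.
move=> hi hk; rewrite !mderivM !mderiv_Xv //; try lia.
by case: k hk => [|[|[|]]] // hk; case: i hi => [|[|[|[|[|[|?]]]]]] // hi;
  rewrite ?m22 ?muln0 ?muln1 /= ?mul1r ?mulr1 ?mul0r ?mulr0 ?addr0 ?add0r.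
Qed.

(** F is a trilinear form in the triples (s, d, p) of the three factors, so by the Leibniz rule its
    derivatives are values of the same form on derived triples. [trip] is the form on polynomials,
    [triv] on their values. *)
Definition tri3 := ({mpoly C[6]} * {mpoly C[6]} * {mpoly C[6]})%type.
Definition trip a (u v t : tri3) : {mpoly C[6]} :=
  a (inord 0) *: (u.1.1 * v.1.1 * t.1.1) + a (inord 1) *: (u.1.1 * v.1.2 * t.1.2)
  + a (inord 2) *: (u.1.2 * v.1.1 * t.1.2) + a (inord 3) *: (u.1.2 * v.1.2 * t.1.1)
  + a (inord 4) *: (u.2 * v.2 * t.2).
Definition triv a (u v t : C * C * C) : C :=
  a (inord 0) * (u.1.1 * v.1.1 * t.1.1) + a (inord 1) * (u.1.1 * v.1.2 * t.1.2)
  + a (inord 2) * (u.1.2 * v.1.1 * t.1.2) + a (inord 3) * (u.1.2 * v.1.2 * t.1.1)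
  + a (inord 4) * (u.2 * v.2 * t.2).
Definition tmap (T T' : Type) (f : T -> T') (u : T * T * T) : T' * T' * T' :=
  (f u.1.1, f u.1.2, f u.2).

Arguments trip : simpl never.
Arguments triv : simpl never.
Arguments tmap : simpl never.

Lemma meval_trip a u v t p : (trip a u v t).@[p] =
  triv a (tmap (meval p) u) (tmap (meval p) v) (tmap (meval p) t).
Proof.
case: u v t => [[u1 u2] u3] [[v1 v2] v3] [[t1 t2] t3].
by rewrite /trip /triv /tmap /= !mevalD !mevalZ !mevalM.
Qed.

Lemma mderiv_trip i a u v t : mderiv i (trip a u v t) =
  trip a (tmap (mderiv i) u) v t + trip a u (tmap (mderiv i) v) t
  + trip a u v (tmap (mderiv i) t).
Proof.
case: u v t => [[u1 u2] u3] [[v1 v2] v3] [[t1 t2] t3].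
rewrite /trip /tmap /= !mderivD !mderivZ !mderivM -!mul_mpolyC; ring.
Qed.

Definition zt : tri3 := (0, 0, 0).

Lemma trip0l a v t : trip a zt v t = 0.
Proof. by rewrite /trip /= !mul0r !scaler0 !addr0. Qed.
Lemma trip0m a u t : trip a u zt t = 0.
Proof. by rewrite /trip /= !mulr0 !mul0r !scaler0 !addr0. Qed.
Lemma trip0r a u v : trip a u v zt = 0.
Proof. by rewrite /trip /= !mulr0 !scaler0 !addr0. Qed.

Definition trip0 := (trip0l, trip0m, trip0r).

Definition tq k : tri3 := (sP C k, dP C k, pP C k).
Definition tq' i : tri3 :=
  (2%:R *: Xv C i, if odd i then - (2%:R *: Xv C i) else 2%:R *: Xv C i,
   if odd i then Xv C i.-1 else Xv C i.+1).
Definition tq'' i : tri3 :=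
  (2%:R *: 1, if odd i then - (2%:R *: 1) else 2%:R *: 1, 0).

Lemma Fa_trip a : Fa a = trip a (tq 0) (tq 1) (tq 2).
Proof. by []. Qed.

Lemma mderiv_tq i k : (i < 6)%N -> (k < 3)%N ->
  tmap (mderiv (ix i)) (tq k) = if i./2 == k then tq' i else zt.
Proof.
move=> hi hk; rewrite /tmap mderiv_sP // mderiv_dP // mderiv_pP //.
by case: ifP.
Qed.

Lemma mderiv_tq' i j : (i < 6)%N -> (j < 6)%N ->
  tmap (mderiv (ix i)) (tq' j) =
  if i./2 == j./2 then (if i == j then tq'' i else (0, 0, 1)) else zt.
Proof.
move=> hi hj; rewrite /tmap /tq' /=.
by case: j hj => [|[|[|[|[|[|?]]]]]] // hj; case: i hi => [|[|[|[|[|[|?]]]]]] // hi;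
  rewrite /= ?mderivN !mderivZ !mderiv_Xv //= ?scaler0 ?oppr0.
Qed.

Definition tqv p k : C * C * C :=
  (sv (p (ix (2 * k))) (p (ix (2 * k).+1)), dv (p (ix (2 * k))) (p (ix (2 * k).+1)),
   p (ix (2 * k)) * p (ix (2 * k).+1)).
Definition tqv' p i : C * C * C :=
  (2 * p (ix i), if odd i then - (2 * p (ix i)) else 2 * p (ix i),
   if odd i then p (ix i.-1) else p (ix i.+1)).
Definition tqv'' i : C * C * C := (2, if odd i then - 2 else 2, 0).

Lemma meval_tq p k : tmap (meval p) (tq k) = tqv p k.
Proof.
by rewrite /tmap /tq /tqv /sP /dP /pP /= mevalD mevalB !expr2 !mevalM !mevalXU.
Qed.

Lemma meval_tq' p i : tmap (meval p) (tq' i) = tqv' p i.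
Proof.
rewrite /tmap /tq' /tqv' /=.
by case: (odd i); rewrite ?mevalN !mevalZ !mevalXU.
Qed.

Lemma meval_tq'' p i : tmap (meval p) (tq'' i) = tqv'' i.
Proof.
rewrite /tmap /tq'' /tqv'' /= meval0.
by case: (odd i); rewrite ?mevalN !mevalZ !meval1 mulr1.
Qed.

Lemma onZE a p : (Fa a).@[p] = triv a (tqv p 0) (tqv p 1) (tqv p 2).
Proof. by rewrite Fa_trip meval_trip !meval_tq. Qed.

Lemma dFaE a p i : (i < 6)%N -> (mderiv (ix i) (Fa a)).@[p] =
  triv a (if i./2 == 0%N then tqv' p i else tqv p 0)
         (if i./2 == 1%N then tqv' p i else tqv p 1)
         (if i./2 == 2 then tqv' p i else tqv p 2).
Proof.
move=> hi; rewrite Fa_trip mderiv_trip !mderiv_tq //.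
case: i hi => [|[|[|[|[|[|?]]]]]] // hi;
  rewrite /= !trip0 ?add0r ?addr0.
all: by rewrite meval_trip !meval_tq meval_tq'.
Qed.

(** The last hypothesis leaves equal indices and indices from different factors: the Hessian uses
    one affine coordinate per factor. *)
Lemma ddFaE a p i j : (i < 6)%N -> (j < 6)%N -> (i./2 == j./2) = (i == j) ->
  (mderiv (ix i) (mderiv (ix j) (Fa a))).@[p] =
  let T k := if i == j then (if i./2 == k then tqv'' i else tqv p k) else
             if i./2 == k then tqv' p i else if j./2 == k then tqv' p j else tqv p k in
  triv a (T 0%N) (T 1%N) (T 2).
Proof.
move=> hi hj; rewrite Fa_trip (mderiv_trip (ix j)) !mderiv_tq //.
by case: i hi => [|[|[|[|[|[|?]]]]]] // hi; case: j hj => [|[|[|[|[|[|?]]]]]] // hj;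
  rewrite /= ?trip0 ?add0r ?addr0 ?mderiv_trip ?mderiv_tq ?mderiv_tq' //=
   ?trip0 ?add0r ?addr0 // meval_trip ?meval_tq ?meval_tq' ?meval_tq''.
Qed.

Lemma singZE a p : singZ a p <->
  sing6 (a (inord 0)) (a (inord 1)) (a (inord 2)) (a (inord 3)) (a (inord 4))
    (p (ix 0)) (p (ix 1)) (p (ix 2)) (p (ix 3)) (p (ix 4)) (p (ix 5)).
Proof.
have := @dFaE a p 0 isT; have := @dFaE a p 1 isT; have := @dFaE a p 2 isT.
have := @dFaE a p 3 isT; have := @dFaE a p 4 isT; have := @dFaE a p 5 isT.
rewrite /= /triv /tqv /tqv' /= ?m22 ?muln0 ?muln1 /sing6 /crit /gv /hv.
set x0 := p (ix 0); set x1 := p (ix 1); set y0 := p (ix 2); set y1 := p (ix 3).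
set z0 := p (ix 4); set z1 := p (ix 5) => E5 E4 E3 E2 E1 E0.
split=> [[_ H]|].
  have := (H (ix 0), H (ix 1), H (ix 2), H (ix 3), H (ix 4), H (ix 5)).
  rewrite E0 E1 E2 E3 E4 E5 => -[[[[[H0 H1] H2] H3] H4] H5].
  split; split; [rewrite -[RHS]H0|rewrite -[RHS]H1|rewrite -[RHS]H2
   |rewrite -[RHS]H3|rewrite -[RHS]H4|rewrite -[RHS]H5]; ring.
case=> -[H0 H1] [H2 H3] [H4 H5]; split; last first.
  move=> i; have -> : i = ix i by apply: val_inj; rewrite /= /ix inordK.
  case: i => -[|[|[|[|[|[|?]]]]]] // hi /=; rewrite ?E0 ?E1 ?E2 ?E3 ?E4 ?E5.
  - rewrite -[RHS]H0; ring.
  - rewrite -[RHS]H1; ring.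
  - rewrite -[RHS]H2; ring.
  - rewrite -[RHS]H3; ring.
  - rewrite -[RHS]H4; ring.
  - rewrite -[RHS]H5; ring.
rewrite /onZ onZE /triv /tqv /= ?m22 ?muln0 ?muln1 -/x0 -/x1 -/y0 -/y1 -/z0 -/z1.
have n2 : (2 : C) != 0 by rewrite pnatr_eq0.
(* Euler's relation in the first factor: 2 F is x0 times the first partial derivative plus x1 times
   the second. *)
apply: (mulfI n2); rewrite mulr0 -[RHS]addr0 -[X in _ = X + _](mulr0 x0) -[X in _ = _ * X + _]H0.
rewrite -[X in _ = _ + X](mulr0 x1) -[X in _ = _ + _ * X]H1 /sv /dv; ring.
Qed.

Definition det3 (h00 h11 h22 h01 h02 h12 : C) :=
  h00 * h11 * h22 + 2 * h01 * h02 * h12 - h00 * h12 ^+ 2 - h11 * h02 ^+ 2 - h22 * h01 ^+ 2.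

Lemma det_mx3 (N : nat -> nat -> C) : (forall i j, N i j = N j i) ->
  \det (\matrix_(i < 3, j < 3) N i j) =
  det3 (N 0%N 0%N) (N 1%N 1%N) (N 2 2) (N 0%N 1%N) (N 0%N 2) (N 1%N 2).
Proof.
move=> sym; rewrite (expand_det_row _ ord0) !big_ord_recl big_ord0 addr0 /cofactor.
rewrite !(expand_det_row _ ord0) !big_ord_recl !big_ord0 !addr0 /cofactor.
rewrite !det_mx11 !mxE /= /bump /= !(add0n, addn0, expr0, expr1, sqrrN, expr1n) /=.
rewrite (sym 1%N 0%N) (sym 2 0%N) (sym 2 1%N) /det3.
have -> : (1 + 1)%N = 2%N by [].
ring.
Qed.

(* [e = 1] is the chart v <> 0 of P^1 and [e = -1] the chart around (1 : 0)
   (there (u, v) = (x_1, x_0)); the triples are the values of s, d, p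
   and of their first and second derivatives with respect to u. *)
Definition cq (e u v : C) : C * C * C := (sv u v, e * dv u v, u * v).
Definition cq' (e u v : C) : C * C * C := (2 * u, e * (2 * u), v).
Definition cq'' (e : C) : C * C * C := (2, e * 2, 0).

Definition hdet a (e0 u0 v0 e1 u1 v1 e2 u2 v2 : C) :=
  det3 (triv a (cq'' e0) (cq e1 u1 v1) (cq e2 u2 v2))
       (triv a (cq e0 u0 v0) (cq'' e1) (cq e2 u2 v2))
       (triv a (cq e0 u0 v0) (cq e1 u1 v1) (cq'' e2))
       (triv a (cq' e0 u0 v0) (cq' e1 u1 v1) (cq e2 u2 v2))
       (triv a (cq' e0 u0 v0) (cq e1 u1 v1) (cq' e2 u2 v2))
       (triv a (cq e0 u0 v0) (cq' e1 u1 v1) (cq' e2 u2 v2)).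

Definition chart p k : C * C * C :=
  if p (ix (2 * k).+1) != 0 then (1, p (ix (2 * k)), p (ix (2 * k).+1))
  else (-1, p (ix (2 * k).+1), p (ix (2 * k))).

Definition cidx p k := if p (ix (2 * k).+1) != 0 then (2 * k)%N else (2 * k).+1.

(** [qdir] is a coordinate direction in each factor, so one of the four terms of each entry
    survives. *)
Lemma hess_chart a p (r s : 'I_3) :
  hess a p r s = (mderiv (ix (cidx p r)) (mderiv (ix (cidx p s)) (Fa a))).@[p].
Proof.
rewrite mxE.
have Q k : qdir p (2 * k) = (p (ix (2 * k).+1) != 0)%:R /\
           qdir p (2 * k + 1) = (p (ix (2 * k).+1) == 0)%:R.
  have q0 : (2 * k)./2 = k by rewrite mul2n doubleK.
  have q1 : (2 * k).+1./2 = k by rewrite mul2n -uphalfE uphalf_double.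
  by rewrite /qdir addn1 q0 q1 /= mul2n odd_double; case: eqP.
rewrite !big_ord_recl !big_ord0 /= /bump /= !addn0 !addr0.
have [-> ->] := Q r; have [-> ->] := Q s; rewrite /cidx !addn1.
by do 2!case: eqP => _ /=; rewrite !(mulr0, mulr1, mul0r, mul1r, addr0, add0r).
Qed.

Lemma tqvE p k : (k < 3)%N ->
  [/\ tqv p k = cq (chart p k).1.1 (chart p k).1.2 (chart p k).2,
      tqv' p (cidx p k) = cq' (chart p k).1.1 (chart p k).1.2 (chart p k).2 &
      tqv'' (cidx p k) = cq'' (chart p k).1.1].
Proof.
move=> k3; rewrite /tqv /tqv' /tqv'' /chart /cidx /cq /cq' /cq''.
by case: ifP => _ /=; rewrite ?mul2n ?oddS ?odd_double /= ?mul1r ?mulN1r //;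
  split=> //; rewrite /sv /dv ?opprB 1?addrC 1?[X in (_, _, X)]mulrC.
Qed.

Lemma hessE a p : \det (hess a p) =
  hdet a (chart p 0).1.1 (chart p 0).1.2 (chart p 0).2
         (chart p 1).1.1 (chart p 1).1.2 (chart p 1).2
         (chart p 2).1.1 (chart p 2).1.2 (chart p 2).2.
Proof.
pose N r s := (mderiv (ix (cidx p r)) (mderiv (ix (cidx p s)) (Fa a))).@[p].
have -> : hess a p = \matrix_(r < 3, s < 3) N r s.
  by apply/matrixP => r s; rewrite hess_chart mxE.
rewrite det_mx3; last by move=> r s; rewrite /N mderiv_comm.
have c6 k : (k < 3)%N -> (cidx p k < 6)%N by rewrite /cidx; case: ifP => _; lia.
have c2 k : (cidx p k)./2 = k.
  by rewrite /cidx; case: ifP => _; rewrite mul2n ?doubleK // -uphalfE uphalf_double.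
have cI r s : (cidx p r)./2 == (cidx p s)./2 = (cidx p r == cidx p s).
  rewrite !c2; apply/eqP/eqP => [->//|]; by rewrite -{2}(c2 r) -{2}(c2 s) => ->.
have cE r s : (cidx p r == cidx p s) = (r == s) by rewrite -cI !c2.
have [u0 u0' u0''] := @tqvE p 0 isT.
have [u1 u1' u1''] := @tqvE p 1 isT.
have [u2 u2' u2''] := @tqvE p 2 isT.
rewrite /N !ddFaE ?c6 ?cI // !cE !c2 /=.
by rewrite u0 u0' u0'' u1 u1' u1'' u2 u2' u2''.
Qed.
End Equations.

(** * Linear combinations of equations *)

Section LinearCombinations.
Variable R : comNzRingType.
Implicit Types x y u v c : R.

Lemma lc x y u v : u = v -> x - y = u - v -> x = y.
Proof. by move=> -> /eqP; rewrite subrr subr_eq0 => /eqP. Qed.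
Lemma lcD x y u v : x = y -> u = v -> x + u = y + v.
Proof. by move=> -> ->. Qed.
Lemma lcM c x y : x = y -> c * x = c * y.
Proof. by move=> ->. Qed.
End LinearCombinations.

(* [lincomb H] closes x = y when x - y equals, by [ring], the difference of
   the two sides of H; linear combinations H are built with [lcD] and [lcM]. *)
Ltac lincomb H := apply: (lc H); ring.

(** * The normalized equations and their angles *)

Section Triples.
Variable C : numClosedFieldType.

Let n2 : (2 : C) != 0. Proof. by rewrite pnatr_eq0. Qed.
Let n4 : (4 : C) != 0. Proof. by rewrite pnatr_eq0. Qed.

(* The singularity equations at a point with p = 1 in each factor, where
   b_i = 8 a_i / w and s_i, d_i are the values of s, d. *)
Definition trp (b0 b1 b2 b3 s0 d0 s1 d1 s2 d2 : C) :=
  [/\ [/\ s0 ^+ 2 - d0 ^+ 2 = 4, s1 ^+ 2 - d1 ^+ 2 = 4 & s2 ^+ 2 - d2 ^+ 2 = 4],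
      b0 * s1 * s2 + b1 * d1 * d2 = - (2 * s0) /\ b2 * s1 * d2 + b3 * d1 * s2 = 2 * d0,
      b0 * s2 * s0 + b2 * d2 * d0 = - (2 * s1) /\ b3 * s2 * d0 + b1 * d2 * s0 = 2 * d1 &
      b0 * s0 * s1 + b3 * d0 * d1 = - (2 * s2) /\ b1 * s0 * d1 + b2 * d0 * s1 = 2 * d2].

Lemma trp_rot b0 b1 b2 b3 s0 d0 s1 d1 s2 d2 :
  trp b0 b1 b2 b3 s0 d0 s1 d1 s2 d2 -> trp b0 b2 b3 b1 s1 d1 s2 d2 s0 d0.
Proof. by case=> -[? ? ?] ? ? ?. Qed.

Lemma sqr_fix (b x : C) : b ^+ 2 != 1 -> x = b ^+ 2 * x -> x = 0.
Proof.
move=> hb hx; have /eqP : (b ^+ 2 - 1) * x = 0 by lincomb (lcM (-1) hx).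
by rewrite mulf_eq0 subr_eq0 (negbTE hb) /= => /eqP.
Qed.

(** If s0 = 0, then d0^2 = -4, and eliminating d2 from two of the equations gives s1 = b2^2 s1, so
    s1 = 0; likewise s2 = 0. Then d2 = 0 contradicts s2^2 - d2^2 = 4. If d0 = 0, then s1 and d1
    vanish in the same way. *)
Lemma trp_neq0_first b0 b1 b2 b3 s0 d0 s1 d1 s2 d2 :
  b0 ^+ 2 != 1 -> b1 ^+ 2 != 1 -> b2 ^+ 2 != 1 -> b3 ^+ 2 != 1 ->
  trp b0 b1 b2 b3 s0 d0 s1 d1 s2 d2 -> s0 != 0 /\ d0 != 0.
Proof.
move=> h0 h1 h2 h3 [[c0 c1 c2] [A0 B0] [A1 B1] [A2 B2]].
split; apply/eqP => z.
- move: c0 A0 B0 A1 B1 A2 B2; rewrite z !(mulr0, mul0r, addr0, add0r, expr0n) /= => c0 A0 B0 A1 B1 A2 B2.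
  have s10 : s1 = 0.
    apply: (sqr_fix h2); apply: (mulfI n4).
    lincomb (lcD (lcM 2 A1) (lcD (lcM (b2 * d0) B2) (lcM (b2^+2 * s1) c0))).
  have s20 : s2 = 0.
    apply: (sqr_fix h3); apply: (mulfI n4).
    lincomb (lcD (lcM 2 A2) (lcD (lcM (b3 * d0) B1) (lcM (b3^+2 * s2) c0))).
  have d20 : d2 = 0 by apply: (mulfI n2); rewrite -B2 s10 !mulr0.
  by move: c2; rewrite s20 d20 expr0n subrr => /esym/eqP; rewrite (negbTE n4).
- move: c0 A0 B0 A1 B1 A2 B2; rewrite z !(mulr0, mul0r, addr0, add0r, expr0n, subr0) /= => c0 A0 B0 A1 B1 A2 B2.
  have s10 : s1 = 0.
    apply: (sqr_fix h0); apply: (mulfI n4).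
    lincomb (lcD (lcM 2 A1) (lcD (lcM (- (b0 * s0)) A2) (lcM (b0^+2 * s1) c0))).
  have d10 : d1 = 0.
    apply: (sqr_fix h1); apply: (mulfI n4).
    lincomb (lcD (lcM (-2) B1) (lcD (lcM (- (b1 * s0)) B2) (lcM (b1^+2 * d1) c0))).
  by move: c1; rewrite s10 d10 expr0n subrr => /esym/eqP; rewrite (negbTE n4).
Qed.

Section NonSpecial.
Variables b0 b1 b2 b3 s0 d0 s1 d1 s2 d2 : C.
Hypotheses (h0 : b0 ^+ 2 != 1) (h1 : b1 ^+ 2 != 1) (h2 : b2 ^+ 2 != 1) (h3 : b3 ^+ 2 != 1).
Hypothesis T : trp b0 b1 b2 b3 s0 d0 s1 d1 s2 d2.

Lemma trp_neq0 : [/\ s0 != 0, s1 != 0 & s2 != 0] /\ [/\ d0 != 0, d1 != 0 & d2 != 0].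
Proof.
have [] := trp_neq0_first h0 h1 h2 h3 T.
have [] := trp_neq0_first h0 h2 h3 h1 (trp_rot T).
by have [] := trp_neq0_first h0 h3 h1 h2 (trp_rot (trp_rot T)).
Qed.

(** The terms of F apart from the one in p, normalized so that F = 0 reads t0 + t1 + t2 + t3 = 4. *)
Definition t0 := - (b0 * s0 * s1 * s2 / 2).
Definition t1 := - (b1 * s0 * d1 * d2 / 2).
Definition t2 := - (b2 * d0 * s1 * d2 / 2).
Definition t3 := - (b3 * d0 * d1 * s2 / 2).

(** Each equation of [trp], multiplied by the s or d on its right side, becomes linear in the
    t_i. *)
Lemma trp_t : [/\ s0 ^+ 2 = t0 + t1, s1 ^+ 2 = t0 + t2, s2 ^+ 2 = t0 + t3,
  t0 + t1 + t2 + t3 = 4 &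
  [/\ d0 ^+ 2 = - (t2 + t3), d1 ^+ 2 = - (t1 + t3) & d2 ^+ 2 = - (t1 + t2)]].
Proof.
case: T => [[c0 c1 c2] [A0 B0] [A1 B1] [A2 B2]].
have E0 : s0 ^+ 2 = t0 + t1 by apply: (lc (lcM (s0 / 2) A0)); rewrite /t0 /t1; field.
have E1 : s1 ^+ 2 = t0 + t2 by apply: (lc (lcM (s1 / 2) A1)); rewrite /t0 /t2; field.
have E2 : s2 ^+ 2 = t0 + t3 by apply: (lc (lcM (s2 / 2) A2)); rewrite /t0 /t3; field.
have F0 : d0 ^+ 2 = - (t2 + t3) by apply: (lc (lcM (- (d0 / 2)) B0)); rewrite /t2 /t3; field.
have F1 : d1 ^+ 2 = - (t1 + t3) by apply: (lc (lcM (- (d1 / 2)) B1)); rewrite /t1 /t3; field.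
have F2 : d2 ^+ 2 = - (t1 + t2) by apply: (lc (lcM (- (d2 / 2)) B2)); rewrite /t1 /t2; field.
by split=> //; rewrite -c0 E0 F0; ring.
Qed.

(** Because the t_i add up to 4, (t_i + t_j)(t_i + t_k)(t_i + t_l) = 4 t_i^2 + e3 for every i; up to
    sign the factors on the left are squares of the s and d. *)
Let e3 := t1 * t2 * t3 + t0 * t2 * t3 + t0 * t1 * t3 + t0 * t1 * t2.

Lemma e1_sub : t3 = 4 - t0 - t1 - t2.
Proof. by have [_ _ _ <- _] := trp_t; ring. Qed.

Lemma pair_neq0 : [/\ t0 + t1 != 0, t0 + t2 != 0 & t0 + t3 != 0] /\
  [/\ t2 + t3 != 0, t1 + t3 != 0 & t1 + t2 != 0].
Proof.
have [<- <- <- _ [/eqP f0 /eqP f1 /eqP f2]] := trp_t.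
have [[x0 x1 x2] [y0 y1 y2]] := trp_neq0.
rewrite -eqr_oppLR in f0; rewrite -eqr_oppLR in f1; rewrite -eqr_oppLR in f2.
by rewrite -(eqP f0) -(eqP f1) -(eqP f2) !oppr_eq0 !sqrf_eq0.
Qed.

Lemma trp_b2 : [/\ b0 ^+ 2 * (4 * t0 ^+ 2 + e3) = 4 * t0 ^+ 2,
  b1 ^+ 2 * (4 * t1 ^+ 2 + e3) = 4 * t1 ^+ 2,
  b2 ^+ 2 * (4 * t2 ^+ 2 + e3) = 4 * t2 ^+ 2 &
  b3 ^+ 2 * (4 * t3 ^+ 2 + e3) = 4 * t3 ^+ 2].
Proof.
have [x0 x1 x2 sm [y0 y1 y2]] := trp_t.
have P0 : s0 ^+ 2 * s1 ^+ 2 * s2 ^+ 2 = 4 * t0 ^+ 2 + e3.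
  by rewrite x0 x1 x2 -sm /e3; ring.
have P1 : s0 ^+ 2 * d1 ^+ 2 * d2 ^+ 2 = 4 * t1 ^+ 2 + e3.
  by rewrite x0 y1 y2 -sm /e3; ring.
have P2 : d0 ^+ 2 * s1 ^+ 2 * d2 ^+ 2 = 4 * t2 ^+ 2 + e3.
  by rewrite y0 x1 y2 -sm /e3; ring.
have P3 : d0 ^+ 2 * d1 ^+ 2 * s2 ^+ 2 = 4 * t3 ^+ 2 + e3.
  by rewrite y0 y1 x2 -sm /e3; ring.
rewrite -P0 -P1 -P2 -P3 /t0 /t1 /t2 /t3.
by split; field.
Qed.

(** If e3 = 0, then b_i^2 t_i^2 = t_i^2 with b_i^2 <> 1 kills t0 and t1, against s0^2 = t0 + t1 <>
    0. *)
Lemma e3_neq0 : e3 != 0.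
Proof.
apply/eqP => z; have [] := trp_b2; rewrite z !addr0.
have h b t : b ^+ 2 != 1 -> b ^+ 2 * (4 * t ^+ 2) = 4 * t ^+ 2 -> t = 0 :> C.
  move=> hb hx; have : 4 * t ^+ 2 = 0 by apply: (sqr_fix hb).
  by move/eqP; rewrite mulf_eq0 (negbTE n4) sqrf_eq0 => /eqP.
move=> /(h _ _ h0) z0 /(h _ _ h1) z1 _ _.
by have [[]] := pair_neq0; rewrite z0 z1 addr0 eqxx.
Qed.

(* Up to the substitution b_i = 8 a_i / w this is the equation of the closure of N. *)
Lemma trp_disc : (2 - b0 ^+ 2 - b1 ^+ 2 - b2 ^+ 2 - b3 ^+ 2 + 2 * (b0 * b1 * b2 * b3)) ^+ 2
  = 4 * ((1 - b0 ^+ 2) * (1 - b1 ^+ 2) * (1 - b2 ^+ 2) * (1 - b3 ^+ 2)).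
Proof.
have [x0 x1 x2 sm [y0 y1 y2]] := trp_t.
have [[p0 p1 p2] [q0 q1 q2]] := pair_neq0.
have [[z0 z1 z2] [w0 w1 w2]] := trp_neq0.
have B0 : b0 ^+ 2 = 4 * t0 ^+ 2 / ((t0 + t1) * (t0 + t2) * (t0 + t3)).
  by rewrite -x0 -x1 -x2 /t0; field; rewrite z0 z1 z2.
have m1 (x y : C) : x = - y -> y = - x by move=> ->; rewrite opprK.
have B1 : b1 ^+ 2 = 4 * t1 ^+ 2 / ((t0 + t1) * (t1 + t3) * (t1 + t2)).
  by rewrite -x0 (m1 _ _ y1) (m1 _ _ y2) /t1; field; rewrite z0 w1 w2.
have B2 : b2 ^+ 2 = 4 * t2 ^+ 2 / ((t2 + t3) * (t0 + t2) * (t1 + t2)).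
  by rewrite -x1 (m1 _ _ y0) (m1 _ _ y2) /t2; field; rewrite z1 w0 w2.
have B3 : b3 ^+ 2 = 4 * t3 ^+ 2 / ((t2 + t3) * (t1 + t3) * (t0 + t3)).
  by rewrite -x2 (m1 _ _ y0) (m1 _ _ y1) /t3; field; rewrite z2 w0 w1.
have BB : b0 * b1 * b2 * b3 = - (16 * (t0 * t1 * t2 * t3)) /
  ((t0 + t1) * (t0 + t2) * (t0 + t3) * ((t2 + t3) * (t1 + t3) * (t1 + t2))).
  rewrite -x0 -x1 -x2 (m1 _ _ y0) (m1 _ _ y1) (m1 _ _ y2) /t0 /t1 /t2 /t3; field.
  by rewrite z0 z1 z2 w0 w1 w2.
(* With t3 = 4 - t0 - t1 - t2 a rational identity in three free variables remains. *)
rewrite BB B0 B1 B2 B3 {x0 x1 x2 y0 y1 y2 B0 B1 B2 B3 BB}.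
move: p0 p1 p2 q0 q1 q2; rewrite e1_sub; move: t0 t1 t2 => u0 u1 u2 p0 p1 p2 q0 q1 q2.
by field; rewrite p0 p1 p2 q0 q1 q2.
Qed.

(** This is the part of the mixed second derivative in the first two factors that comes from a_0,
    ..., a_3. Expanded, it consists of the equation F = 0, four singularity equations, and the sum
    [f12], in which s and d are exchanged in the first two factors. *)
Lemma trp_off : (s0 + d0) * (s1 + d1) * ((b0 + b3) * s2 + (b1 + b2) * d2) =
  - 8 - 8 * (t0 * t3 - t1 * t2) / (s0 * d0 * (s1 * d1)).
Proof.
have [x0 x1 x2 sm [y0 y1 y2]] := trp_t.
have [[z0 z1 z2] [w0 w1 w2]] := trp_neq0.
case: T => [[c0 c1 c2] [A0 B0] [A1 B1] [A2 B2]].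
have f12 : (b0 * d0 * d1 * s2 + b1 * d0 * s1 * d2 + b2 * s0 * d1 * d2 + b3 * s0 * s1 * s2)
    = - 8 * (t0 * t3 - t1 * t2) / (s0 * d0 * (s1 * d1)).
  have n : s0 * d0 * (s1 * d1) != 0 by rewrite !mulf_neq0.
  apply: (mulIf n); rewrite divfK //.
  transitivity (- 2 * (t0 * (d0 ^+ 2 * d1 ^+ 2) + t1 * (d0 ^+ 2 * s1 ^+ 2)
                + t2 * (s0 ^+ 2 * d1 ^+ 2) + t3 * (s0 ^+ 2 * s1 ^+ 2))).
    by rewrite /t0 /t1 /t2 /t3; field.
  rewrite x0 x1 y0 y1 e1_sub; ring.
have m8 : b0 * s0 * s1 * s2 + b1 * s0 * d1 * d2 + b2 * d0 * s1 * d2 + b3 * d0 * d1 * s2 = - 8.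
  by apply: (lc (lcM (-2) sm)); rewrite /t0 /t1 /t2 /t3; field.
apply: (lc (lcD m8 (lcD f12 (lcD (lcD (lcM d0 A0) (lcM s0 B0)) (lcD (lcM d1 A1) (lcM s1 B1)))))).
ring.
Qed.

(** Up to a nonzero factor this is the determinant of the Hessian at the singular point. It equals -
    4 e3^2, which is why the singularity is a node. *)
Lemma trp_hess :
  (s0 * d0) ^+ 2 * (s1 * d1) ^+ 2 * (s2 * d2) ^+ 2
  + 2 * ((t0 * t3 - t1 * t2) * (t0 * t2 - t1 * t3) * (t0 * t1 - t2 * t3))
  - (t0 * t3 - t1 * t2) ^+ 2 * (s2 * d2) ^+ 2 - (t0 * t2 - t1 * t3) ^+ 2 * (s1 * d1) ^+ 2
  - (t0 * t1 - t2 * t3) ^+ 2 * (s0 * d0) ^+ 2 != 0.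
Proof.
have [x0 x1 x2 sm [y0 y1 y2]] := trp_t.
set D := (X in X != 0).
have -> : D = - (4 * e3 ^+ 2); last by rewrite oppr_eq0 mulf_neq0 ?expf_neq0 ?e3_neq0.
rewrite /D !exprMn x0 x1 x2 y0 y1 y2 /e3 e1_sub; ring.
Qed.
End NonSpecial.

(* The angles: b_i = sin(theta_i), k_i = cos(theta_i), with the theta_i summing to 0;
   the three middle conditions say sin(theta_0 + theta_j) = - sin(theta_k + theta_l). *)
Definition kdata (b0 b1 b2 b3 k0 k1 k2 k3 : C) :=
  [/\ [/\ k0 != 0, k1 != 0, k2 != 0 & k3 != 0],
      [/\ k0 ^+ 2 = 1 - b0 ^+ 2, k1 ^+ 2 = 1 - b1 ^+ 2,
          k2 ^+ 2 = 1 - b2 ^+ 2 & k3 ^+ 2 = 1 - b3 ^+ 2],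
      [/\ b0 * k1 + b1 * k0 = - (b2 * k3 + b3 * k2),
          b0 * k2 + b2 * k0 = - (b1 * k3 + b3 * k1) &
          b0 * k3 + b3 * k0 = - (b1 * k2 + b2 * k1)] &
      [/\ b0 * k1 + b1 * k0 != 0, b0 * k2 + b2 * k0 != 0 & b0 * k3 + b3 * k0 != 0]].

Lemma kdataN b0 b1 b2 b3 k0 k1 k2 k3 :
  kdata b0 b1 b2 b3 k0 k1 k2 k3 -> kdata b0 b1 b2 b3 (- k0) (- k1) (- k2) (- k3).
Proof.
move=> [[? ? ? ?] K [R1 R2 R3] [? ? ?]].
split; rewrite ?oppr_eq0 ?sqrrN //; rewrite !mulrN -!opprD ?oppr_eq0 //.
by split; rewrite ?R1 ?R2 ?R3.
Qed.

(** Let P_i be the product of s and d in t_i, so that b_i = - 2 t_i / P_i. With 4 mu^2 = e3 and k_i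
    = - 2 mu / P_i one gets b_i^2 + k_i^2 = (4 t_i^2 + e3) / P_i^2 = 1. That all k_i P_i are equal
    is kept for [trp_unique]. *)
Lemma trp_kdata b0 b1 b2 b3 s0 d0 s1 d1 s2 d2 :
  b0 ^+ 2 != 1 -> b1 ^+ 2 != 1 -> b2 ^+ 2 != 1 -> b3 ^+ 2 != 1 ->
  trp b0 b1 b2 b3 s0 d0 s1 d1 s2 d2 ->
  exists mu k0 k1 k2 k3, mu != 0 /\ kdata b0 b1 b2 b3 k0 k1 k2 k3 /\
    [/\ k0 * (s0 * s1 * s2) = - 2 * mu, k1 * (s0 * d1 * d2) = - 2 * mu,
        k2 * (d0 * s1 * d2) = - 2 * mu & k3 * (d0 * d1 * s2) = - 2 * mu].
Proof.
move=> h0 h1 h2 h3 T.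
have [x0 x1 x2 sm [y0 y1 y2]] := trp_t T.
have [[z0 z1 z2] [w0 w1 w2]] := trp_neq0 h0 h1 h2 h3 T.
have [B0 B1 B2 B3] := trp_b2 T.
have := e3_neq0 h0 h1 h2 h3 T.
set e := _ + _ + _ + _ => en0.
pose mu := sqrtC e / 2.
have mu2 : 4 * mu ^+ 2 = e by rewrite /mu expr_div_n sqrtCK; field.
have mun0 : mu != 0.
  by apply: contraNneq en0 => m0; rewrite -mu2 m0 expr0n mulr0.
have p4 : 4 * mu ^+ 2 != 0 by rewrite mu2.
have m1 (x y : C) : x = - y -> y = - x by move=> ->; rewrite opprK.
have kk (b t k P : C) : P != 0 -> P ^+ 2 = 4 * t ^+ 2 + e -> b ^+ 2 * (4 * t ^+ 2 + e) = 4 * t ^+ 2 ->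
    k = - 2 * mu / P -> k ^+ 2 = 1 - b ^+ 2.
  move=> Pn0 hP hb ->; have P2 : P ^+ 2 != 0 by rewrite sqrf_eq0.
  apply: (mulIf P2); rewrite expr_div_n divfK // mulrBl mul1r.
  rewrite hP hb -mu2; ring.
exists mu, (- 2 * mu / (s0 * s1 * s2)), (- 2 * mu / (s0 * d1 * d2)),
  (- 2 * mu / (d0 * s1 * d2)), (- 2 * mu / (d0 * d1 * s2)).
have P0 : s0 * s1 * s2 != 0 by rewrite !mulf_neq0.
have P1 : s0 * d1 * d2 != 0 by rewrite !mulf_neq0.
have P2 : d0 * s1 * d2 != 0 by rewrite !mulf_neq0.
have P3 : d0 * d1 * s2 != 0 by rewrite !mulf_neq0.
split=> //; split; last by rewrite !divfK.
have mn2 : - 2 * mu != 0 by rewrite mulf_neq0 // oppr_eq0.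
have bP (b P : C) : P != 0 -> b = - 2 * (- (b * P / 2)) / P by move=> Pn0; field.
(* The sine of a sum of two angles is 4 mu (t + t') / (P P'), and t + t' is a square s^2 or the
   negative of a square d^2. *)
have qq (b b' P P' r r' : C) : P != 0 -> P' != 0 -> - (b * P / 2) + - (b' * P' / 2) = r ->
    4 * mu * r = r' * (P * P') -> b * (- 2 * mu / P') + b' * (- 2 * mu / P) = r'.
  move=> Pn0 Pn0' hr hr'; apply: (mulIf (mulf_neq0 Pn0 Pn0')); rewrite -hr' -hr.
  by field; rewrite Pn0 Pn0'.
have bs b x y z : t0 b x y z = - (b * (x * y * z) / 2) by rewrite /t0 !mulrA.
have bs1 b x y z : t1 b x y z = - (b * (x * y * z) / 2) by rewrite /t1 !mulrA.
have bs2 b x y z : t2 b x y z = - (b * (x * y * z) / 2) by rewrite /t2 !mulrA.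
have bs3 b x y z : t3 b x y z = - (b * (x * y * z) / 2) by rewrite /t3 !mulrA.
have K0 := kk _ _ _ _ P0 _ B0 erefl; have K1 := kk _ _ _ _ P1 _ B1 erefl.
have K2 := kk _ _ _ _ P2 _ B2 erefl; have K3 := kk _ _ _ _ P3 _ B3 erefl.
have Q01 : b0 * (- 2 * mu / (s0 * d1 * d2)) + b1 * (- 2 * mu / (s0 * s1 * s2)) = 4 * mu / (s1 * s2 * d1 * d2).
  apply: (qq _ _ _ _ (s0 ^+ 2)) => //; first by rewrite x0 bs bs1.
  by field; rewrite z1 z2 w1 w2.
have Q02 : b0 * (- 2 * mu / (d0 * s1 * d2)) + b2 * (- 2 * mu / (s0 * s1 * s2)) = 4 * mu / (s0 * s2 * d0 * d2).
  apply: (qq _ _ _ _ (s1 ^+ 2)) => //; first by rewrite x1 bs bs2.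
  by field; rewrite z0 z2 w0 w2.
have Q03 : b0 * (- 2 * mu / (d0 * d1 * s2)) + b3 * (- 2 * mu / (s0 * s1 * s2)) = 4 * mu / (s0 * s1 * d0 * d1).
  apply: (qq _ _ _ _ (s2 ^+ 2)) => //; first by rewrite x2 bs bs3.
  by field; rewrite z0 z1 w0 w1.
have Q23 : b2 * (- 2 * mu / (d0 * d1 * s2)) + b3 * (- 2 * mu / (d0 * s1 * d2)) = - (4 * mu / (s1 * s2 * d1 * d2)).
  apply: (qq _ _ _ _ (- d0 ^+ 2)) => //; first by rewrite y0 opprK bs2 bs3.
  by field; rewrite z1 z2 w1 w2.
have Q13 : b1 * (- 2 * mu / (d0 * d1 * s2)) + b3 * (- 2 * mu / (s0 * d1 * d2)) = - (4 * mu / (s0 * s2 * d0 * d2)).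
  apply: (qq _ _ _ _ (- d1 ^+ 2)) => //; first by rewrite y1 opprK bs1 bs3.
  by field; rewrite z0 z2 w0 w2.
have Q12 : b1 * (- 2 * mu / (d0 * s1 * d2)) + b2 * (- 2 * mu / (s0 * d1 * d2)) = - (4 * mu / (s0 * s1 * d0 * d1)).
  apply: (qq _ _ _ _ (- d2 ^+ 2)) => //; first by rewrite y2 opprK bs1 bs2.
  by field; rewrite z0 z1 w0 w1.
have PP0 : (s0 * s1 * s2) ^+ 2 = 4 * t0 b0 s0 s1 s2 ^+ 2 + e by rewrite !exprMn x0 x1 x2 -sm /e; ring.
have PP1 : (s0 * d1 * d2) ^+ 2 = 4 * t1 b1 s0 d1 d2 ^+ 2 + e by rewrite !exprMn x0 y1 y2 -sm /e; ring.
have PP2 : (d0 * s1 * d2) ^+ 2 = 4 * t2 b2 d0 s1 d2 ^+ 2 + e by rewrite !exprMn y0 x1 y2 -sm /e; ring.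
have PP3 : (d0 * d1 * s2) ^+ 2 = 4 * t3 b3 d0 d1 s2 ^+ 2 + e by rewrite !exprMn y0 y1 x2 -sm /e; ring.
split; first by split; rewrite mulf_neq0 ?invr_eq0.
- by rewrite (K0 PP0) (K1 PP1) (K2 PP2) (K3 PP3).
- by rewrite Q01 Q02 Q03 Q23 Q13 Q12 !opprK.
- have m4 : 4 * mu != 0 by rewrite mulf_neq0.
  by rewrite Q01 Q02 Q03; split; rewrite mulf_neq0 ?invr_eq0 // !mulf_neq0.
Qed.

(** Each l_i is k_i or - k_i. In each of the seven other sign patterns, sums or differences of the
    two sets of relations make one of the sines b0 k_i + b_i k0 vanish. *)
Lemma kdata_unique_aux b0 b1 b2 b3 k0 k1 k2 k3 l1 l2 l3 :
  kdata b0 b1 b2 b3 k0 k1 k2 k3 -> kdata b0 b1 b2 b3 k0 l1 l2 l3 ->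
  [/\ l1 = k1, l2 = k2 & l3 = k3].
Proof.
move=> [[k0n k1n k2n k3n] [_ K1 K2 K3] [R1 R2 R3] [r1 r2 r3]].
move=> [_ [_ L1 L2 L3] [S1 S2 S3] _].
have sq (l k b : C) : l ^+ 2 = 1 - b ^+ 2 -> k ^+ 2 = 1 - b ^+ 2 -> l = k \/ l = - k.
  by move=> hl hk; have /eqP := etrans hl (esym hk); rewrite eqf_sqr => /orP[]/eqP; [left|right].
have z (b k : C) : k != 0 -> 2 * (b * k) = 0 -> b = 0.
  by move=> kn /eqP; rewrite !mulf_eq0 (negbTE n2) (negbTE kn) orbF => /eqP.
have [E1|E1] := sq _ _ _ L1 K1; have [E2|E2] := sq _ _ _ L2 K2;
  have [E3|E3] := sq _ _ _ L3 K3; rewrite E1 E2 E3 in S1 S2 S3 *; try (by split); exfalso.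
- have b00 : b0 = 0 by apply: (z _ k3) => //; lincomb (lcD R3 (lcM (-1) S3)).
  have b20 : b2 = 0 by apply: (z _ k3) => //; lincomb (lcD R1 (lcM (-1) S1)).
  by move: r2; rewrite b00 b20 !mul0r addr0 eqxx.
- have b00 : b0 = 0 by apply: (z _ k2) => //; lincomb (lcD R2 (lcM (-1) S2)).
  have b30 : b3 = 0 by apply: (z _ k2) => //; lincomb (lcD R1 (lcM (-1) S1)).
  by move: r3; rewrite b00 b30 !mul0r addr0 eqxx.
- by case/eqP: r1; apply: (mulfI n2); lincomb (lcD R1 S1).
- have b00 : b0 = 0 by apply: (z _ k1) => //; lincomb (lcD R1 (lcM (-1) S1)).
  have b30 : b3 = 0 by apply: (z _ k1) => //; lincomb (lcD R2 (lcM (-1) S2)).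
  by move: r3; rewrite b00 b30 !mul0r addr0 eqxx.
- by case/eqP: r2; apply: (mulfI n2); lincomb (lcD R2 S2).
- by case/eqP: r3; apply: (mulfI n2); lincomb (lcD R3 S3).
- have b10 : b1 = 0 by apply: (z _ k0) => //; lincomb (lcD R1 S1).
  have b20 : b2 = 0 by apply: (z _ k0) => //; lincomb (lcD R2 S2).
  by move: r3; rewrite R3 b10 b20 !mul0r addr0 oppr0 eqxx.
Qed.

Lemma kdata_unique b0 b1 b2 b3 k0 k1 k2 k3 l0 l1 l2 l3 :
  kdata b0 b1 b2 b3 k0 k1 k2 k3 -> kdata b0 b1 b2 b3 l0 l1 l2 l3 ->
  [/\ l0 = k0, l1 = k1, l2 = k2 & l3 = k3] \/
  [/\ l0 = - k0, l1 = - k1, l2 = - k2 & l3 = - k3].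
Proof.
move=> K L; have [_ [K0 _ _ _] _ _] := K; have [_ [L0 _ _ _] _ _] := L.
have /eqP := etrans L0 (esym K0); rewrite eqf_sqr => /orP[]/eqP E.
  by left; rewrite E in L *; have [-> -> ->] := kdata_unique_aux K L.
right; have := kdataN L; rewrite {1}E opprK => /(kdata_unique_aux K)[<- <- <-].
by rewrite !opprK.
Qed.

(** Both solutions have the same cosines up to a common sign, which is absorbed into nu. Once nu =
    mu, the products P_i agree, then the t_i, then all s^2 and d^2; equality of the P_i restricts
    the six signs to the eight choices stated. *)
Lemma trp_unique b0 b1 b2 b3 s0 d0 s1 d1 s2 d2 x0 y0 x1 y1 x2 y2 :
  b0 ^+ 2 != 1 -> b1 ^+ 2 != 1 -> b2 ^+ 2 != 1 -> b3 ^+ 2 != 1 ->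
  trp b0 b1 b2 b3 s0 d0 s1 d1 s2 d2 -> trp b0 b1 b2 b3 x0 y0 x1 y1 x2 y2 ->
  exists e0 e1 e2 c : C,
    [/\ e0 ^+ 2 = 1, e1 ^+ 2 = 1, e2 ^+ 2 = 1, c ^+ 2 = 1 & e0 * e1 * e2 = 1] /\
    [/\ x0 = e0 * s0, x1 = e1 * s1, x2 = e2 * s2 &
     [/\ y0 = c * e0 * d0, y1 = c * e1 * d1 & y2 = c * e2 * d2]].
Proof.
move=> h0 h1 h2 h3 T T'.
have [sq0 sq1 sq2 sm [dq0 dq1 dq2]] := trp_t T.
have [sq0' sq1' sq2' sm' [dq0' dq1' dq2']] := trp_t T'.
have [[z0 z1 z2] [w0 w1 w2]] := trp_neq0 h0 h1 h2 h3 T.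
have [mu [k0 [k1 [k2 [k3 [mun0 [K [P0 P1 P2 P3]]]]]]]] := trp_kdata h0 h1 h2 h3 T.
have [mu' [l0 [l1 [l2 [l3 [mun0' [L [Q0 Q1 Q2 Q3]]]]]]]] := trp_kdata h0 h1 h2 h3 T'.
have {L Q0 Q1 Q2 Q3 mun0'} [nu [R0 R1 R2 R3]] : exists nu,
    [/\ k0 * (x0 * x1 * x2) = - 2 * nu, k1 * (x0 * y1 * y2) = - 2 * nu,
        k2 * (y0 * x1 * y2) = - 2 * nu & k3 * (y0 * y1 * x2) = - 2 * nu].
  case: (kdata_unique K L) => -[E0 E1 E2 E3].
    by exists mu'; rewrite -E0 -E1 -E2 -E3.
  exists (- mu'); rewrite -[k0]opprK -[k1]opprK -[k2]opprK -[k3]opprK -E0 -E1 -E2 -E3.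
  by rewrite !mulNr Q0 Q1 Q2 Q3 !mulNr !mulrN opprK.
have [[k0n k1n k2n k3n] _ _ _] := K.
(* For both solutions the t_i add up to 4, and nu t_i = mu t'_i for each i. *)
have numu : nu = mu.
  have E (k P P' b r : C) : k != 0 -> k * P = - 2 * mu -> k * P' = - 2 * nu ->
      nu * (- (b * P / 2)) = mu * (- (b * P' / 2)).
    by move=> kn hP hP'; apply: (mulfI kn);
      lincomb (lcD (lcM (- (nu * b / 2)) hP) (lcM (mu * b / 2) hP')).
  apply: (mulIf n4); rewrite -{1}sm -sm' !mulrDr /t0 /t1 /t2 /t3.
  have := E _ _ _ b0 0 k0n P0 R0; have := E _ _ _ b1 0 k1n P1 R1.
  have := E _ _ _ b2 0 k2n P2 R2; have := E _ _ _ b3 0 k3n P3 R3.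
  by rewrite !mulrA => -> -> -> ->.
rewrite numu in R0 R1 R2 R3 => {nu numu}.
have PE (k P P' : C) : k != 0 -> k * P = - 2 * mu -> k * P' = - 2 * mu -> P' = P.
  by move=> kn hP hP'; apply: (mulfI kn); rewrite hP hP'.
have {R0}U0 := PE _ _ _ k0n P0 R0; have {R1}U1 := PE _ _ _ k1n P1 R1.
have {R2}U2 := PE _ _ _ k2n P2 R2; have {R3 PE}U3 := PE _ _ _ k3n P3 R3.
have v0 : t0 b0 x0 x1 x2 = t0 b0 s0 s1 s2 by rewrite /t0 -!(mulrA b0) U0.
have v1 : t1 b1 x0 y1 y2 = t1 b1 s0 d1 d2 by rewrite /t1 -!(mulrA b1) U1.
have v2 : t2 b2 y0 x1 y2 = t2 b2 d0 s1 d2 by rewrite /t2 -!(mulrA b2) U2.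
have v3 : t3 b3 y0 y1 x2 = t3 b3 d0 d1 s2 by rewrite /t3 -!(mulrA b3) U3.
rewrite v0 v1 -sq0 in sq0'; rewrite v0 v2 -sq1 in sq1'; rewrite v0 v3 -sq2 in sq2'.
rewrite v2 v3 -dq0 in dq0'; rewrite v1 v3 -dq1 in dq1'; rewrite v1 v2 -dq2 in dq2'.
have sg (x s : C) : s != 0 -> x ^+ 2 = s ^+ 2 -> exists2 e : C, e ^+ 2 = 1 & x = e * s.
  by move=> sn hx; exists (x / s); rewrite ?divfK // expr_div_n hx divff ?sqrf_eq0.
have [e0 e02 E0] := sg _ _ z0 sq0'; have [e1 e12 E1] := sg _ _ z1 sq1'.
have [e2 e22 E2] := sg _ _ z2 sq2'; have [f0 f02 F0] := sg _ _ w0 dq0'.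
have [f1 f12 F1] := sg _ _ w1 dq1'; have [f2 f22 F2] := sg _ _ w2 dq2'.
have M0 : e0 * e1 * e2 = 1.
  by apply: (mulIf (mulf_neq0 (mulf_neq0 z0 z1) z2)); rewrite mul1r -[RHS]U0 E0 E1 E2; ring.
have M2 : f0 * e1 * f2 = 1.
  by apply: (mulIf (mulf_neq0 (mulf_neq0 w0 z1) w2)); rewrite mul1r -[RHS]U2 F0 E1 F2; ring.
have M3 : f0 * f1 * e2 = 1.
  by apply: (mulIf (mulf_neq0 (mulf_neq0 w0 w1) z2)); rewrite mul1r -[RHS]U3 F0 F1 E2; ring.
exists e0, e1, e2, (f0 * e0); split.
  by split=> //; rewrite exprMn f02 e02 mulr1.
have G1 : f1 = f0 * e0 * e1.
  lincomb (lcD (lcM (f0 * e2) M3) (lcD (lcM (- f0 * e2) M0) (lcD (lcM (- f1) f02)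
    (lcM (- f1 * f0 ^+ 2 + f0 * e0 * e1) e22)))).
have G2 : f2 = f0 * e0 * e2.
  lincomb (lcD (lcM (f0 * e1) M2) (lcD (lcM (- f0 * e1) M0) (lcD (lcM (- f2) f02)
    (lcM (- f2 * f0 ^+ 2 + f0 * e0 * e2) e12)))).
split=> //; split; last 2 first.
- by rewrite F1 G1.
- by rewrite F2 G2.
by rewrite F0 -(mulrA f0) -expr2 e02 mulr1.
Qed.

Section Rotate.
Variables b0 b1 b2 b3 k0 k1 k2 k3 : C.
Hypotheses (K0 : k0 ^+ 2 = 1 - b0 ^+ 2) (K2 : k2 ^+ 2 = 1 - b2 ^+ 2) (K3 : k3 ^+ 2 = 1 - b3 ^+ 2).
Hypothesis E1 : k0 * k1 - b0 * b1 = k2 * k3 - b2 * b3.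
Hypothesis R1 : b0 * k1 + b1 * k0 = - (b2 * k3 + b3 * k2).

(* With z_j = k_j + i b_j and bar z_j = k_j - i b_j = 1 / z_j, the hypotheses say
   z_0 z_1 = bar (z_2 z_3); multiply by z_2 / z_1. *)
Lemma kdata_rot : k0 * k2 - b0 * b2 = k1 * k3 - b1 * b3 /\
  b0 * k2 + b2 * k0 = - (b1 * k3 + b3 * k1).
Proof.
split.
- lincomb (lcD (lcM (- (k0 * k2 - b0 * b2)) K3) (lcD (lcM (k1 * k3 - b1 * b3) K0)
   (lcD (lcM (- (k0 * k3 + b0 * b3)) E1) (lcM (- (b0 * k3 - k0 * b3)) R1)))).
- lincomb (lcD (lcM (- (k0 * b2 + b0 * k2)) K3) (lcD (lcM (- (k1 * b3 + b1 * k3)) K0)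
   (lcD (lcM (k0 * k3 + b0 * b3) R1) (lcM (- (b0 * k3 - k0 * b3)) E1)))).
Qed.

Hypothesis R3 : b0 * k3 + b3 * k0 = - (b1 * k2 + b2 * k1).

(** For angles with sum 0, sin(theta_0 + theta_2) sin(theta_0 + theta_3) is half of cos(theta_2 -
    theta_3) - cos(theta_0 - theta_1); [E1] turns this into the left side. *)
Lemma kdata_sin_sin : k2 * k3 - k0 * k1 = (b0 * k2 + b2 * k0) * (b0 * k3 + b3 * k0).
Proof.
lincomb (lcD (lcM (- (b0 * k2 + b2 * k0)) R3) (lcD (lcM (b0 * b1 - b2 * b3) K2)
  (lcD (lcM (b2 ^+ 2 - 1) E1) (lcM (b2 * k2) R1)))).
Qed.
End Rotate.

(** Three squarings are undone in turn. The sign of k0 corrects the product of the cosines, the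
    signs of k0 and k2 give cos(theta_0 + theta_1) = cos(theta_2 + theta_3), and the signs of k2 and
    k3 make the corresponding sines opposite. Each change keeps what the earlier ones achieved. *)
Lemma disc_cos (b0 b1 b2 b3 : C) :
  (2 - b0 ^+ 2 - b1 ^+ 2 - b2 ^+ 2 - b3 ^+ 2 + 2 * (b0 * b1 * b2 * b3)) ^+ 2
  = 4 * ((1 - b0 ^+ 2) * (1 - b1 ^+ 2) * (1 - b2 ^+ 2) * (1 - b3 ^+ 2)) ->
  exists k0 k1 k2 k3 : C,
    [/\ k0 ^+ 2 = 1 - b0 ^+ 2, k1 ^+ 2 = 1 - b1 ^+ 2,
        k2 ^+ 2 = 1 - b2 ^+ 2 & k3 ^+ 2 = 1 - b3 ^+ 2] /\
    k0 * k1 - b0 * b1 = k2 * k3 - b2 * b3 /\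
    b0 * k1 + b1 * k0 = - (b2 * k3 + b3 * k2).
Proof.
move=> disc; set q := 2 - _ - _ - _ - _ + _ in disc.
have [k0 [k1 [k2 [k3 [K Kq]]]]] : exists k0 k1 k2 k3 : C,
    [/\ k0 ^+ 2 = 1 - b0 ^+ 2, k1 ^+ 2 = 1 - b1 ^+ 2,
        k2 ^+ 2 = 1 - b2 ^+ 2 & k3 ^+ 2 = 1 - b3 ^+ 2] /\ q = 2 * (k0 * k1 * k2 * k3).
  pose s b : C := sqrtC (1 - b ^+ 2).
  have sE b : s b ^+ 2 = 1 - b ^+ 2 by rewrite sqrtCK.
  have /eqP : q ^+ 2 = (2 * (s b0 * s b1 * s b2 * s b3)) ^+ 2.
    by rewrite disc !exprMn !sE; ring.
  rewrite eqf_sqr => /orP[]/eqP ->.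
    by exists (s b0), (s b1), (s b2), (s b3); rewrite !sE.
  exists (- s b0), (s b1), (s b2), (s b3); rewrite sqrrN !sE; split=> //; ring.
have {k0 k1 k2 k3 K Kq disc} [k0 [k1 [k2 [k3 [[K0 K1 K2 K3] E]]]]] : exists k0 k1 k2 k3 : C,
    [/\ k0 ^+ 2 = 1 - b0 ^+ 2, k1 ^+ 2 = 1 - b1 ^+ 2,
        k2 ^+ 2 = 1 - b2 ^+ 2 & k3 ^+ 2 = 1 - b3 ^+ 2] /\
    k0 * k1 - b0 * b1 = k2 * k3 - b2 * b3.
  case: K => K0 K1 K2 K3.
  have /eqP : (k0 * k1 - k2 * k3) ^+ 2 = (b0 * b1 - b2 * b3) ^+ 2.
    transitivity (k0 ^+ 2 * k1 ^+ 2 + k2 ^+ 2 * k3 ^+ 2 - 2 * (k0 * k1 * k2 * k3)); first by ring.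
    by rewrite -Kq K0 K1 K2 K3 /q; ring.
  rewrite eqf_sqr => /orP[]/eqP h.
    by exists k0, k1, k2, k3; split=> //; lincomb h.
  by exists (- k0), k1, (- k2), k3; rewrite !sqrrN; split=> //; lincomb (lcM (-1) h).
have /eqP : (b0 * k1 + b1 * k0) ^+ 2 = (b2 * k3 + b3 * k2) ^+ 2.
  transitivity (1 - (k0 * k1 - b0 * b1) ^+ 2).
    lincomb (lcD (lcM (1 - b1 ^+ 2) K0) (lcD (lcM (b0 ^+ 2 + k0 ^+ 2) K1) (lcM (b1 ^+ 2) K0))).
  rewrite E; lincomb (lcD (lcM (- (1 - b3 ^+ 2)) K2) (lcD (lcM (- (b2 ^+ 2 + k2 ^+ 2)) K3) (lcM (- b3 ^+ 2) K2))).
rewrite eqf_sqr => /orP[]/eqP h; last by exists k0, k1, k2, k3.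
exists k0, k1, (- k2), (- k3); rewrite !sqrrN; split=> //; split; first by rewrite E; ring.
by rewrite h; ring.
Qed.

Lemma disc_kdata (b0 b1 b2 b3 : C) :
  b0 ^+ 2 != 1 -> b1 ^+ 2 != 1 -> b2 ^+ 2 != 1 -> b3 ^+ 2 != 1 ->
  (b0 + b1 + b2 + b3) * (b0 - b1 - b2 + b3) * (b0 - b1 + b2 - b3) * (b0 + b1 - b2 - b3) != 0 ->
  (2 - b0 ^+ 2 - b1 ^+ 2 - b2 ^+ 2 - b3 ^+ 2 + 2 * (b0 * b1 * b2 * b3)) ^+ 2
  = 4 * ((1 - b0 ^+ 2) * (1 - b1 ^+ 2) * (1 - b2 ^+ 2) * (1 - b3 ^+ 2)) ->
  exists k0 k1 k2 k3 : C, kdata b0 b1 b2 b3 k0 k1 k2 k3 /\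
    [/\ k2 * k3 - k0 * k1 = (b0 * k2 + b2 * k0) * (b0 * k3 + b3 * k0),
        k1 * k3 - k0 * k2 = (b0 * k1 + b1 * k0) * (b0 * k3 + b3 * k0) &
        k1 * k2 - k0 * k3 = (b0 * k1 + b1 * k0) * (b0 * k2 + b2 * k0)].
Proof.
move=> h0 h1 h2 h3 L disc.
(* The two sides of [disc] differ by L - 4 M, where L is the product of the linear forms and M that
   of the minors. Each minor is up to sign a product of two of the sines, which are therefore
   nonzero. *)
have {L} : (b0 * b1 - b2 * b3) * (b0 * b2 - b1 * b3) * (b0 * b3 - b1 * b2) != 0.
  apply: contraNneq L => M0; apply/eqP.
  by apply: (lc (lcD disc (lcM 4 M0))); ring.
have [k0 [k1 [k2 [k3 [[K0 K1 K2 K3] [E1 R1]]]]]] := disc_cos disc.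
rewrite !mulf_eq0 !negb_or => /andP[/andP[M1 M2] M3].
have [E2 R2] := kdata_rot K0 K3 E1 R1.
have [E3 R3] : k0 * k3 - b0 * b3 = k1 * k2 - b1 * b2 /\ b0 * k3 + b3 * k0 = - (b1 * k2 + b2 * k1).
  by apply: (kdata_rot K0 K2); [rewrite E1; ring | rewrite R1; ring].
have S1 := kdata_sin_sin K2 E1 R1 R3.
have S2 : k1 * k3 - k0 * k2 = (b0 * k1 + b1 * k0) * (b0 * k3 + b3 * k0).
  by apply: (@kdata_sin_sin b0 b2 b1 b3 k0 k2 k1 k3 K1) => //; rewrite R3; ring.
have S3 : k1 * k2 - k0 * k3 = (b0 * k1 + b1 * k0) * (b0 * k2 + b2 * k0).
  rewrite mulrC [RHS]mulrC.
  apply: (@kdata_sin_sin b0 b3 b2 b1 k0 k3 k2 k1 K2); rewrite ?E3 ?R3 ?R1; ring.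
exists k0, k1, k2, k3; split=> //; split=> //.
- have kn (k b : C) : b ^+ 2 != 1 -> k ^+ 2 = 1 - b ^+ 2 -> k != 0.
    by move=> hb hk; rewrite -sqrf_eq0 hk subr_eq0 eq_sym.
  by split; [apply: kn K0|apply: kn K1|apply: kn K2|apply: kn K3].
- have m (x y u v : C) : x - y = u - v -> x - u = y - v by move=> h; lincomb h.
  move: M1 M2 M3; rewrite -(m _ _ _ _ E1) -(m _ _ _ _ E2) -opprB oppr_eq0 S1.
  by rewrite -[k0 * k2 - _]opprB oppr_eq0 S2 !mulf_eq0 !negb_or => /andP[-> ->] /andP[-> _].
Qed.

(** With r_j = b0 k_j + b_j k0 the solution has s0^2 = 4 k2 k3 / (r2 r3), d0^2 = 4 k0 k1 / (r2 r3)
    and so on, and the three product hypotheses say that s^2 - d^2 = 4. Fixing roots of the k_i and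
    r_j beforehand makes the signs coherent; the minus sign in the third factor produces the - 2 s0
    in [trp]. *)
Lemma kdata_trp (b0 b1 b2 b3 k0 k1 k2 k3 : C) : kdata b0 b1 b2 b3 k0 k1 k2 k3 ->
  k2 * k3 - k0 * k1 = (b0 * k2 + b2 * k0) * (b0 * k3 + b3 * k0) ->
  k1 * k3 - k0 * k2 = (b0 * k1 + b1 * k0) * (b0 * k3 + b3 * k0) ->
  k1 * k2 - k0 * k3 = (b0 * k1 + b1 * k0) * (b0 * k2 + b2 * k0) ->
  exists s0 d0 s1 d1 s2 d2, trp b0 b1 b2 b3 s0 d0 s1 d1 s2 d2.
Proof.
move=> [_ _ [R1 R2 R3] [r1n r2n r3n]] S1 S2 S3.
pose u j : C := sqrtC j.
have uE j : u j ^+ 2 = j by exact: sqrtCK.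
set r1 := b0 * k1 + b1 * k0 in r1n S2 S3 *; set r2 := b0 * k2 + b2 * k0 in r2n S1 S3 *.
set r3 := b0 * k3 + b3 * k0 in r3n S1 S2 *.
move: (uE k0) (uE k1) (uE k2) (uE k3) (uE r1) (uE r2) (uE r3).
have un r : r != 0 -> u r != 0 by move=> rn; rewrite -sqrf_eq0 uE.
move: (un _ r1n) (un _ r2n) (un _ r3n).
move: (u k0) (u k1) (u k2) (u k3) (u r1) (u r2) (u r3) => v0 v1 v2 v3 w1 w2 w3.
move=> w1n w2n w3n V0 V1 V2 V3 W1 W2 W3.
exists (2 * v2 * v3 / (w2 * w3)), (2 * v0 * v1 / (w2 * w3)), (2 * v1 * v3 / (w1 * w3)),
  (2 * v0 * v2 / (w1 * w3)), (- (2 * v1 * v2 / (w1 * w2))), (- (2 * v0 * v3 / (w1 * w2))).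
have N2 : w2 * w3 != 0 by rewrite mulf_neq0.
have N1 : w1 * w3 != 0 by rewrite mulf_neq0.
have N3 : w1 * w2 != 0 by rewrite mulf_neq0.
have cone (x y z t p q r r' : C) : p * q != 0 -> p ^+ 2 = r -> q ^+ 2 = r' ->
    x ^+ 2 * y ^+ 2 - z ^+ 2 * t ^+ 2 = r * r' ->
    (2 * x * y / (p * q)) ^+ 2 - (2 * z * t / (p * q)) ^+ 2 = 4.
  move=> pq P Q h; have pq2 : (p * q) ^+ 2 != 0 by rewrite sqrf_eq0.
  apply: (mulIf pq2); rewrite mulrBl !expr_div_n !divfK // [in RHS]exprMn P Q -h; ring.
split.
- rewrite !sqrrN; split.
  + by apply: cone W2 W3 _ => //; rewrite V0 V1 V2 V3 S1.
  + by apply: cone W1 W3 _ => //; rewrite V0 V1 V2 V3 S2.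
  + by apply: cone W1 W2 _ => //; rewrite V0 V1 V2 V3 S3.
all: have H1 : b0 * v1 ^+ 2 + b1 * v0 ^+ 2 = w1 ^+ 2 by rewrite V0 V1 W1.
all: have H1' : b2 * v3 ^+ 2 + b3 * v2 ^+ 2 = - w1 ^+ 2 by rewrite V2 V3 W1 /r1 R1 opprK.
all: have H2 : b0 * v2 ^+ 2 + b2 * v0 ^+ 2 = w2 ^+ 2 by rewrite V0 V2 W2.
all: have H2' : b1 * v3 ^+ 2 + b3 * v1 ^+ 2 = - w2 ^+ 2 by rewrite V1 V3 W2 /r2 R2 opprK.
all: have H3 : b0 * v3 ^+ 2 + b3 * v0 ^+ 2 = w3 ^+ 2 by rewrite V0 V3 W3.
all: have H3' : b1 * v2 ^+ 2 + b2 * v1 ^+ 2 = - w3 ^+ 2 by rewrite V1 V2 W3 /r3 R3 opprK.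
- split.
  + by apply: (lc (lcM (- (4 * v2 * v3 / (w1 * w2 * w3 * w1))) H1)); field; rewrite w1n w2n w3n.
  + by apply: (lc (lcM (- (4 * v0 * v1 / (w1 * w2 * w3 * w1))) H1')); field; rewrite w1n w2n w3n.
- split.
  + by apply: (lc (lcM (- (4 * v1 * v3 / (w1 * w2 * w3 * w2))) H2)); field; rewrite w1n w2n w3n.
  + by apply: (lc (lcM (- (4 * v0 * v2 / (w1 * w2 * w3 * w2))) H2')); field; rewrite w1n w2n w3n.
- split.
  + by apply: (lc (lcM (4 * v1 * v2 / (w1 * w2 * w3 * w3)) H3)); field; rewrite w1n w2n w3n.
  + by apply: (lc (lcM (4 * v0 * v3 / (w1 * w2 * w3 * w3)) H3')); field; rewrite w1n w2n w3n.
Qed.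
End Triples.

(** * Points of the product of lines, group action, singular points for w <> 0 *)

Section Points.
Variable C : numClosedFieldType.
Implicit Types (p q : pt C) (X Y Z : C * C).

Definition pr p (k : nat) : C * C := (p (ix (2 * k)), p (ix (2 * k).+1)).
Definition nzp X := (X.1 != 0) || (X.2 != 0).
Definition peq1 X Y := X.1 * Y.2 = X.2 * Y.1.
Definition act1 (b e : bool) X := e2 e (e1 b X).
Definition mkp X Y Z : pt C := fun i => nth 0 [:: X.1; X.2; Y.1; Y.2; Z.1; Z.2] i.

Lemma pr_mkp X Y Z : (pr (mkp X Y Z) 0 = X) * (pr (mkp X Y Z) 1 = Y) * (pr (mkp X Y Z) 2 = Z).
Proof. by rewrite /pr /mkp /ix !inordK //= -!surjective_pairing. Qed.

Lemma validE p : valid p <-> [/\ nzp (pr p 0), nzp (pr p 1) & nzp (pr p 2)].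
Proof.
split=> [v|[v0 v1 v2] [|[|[|k]]]] //.
by split; [apply: (v 0%N) | apply: (v 1%N) | apply: (v 2)].
Qed.

Lemma peqE p q : peq p q <->
  [/\ peq1 (pr p 0) (pr q 0), peq1 (pr p 1) (pr q 1) & peq1 (pr p 2) (pr q 2)].
Proof.
split=> [v|[v0 v1 v2] [|[|[|k]]]] //.
by split; [apply: (v 0%N) | apply: (v 1%N) | apply: (v 2)].
Qed.

Lemma pr_act g p k : (k < 3)%N -> pr (act g p) k = act1 (gbit g k) g.2 (pr p k).
Proof.
move=> k3; have q0 : (2 * k)./2 = k by rewrite mul2n doubleK.
have q1 : (2 * k).+1./2 = k by rewrite mul2n -uphalfE uphalf_double.
have o0 : odd (2 * k) = false by rewrite mul2n odd_double.
have v0 : (ix (2 * k) : nat) = (2 * k)%N by rewrite /ix inordK //; lia.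
have v1 : (ix (2 * k).+1 : nat) = (2 * k).+1 by rewrite /ix inordK //; lia.
by rewrite {1}/pr /act v0 v1 q0 q1 oddS o0 /= -surjective_pairing.
Qed.

Lemma nzp_act b e X : nzp (act1 b e X) = nzp X.
Proof. by case: X b e => u v [] [] /=; rewrite /nzp /= ?oppr_eq0 // orbC. Qed.

Lemma peq1_refl X : peq1 X X. Proof. by rewrite /peq1 mulrC. Qed.
Lemma peq1_sym X Y : peq1 X Y -> peq1 Y X.
Proof. by rewrite /peq1 => h; rewrite mulrC -h mulrC. Qed.

(** e_1 and e_2 anticommute on representatives, so on P^1 they generate an elementary abelian group,
    where g X = h X means g h X = X. *)
Lemma peq1_act b e b' e' X :
  peq1 (act1 b e X) (act1 b' e' X) -> peq1 (act1 (b (+) b') (e (+) e') X) X.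
Proof.
case: X => u v; rewrite /peq1 /act1.
by case: b; case: e; case: b'; case: e' => /= h; first [lincomb h | lincomb (lcM (-1) h)].
Qed.

Definition onZ3 (a : 'I_5 -> C) X Y Z := triv a (sv X.1 X.2, dv X.1 X.2, X.1 * X.2)
  (sv Y.1 Y.2, dv Y.1 Y.2, Y.1 * Y.2) (sv Z.1 Z.2, dv Z.1 Z.2, Z.1 * Z.2).

Lemma onZ3E (a : 'I_5 -> C) p : onZ a p <-> onZ3 a (pr p 0) (pr p 1) (pr p 2) = 0.
Proof. by rewrite /onZ onZE. Qed.

Definition sing3 (a0 a1 a2 a3 w : C) X Y Z :=
  sing6 a0 a1 a2 a3 w X.1 X.2 Y.1 Y.2 Z.1 Z.2.

Lemma sing3_rot a0 a1 a2 a3 w X Y Z :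
  sing3 a0 a1 a2 a3 w X Y Z -> sing3 a0 a2 a3 a1 w Y Z X.
Proof. by case. Qed.

Lemma sing3E (a : 'I_5 -> C) p : singZ a p <->
  sing3 (a (inord 0)) (a (inord 1)) (a (inord 2)) (a (inord 3)) (a (inord 4))
    (pr p 0) (pr p 1) (pr p 2).
Proof. exact: singZE. Qed.

Lemma sv_act b e X : sv (act1 b e X).1 (act1 b e X).2 = sv X.1 X.2.
Proof. by case: X => u v; case: b; case: e; rewrite /sv /= ?sqrrN // addrC. Qed.

Lemma dv_act b e X : dv (act1 b e X).1 (act1 b e X).2 = (-1) ^+ e * dv X.1 X.2.
Proof. by case: X => u v; case: b; case: e; rewrite /dv /=; ring. Qed.

Lemma pv_act b e X : (act1 b e X).1 * (act1 b e X).2 = (-1) ^+ b * (X.1 * X.2).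
Proof. by case: X => u v; case: b; case: e => /=; ring. Qed.

Lemma crit_act (b e : bool) X (g h q g' h' q' : C) : g' = g -> h' = (-1) ^+ e * h -> q' = (-1) ^+ b * q ->
  crit g h q X.1 X.2 -> crit g' h' q' (act1 b e X).1 (act1 b e X).2.
Proof.
case: X => u v -> -> -> [/= H0 H1]; rewrite /crit /act1.
case: b; case: e => /=; rewrite ?expr1 ?expr0; split;
 first [lincomb H0 | lincomb H1 | lincomb (lcM (-1) H0) | lincomb (lcM (-1) H1)].
Qed.

Lemma gv_act e (a0 c s1 d1 s2 d2 : C) :
  gv a0 c s1 ((-1) ^+ (e : bool) * d1) s2 ((-1) ^+ e * d2) = gv a0 c s1 d1 s2 d2.
Proof. by case: e; rewrite /gv; ring. Qed.

Lemma hv_act e (a0 c s1 d1 s2 d2 : C) :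
  hv a0 c s1 ((-1) ^+ (e : bool) * d1) s2 ((-1) ^+ e * d2) = (-1) ^+ e * hv a0 c s1 d1 s2 d2.
Proof. by case: e; rewrite /hv; ring. Qed.

Lemma sing3_act a0 a1 a2 a3 w X Y Z b b' e : sing3 a0 a1 a2 a3 w X Y Z ->
  sing3 a0 a1 a2 a3 w (act1 b e X) (act1 b' e Y) (act1 (b (+) b') e Z).
Proof.
case=> H0 H1 H2; rewrite /sing3 /sing6 !sv_act !dv_act !pv_act.
split; [move: H0|move: H1|move: H2]; apply: crit_act; rewrite ?gv_act ?hv_act //.
all: by case: b; case: b' => /=; rewrite ?expr1 ?expr0; ring.
Qed.

(* On the fixed points (1 : 0), (0 : 1) of e_1 one has d = + s or d = - s. *)
Definition edge X := X.1 * X.2 = 0.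

Lemma edgeP X : nzp X -> edge X ->
  exists e : C, [/\ e = 1 \/ e = -1, dv X.1 X.2 = e * sv X.1 X.2 & sv X.1 X.2 != 0].
Proof.
case: X => u v; rewrite /nzp /edge /= => nz /eqP; rewrite mulf_eq0 => /orP[]/eqP E.
  exists (-1); move: nz; rewrite E eqxx /= => v0; split; [by right| |].
    by rewrite /sv /dv; ring.
  by rewrite /sv expr0n add0r sqrf_eq0.
exists 1; move: nz; rewrite E eqxx orbF => u0; split; [by left| |].
  by rewrite /sv /dv; ring.
by rewrite /sv expr0n addr0 sqrf_eq0.
Qed.

Definition Lv (a0 a1 a2 a3 : C) :=
  (a0 + a1 + a2 + a3) * (a0 - a1 - a2 + a3) * (a0 - a1 + a2 - a3) * (a0 + a1 - a2 - a3).

Lemma Lv_sign a0 a1 a2 a3 (e f : C) : Lv a0 a1 a2 a3 != 0 ->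
  e = 1 \/ e = -1 -> f = 1 \/ f = -1 -> a0 + e * f * a1 + e * a2 + f * a3 != 0.
Proof.
rewrite /Lv !mulf_eq0 !negb_or => /andP[/andP[/andP[L1 L2] L3] L4].
have eqn (x y : C) : x != 0 -> x = y -> y != 0 by move=> ? <-.
case=> -> [] ->; [apply: (eqn _ _ L1) | apply: (eqn _ _ L3) | apply: (eqn _ _ L2) | apply: (eqn _ _ L4)]; ring.
Qed.

Lemma Lv_rot a0 a1 a2 a3 : Lv a0 a2 a3 a1 = Lv a0 a1 a2 a3.
Proof. rewrite /Lv; ring. Qed.

(** On two edges p = 0 and d = s or d = - s, so the equations of the third factor are diagonal, with
    factors of L as coefficients. Both coordinates of Z would vanish. *)
Lemma sing3_two_edges (a0 a1 a2 a3 w : C) X Y Z : Lv a0 a1 a2 a3 != 0 ->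
  nzp X -> nzp Y -> nzp Z -> sing3 a0 a1 a2 a3 w X Y Z ->
  edge X -> edge Y -> False.
Proof.
move=> L nX nY nZ [_ _ [H0 H1]] eX eY.
have [e [he dX sX]] := edgeP nX eX; have [f [hf dY sY]] := edgeP nY eY.
have L' : Lv a0 a3 a1 a2 != 0 by rewrite Lv_rot Lv_rot.
have neg (x : C) : x = 1 \/ x = -1 -> - x = 1 \/ - x = -1.
  by case=> ->; [right|left; rewrite opprK].
have P := Lv_sign L' hf he; have N := Lv_sign L' (neg _ hf) (neg _ he).
move: H0 H1; rewrite /gv /hv dX dY eX !(mulr0, mul0r, addr0) => H0 H1.
have sXY : 2 * (sv X.1 X.2 * sv Y.1 Y.2) != 0 by rewrite !mulf_neq0 // pnatr_eq0.
have z (u v t : C) : t != 0 -> 2 * (sv X.1 X.2 * sv Y.1 Y.2) * t * u = 0 -> u = 0.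
  by move=> tn /eqP; rewrite mulf_eq0 (negbTE (mulf_neq0 sXY tn)) => /eqP.
move: nZ; rewrite /nzp.
rewrite (z Z.1 0 _ P) ?eqxx /=; last by rewrite -[RHS]H0; ring.
by rewrite (z Z.2 0 _ N) ?eqxx //= -[RHS]H1; ring.
Qed.

(** At an edge point of X, one equation of the first factor reduces to w p(Y) p(Z) = 0, which puts a
    second factor on an edge. *)
Lemma sing3_noedge_w (a0 a1 a2 a3 w : C) X Y Z : Lv a0 a1 a2 a3 != 0 -> w != 0 -> nzp X -> nzp Y -> nzp Z ->
  sing3 a0 a1 a2 a3 w X Y Z -> ~ edge X.
Proof.
move=> L w0 nX nY nZ S eX.
have q0 : w * (Y.1 * Y.2) * (Z.1 * Z.2) = 0.
  case: S => [[H0 H1] _ _]; move/eqP: eX; rewrite /edge mulf_eq0 => /orP[]/eqP E.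
    move: H0; rewrite E !(mulr0, mul0r, add0r) => /eqP; rewrite mulf_eq0 => /orP[]/eqP E' //.
    by move: nX; rewrite /nzp E E' eqxx.
  move: H1; rewrite E !(mulr0, mul0r, add0r) => /eqP; rewrite mulf_eq0 => /orP[]/eqP E' //.
  by move: nX; rewrite /nzp E E' eqxx.
move/eqP: q0; rewrite mulf_eq0 mulf_eq0 (negbTE w0) /= => /orP[]/eqP E.
  exact: (sing3_two_edges L nX nY nZ S eX E).
apply: (sing3_two_edges _ nZ nX nY (sing3_rot (sing3_rot S)) E eX).
by rewrite Lv_rot Lv_rot.
Qed.

(** [sg] and [dl] are s / p and d / p, the values after scaling to p = 1. *)
Definition sg X := X.1 / X.2 + X.2 / X.1.
Definition dl X := X.1 / X.2 - X.2 / X.1.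

Lemma noedgeP X : ~ edge X -> X.1 != 0 /\ X.2 != 0.
Proof. by move=> /eqP; rewrite mulf_eq0 negb_or => /andP[]. Qed.

Lemma crit_norm X (G H q : C) : ~ edge X -> q != 0 ->
  crit (q / 8 * G) (q / 8 * H) q X.1 X.2 <-> G = - (2 * sg X) /\ H = 2 * dl X.
Proof.
move=> /noedgeP[u0 v0] q0; rewrite /crit /sg /dl; move: X.1 X.2 u0 v0 => u v u0 v0.
have n8 : (8 : C) != 0 by rewrite pnatr_eq0.
have n2 : (2 : C) != 0 by rewrite pnatr_eq0.
split=> [[A B]|[-> ->]]; last by split; field; rewrite u0 v0.
by split; [apply: (lc (lcD (lcM (2 / (q * u)) A) (lcM (2 / (q * v)) B)))
  | apply: (lc (lcD (lcM (2 / (q * u)) A) (lcM (- (2 / (q * v))) B)))]; field; rewrite u0 v0 q0.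
Qed.

Lemma svE X : ~ edge X -> sv X.1 X.2 = X.1 * X.2 * sg X.
Proof. by move=> /noedgeP[u0 v0]; rewrite /sv /sg; field; rewrite u0 v0. Qed.
Lemma dvE X : ~ edge X -> dv X.1 X.2 = X.1 * X.2 * dl X.
Proof. by move=> /noedgeP[u0 v0]; rewrite /dv /dl; field; rewrite u0 v0. Qed.

Lemma sing3_trp (a0 a1 a2 a3 w : C) X Y Z : w != 0 -> ~ edge X -> ~ edge Y -> ~ edge Z ->
  sing3 a0 a1 a2 a3 w X Y Z <->
  trp (8 * a0 / w) (8 * a1 / w) (8 * a2 / w) (8 * a3 / w) (sg X) (dl X) (sg Y) (dl Y) (sg Z) (dl Z).
Proof.
move=> w0 eX eY eZ.
have n8 : (8 : C) != 0 by rewrite pnatr_eq0.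
have key (c e f : C) U V W : ~ edge U -> ~ edge V -> ~ edge W ->
  crit (gv a0 c (sv V.1 V.2) (dv V.1 V.2) (sv W.1 W.2) (dv W.1 W.2))
       (hv e f (sv V.1 V.2) (dv V.1 V.2) (sv W.1 W.2) (dv W.1 W.2))
       (w * (V.1 * V.2) * (W.1 * W.2)) U.1 U.2 <->
  8 * a0 / w * sg V * sg W + 8 * c / w * dl V * dl W = - (2 * sg U) /\
  8 * e / w * sg V * dl W + 8 * f / w * dl V * sg W = 2 * dl U.
  move=> eU eV eW; have [v0 v1] := noedgeP eV; have [w1 w2] := noedgeP eW.
  rewrite -(@crit_norm U _ _ (w * (V.1 * V.2) * (W.1 * W.2))) //; last by rewrite !mulf_neq0.
  rewrite !svE // !dvE //.
  set g := gv _ _ _ _ _ _; set h := hv _ _ _ _ _ _; set g' := _ / 8 * _; set h' := _ / 8 * (_ + _).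
  have -> : g' = g by rewrite /g' /g /gv; field.
  have -> : h' = h by rewrite /h' /h /hv; field.
  by [].
have cone U : ~ edge U -> sg U ^+ 2 - dl U ^+ 2 = 4.
  by move=> /noedgeP[u0 v0]; rewrite /sg /dl; field; rewrite u0 v0.
split=> [[/(key _ _ _ _ _ _ eX eY eZ) A /(key _ _ _ _ _ _ eY eZ eX) B /(key _ _ _ _ _ _ eZ eX eY) D]|].
  by split=> //; split; apply: cone.
by case=> _ A B D; split; [apply/key|apply/key|apply/key].
Qed.

Definition triv5 (a0 a1 a2 a3 w : C) (u v t : C * C * C) : C :=
  a0 * (u.1.1 * v.1.1 * t.1.1) + a1 * (u.1.1 * v.1.2 * t.1.2)
  + a2 * (u.1.2 * v.1.1 * t.1.2) + a3 * (u.1.2 * v.1.2 * t.1.1)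
  + w * (u.2 * v.2 * t.2).

Lemma triv5_rot a0 a1 a2 a3 w u v t : triv5 a0 a2 a3 a1 w v t u = triv5 a0 a1 a2 a3 w u v t.
Proof. rewrite /triv5; ring. Qed.

Definition chart1 X : C * C * C := if X.2 != 0 then (1, X.1, X.2) else (-1, X.2, X.1).
Definition q0 X := cq (chart1 X).1.1 (chart1 X).1.2 (chart1 X).2.
Definition q1 X := cq' (chart1 X).1.1 (chart1 X).1.2 (chart1 X).2.
Definition q2 X := cq'' (chart1 X).1.1.

Definition hdet3 a0 a1 a2 a3 w X Y Z :=
  det3 (triv5 a0 a1 a2 a3 w (q2 X) (q0 Y) (q0 Z)) (triv5 a0 a1 a2 a3 w (q0 X) (q2 Y) (q0 Z))
       (triv5 a0 a1 a2 a3 w (q0 X) (q0 Y) (q2 Z)) (triv5 a0 a1 a2 a3 w (q1 X) (q1 Y) (q0 Z))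
       (triv5 a0 a1 a2 a3 w (q1 X) (q0 Y) (q1 Z)) (triv5 a0 a1 a2 a3 w (q0 X) (q1 Y) (q1 Z)).

Lemma hdet3_rot a0 a1 a2 a3 w X Y Z : hdet3 a0 a2 a3 a1 w Y Z X = hdet3 a0 a1 a2 a3 w X Y Z.
Proof. rewrite /hdet3 !(triv5_rot a0 a1 a2 a3 w) /det3; ring. Qed.

Lemma hdet3E (a : 'I_5 -> C) p : \det (hess a p) =
  hdet3 (a (inord 0)) (a (inord 1)) (a (inord 2)) (a (inord 3)) (a (inord 4))
    (pr p 0) (pr p 1) (pr p 2).
Proof. exact: hessE. Qed.

Definition orb3 X Y Z X' Y' Z' := exists b b' e,
  [/\ peq1 X (act1 b e X'), peq1 Y (act1 b' e Y') & peq1 Z (act1 (b (+) b') e Z')].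

(** The orbit is not counted here; that its eight points are distinct is a matter of stabilizers,
    see [one_node_orbit_eight]. *)
Definition one_node_orbit (a0 a1 a2 a3 w : C) := exists X0 Y0 Z0,
  [/\ nzp X0, nzp Y0, nzp Z0, sing3 a0 a1 a2 a3 w X0 Y0 Z0 &
   forall X Y Z, nzp X -> nzp Y -> nzp Z -> sing3 a0 a1 a2 a3 w X Y Z ->
     orb3 X Y Z X0 Y0 Z0 /\ hdet3 a0 a1 a2 a3 w X Y Z != 0].

Lemma one_node_orbit_rot (a0 a1 a2 a3 w : C) :
  one_node_orbit a0 a2 a3 a1 w -> one_node_orbit a0 a1 a2 a3 w.
Proof.
move=> [X0 [Y0 [Z0 [nX nY nZ S H]]]]; exists Z0, X0, Y0; split=> //.
  exact: (sing3_rot (sing3_rot S)).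
move=> X Y Z hX hY hZ hS.
have [[b [b' [e [P Q R]]]] D] := H Y Z X hY hZ hX (sing3_rot hS).
split; last by rewrite -hdet3_rot.
by exists (b (+) b'), b, e; split; rewrite // addbC addKb.
Qed.

(** Scaling rows and columns by the x_i passes to logarithmic coordinates, where the diagonal is
    constant; clearing the y_i then leaves - P^3 times the expression of [trp_hess]. *)
Lemma det3_scale (h00 h11 h22 h01 h02 h12 x0 x1 x2 P y0 y1 y2 n01 n02 n12 : C) :
  x0 != 0 -> x1 != 0 -> x2 != 0 -> P != 0 -> y0 != 0 -> y1 != 0 -> y2 != 0 ->
  x0 ^+ 2 * h00 = - P -> x1 ^+ 2 * h11 = - P -> x2 ^+ 2 * h22 = - P ->
  x0 * x1 * h01 = - P * n01 / (y0 * y1) -> x0 * x2 * h02 = - P * n02 / (y0 * y2) ->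
  x1 * x2 * h12 = - P * n12 / (y1 * y2) ->
  y0 ^+ 2 * y1 ^+ 2 * y2 ^+ 2 + 2 * (n01 * n02 * n12) - n01 ^+ 2 * y2 ^+ 2
    - n02 ^+ 2 * y1 ^+ 2 - n12 ^+ 2 * y0 ^+ 2 != 0 ->
  det3 h00 h11 h22 h01 h02 h12 != 0.
Proof.
move=> x0n x1n x2n Pn y0n y1n y2n H00 H11 H22 H01 H02 H12.
set T := _ - _ => Tn; apply/eqP => D0.
have : - P ^+ 3 * T / (y0 ^+ 2 * y1 ^+ 2 * y2 ^+ 2) = 0.
  transitivity ((x0 * x1 * x2) ^+ 2 * det3 h00 h11 h22 h01 h02 h12); last by rewrite D0 mulr0.
  transitivity (det3 (x0 ^+ 2 * h00) (x1 ^+ 2 * h11) (x2 ^+ 2 * h22)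
    (x0 * x1 * h01) (x0 * x2 * h02) (x1 * x2 * h12)); last by rewrite /det3; ring.
  by rewrite H00 H11 H22 H01 H02 H12 /det3 /T; field; rewrite y0n y1n y2n.
apply/eqP; rewrite !mulf_neq0 ?invr_eq0 ?mulf_neq0 ?oppr_eq0 ?expf_neq0 //.
Qed.

Lemma chart1_noedge X : ~ edge X -> chart1 X = (1, X.1, X.2).
Proof. by move=> /noedgeP[_ v0]; rewrite /chart1 v0. Qed.

Lemma diag_noedge (a0 a1 a2 a3 w : C) X Y Z : ~ edge X -> ~ edge Y -> ~ edge Z ->
  sing3 a0 a1 a2 a3 w X Y Z ->
  X.1 ^+ 2 * triv5 a0 a1 a2 a3 w (q2 X) (q0 Y) (q0 Z) =
  - (w * (X.1 * X.2) * (Y.1 * Y.2) * (Z.1 * Z.2)).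
Proof.
move=> eX eY eZ [[H _] _ _].
rewrite /q0 /q2 !chart1_noedge //= /cq /cq'' /triv5 /= !mul1r.
by move: H; rewrite /gv /hv => H; lincomb (lcM X.1 H).
Qed.

Lemma off_noedge (a0 a1 a2 a3 w : C) X Y Z : w != 0 -> ~ edge X -> ~ edge Y -> ~ edge Z ->
  let b0 := 8 * a0 / w in let b1 := 8 * a1 / w in let b2 := 8 * a2 / w in
  let b3 := 8 * a3 / w in
  b0 ^+ 2 != 1 -> b1 ^+ 2 != 1 -> b2 ^+ 2 != 1 -> b3 ^+ 2 != 1 ->
  trp b0 b1 b2 b3 (sg X) (dl X) (sg Y) (dl Y) (sg Z) (dl Z) ->
  X.1 * Y.1 * triv5 a0 a1 a2 a3 w (q1 X) (q1 Y) (q0 Z) =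
  - (w * (X.1 * X.2) * (Y.1 * Y.2) * (Z.1 * Z.2)) *
  (t0 b0 (sg X) (sg Y) (sg Z) * t3 b3 (dl X) (dl Y) (sg Z)
   - t1 b1 (sg X) (dl Y) (dl Z) * t2 b2 (dl X) (sg Y) (dl Z)) /
  (sg X * dl X * (sg Y * dl Y)).
Proof.
move=> w0 eX eY eZ b0 b1 b2 b3 h0 h1 h2 h3 T.
have := trp_off h0 h1 h2 h3 T.
have [[z0 z1 z2] [w0' w1 w2]] := trp_neq0 h0 h1 h2 h3 T.
set n := t0 _ _ _ _ * _ - _; set y := sg X * dl X * _.
have yn : y != 0 by rewrite /y !mulf_neq0.
move=> O.
have n8 : (8 : C) != 0 by rewrite pnatr_eq0.
have O' : (sg X + dl X) * (sg Y + dl Y) * ((b0 + b3) * sg Z + (b1 + b2) * dl Z) / 8 + 1 = - n / y.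
  by rewrite O; field; rewrite yn.
rewrite -[RHS]mulrA mulNr -mulrN -mulNr -O' /q0 /q1 !chart1_noedge //= /cq /cq' /triv5 /= !mul1r svE // dvE //.
have [u0 v0] := noedgeP eX; have [u1 v1] := noedgeP eY; have [u2 v2] := noedgeP eZ.
have E0 : sg X + dl X = 2 * X.1 / X.2 by rewrite /sg /dl; field; rewrite u0 v0.
have E1 : sg Y + dl Y = 2 * Y.1 / Y.2 by rewrite /sg /dl; field; rewrite u1 v1.
by rewrite E0 E1 /b0 /b1 /b2 /b3; field; rewrite v0 v1 w0.
Qed.

Lemma hdet3_noedge (a0 a1 a2 a3 w : C) X Y Z : w != 0 -> ~ edge X -> ~ edge Y -> ~ edge Z ->
  (8 * a0 / w) ^+ 2 != 1 -> (8 * a1 / w) ^+ 2 != 1 ->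
  (8 * a2 / w) ^+ 2 != 1 -> (8 * a3 / w) ^+ 2 != 1 ->
  sing3 a0 a1 a2 a3 w X Y Z -> hdet3 a0 a1 a2 a3 w X Y Z != 0.
Proof.
move=> w0 eX eY eZ h0 h1 h2 h3 S.
have T := proj1 (sing3_trp a0 a1 a2 a3 w0 eX eY eZ) S.
have [u0 v0] := noedgeP eX; have [u1 v1] := noedgeP eY; have [u2 v2] := noedgeP eZ.
have [[z0 z1 z2] [w0' w1 w2]] := trp_neq0 h0 h1 h2 h3 T.
have := trp_hess h0 h1 h2 h3 T.
apply: (@det3_scale _ _ _ _ _ _ X.1 Y.1 Z.1 (w * (X.1 * X.2) * (Y.1 * Y.2) * (Z.1 * Z.2))) => //;
  rewrite ?mulf_neq0 //.
- exact: diag_noedge.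
- by rewrite -triv5_rot (diag_noedge eY eZ eX (sing3_rot S)); ring.
- by rewrite -triv5_rot -triv5_rot (diag_noedge eZ eX eY (sing3_rot (sing3_rot S))); ring.
- exact: off_noedge.
- rewrite -triv5_rot -triv5_rot [X.1 * _]mulrC.
  rewrite (off_noedge w0 eZ eX eY h0 h3 h1 h2 (trp_rot (trp_rot T))) /t0 /t1 /t2 /t3.
  by field; rewrite z0 z2 w0' w2.
- rewrite -triv5_rot (off_noedge w0 eY eZ eX h0 h2 h3 h1 (trp_rot T)) /t0 /t1 /t2 /t3.
  by field; rewrite z1 z2 w1 w2.
Qed.
End Points.

(** * The singular points form one orbit of nodes *)

Section Nodes.
Variable C : numClosedFieldType.
Implicit Types (X Y Z : C * C).

Let n2 : (2 : C) != 0. Proof. by rewrite pnatr_eq0. Qed.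

Lemma sqr1_sign (e : C) : e ^+ 2 = 1 -> exists b : bool, e = (-1) ^+ b.
Proof.
move/eqP; rewrite sqrf_eq1 => /orP[]/eqP->; [by exists false; rewrite expr0|by exists true; rewrite expr1].
Qed.

(** The ratio of the coordinates is half the sum of [sg] and [dl]. Changing the sign of d inverts
    it, because (s + d) / 2 and (s - d) / 2 have product 1. *)
Lemma peq1_normalized X (s d : C) (b e : bool) : ~ edge X -> s ^+ 2 - d ^+ 2 = 4 ->
  sg X = (-1) ^+ b * s -> dl X = (-1) ^+ e * (-1) ^+ b * d ->
  peq1 X (act1 b e ((s + d) / 2, 1)).
Proof.
move=> /noedgeP[]; case: X => u v /= u0 v0 h; rewrite /sg /dl /peq1 /act1 /= => S D.
have E : u / v = (-1) ^+ b * (s + (-1) ^+ e * d) / 2.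
  by apply: (lc (lcD (lcM (1 / 2) S) (lcM (1 / 2) D))); field; rewrite u0 v0.
have {}E : u = v * ((-1) ^+ b * (s + (-1) ^+ e * d) / 2) by rewrite -E; field.
rewrite E; case: b {S D E} => //=; case: e => //=; rewrite ?expr1 ?expr0.
all: first [by field | by apply: (lc (lcM (v / 4) h)); field | by apply: (lc (lcM (- v / 4) h)); field].
Qed.

Lemma one_node_orbit_generic (a0 a1 a2 a3 w : C) : w != 0 -> Lv a0 a1 a2 a3 != 0 ->
  let b0 := 8 * a0 / w in let b1 := 8 * a1 / w in let b2 := 8 * a2 / w in
  let b3 := 8 * a3 / w in
  b0 ^+ 2 != 1 -> b1 ^+ 2 != 1 -> b2 ^+ 2 != 1 -> b3 ^+ 2 != 1 ->
  (2 - b0 ^+ 2 - b1 ^+ 2 - b2 ^+ 2 - b3 ^+ 2 + 2 * (b0 * b1 * b2 * b3)) ^+ 2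
  = 4 * ((1 - b0 ^+ 2) * (1 - b1 ^+ 2) * (1 - b2 ^+ 2) * (1 - b3 ^+ 2)) ->
  one_node_orbit a0 a1 a2 a3 w.
Proof.
move=> w0 L b0 b1 b2 b3 h0 h1 h2 h3 disc.
have Lb : (b0 + b1 + b2 + b3) * (b0 - b1 - b2 + b3) * (b0 - b1 + b2 - b3) * (b0 + b1 - b2 - b3) != 0.
  have -> : (b0 + b1 + b2 + b3) * (b0 - b1 - b2 + b3) * (b0 - b1 + b2 - b3) * (b0 + b1 - b2 - b3)
    = (8 / w) ^+ 4 * Lv a0 a1 a2 a3 by rewrite /b0 /b1 /b2 /b3 /Lv; ring.
  by rewrite mulf_neq0 // expf_neq0 // mulf_neq0 ?invr_eq0 // pnatr_eq0.
have [k0 [k1 [k2 [k3 [K [S1 S2 S3]]]]]] := disc_kdata h0 h1 h2 h3 Lb disc.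
have [s0 [d0 [s1 [d1 [s2 [d2 T]]]]]] := kdata_trp K S1 S2 S3.
have [[c0 c1 c2] _ _ _] := T.
pose pt s d : C * C := ((s + d) / 2, 1).
have ptE s d : s ^+ 2 - d ^+ 2 = 4 -> [/\ ~ edge (pt s d), sg (pt s d) = s & dl (pt s d) = d].
  move=> h; have sd : (s + d) / 2 * ((s - d) / 2) = 1.
    by apply: (lc (lcM (1 / 4) h)); field.
  have x0 : (s + d) / 2 != 0.
    by apply: contraTneq (oner_neq0 C) => E; rewrite -sd E mul0r eqxx.
  have iv : ((s + d) / 2)^-1 = (s - d) / 2 by apply: (mulfI x0); rewrite divff // sd.
  split; first by rewrite /edge /= mulr1 => /eqP; rewrite (negbTE x0).
    by rewrite /sg /= divr1 div1r iv; field.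
  by rewrite /dl /= divr1 div1r iv; field.
have [e0 g0 l0] := ptE _ _ c0; have [e1 g1 l1] := ptE _ _ c1; have [e2 g2 l2] := ptE _ _ c2.
have nz s d : nzp (pt s d) by rewrite /nzp /= oner_neq0 orbT.
exists (pt s0 d0), (pt s1 d1), (pt s2 d2); split=> //.
  by apply/(sing3_trp _ _ _ _ w0 e0 e1 e2); rewrite g0 l0 g1 l1 g2 l2.
move=> X Y Z nX nY nZ S.
have eX := sing3_noedge_w L w0 nX nY nZ S.
have eY : ~ edge Y by apply: (sing3_noedge_w _ w0 nY nZ nX (sing3_rot S)); rewrite Lv_rot.
have eZ : ~ edge Z.
  by apply: (sing3_noedge_w _ w0 nZ nX nY (sing3_rot (sing3_rot S))); rewrite Lv_rot Lv_rot.
split; last exact: hdet3_noedge.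
have T' := proj1 (sing3_trp _ _ _ _ w0 eX eY eZ) S.
have [x0 [x1 [x2 [c [[X0 X1 X2 c' X012] [E0 E1 E2 [F0 F1 F2]]]]]]] := trp_unique h0 h1 h2 h3 T T'.
have [b B0] := sqr1_sign X0; have [b' B1] := sqr1_sign X1; have [e Ec] := sqr1_sign c'.
(* The sign relation e0 e1 e2 = 1 is the relation between the three bits of an element of G. *)
have B2 : x2 = (-1) ^+ (b (+) b').
  by rewrite signr_addb -B0 -B1 -[x2]mul1r -X012; lincomb (lcM (x0 * x1) X2).
rewrite {}B0 {}B1 {}B2 {}Ec in E0 E1 E2 F0 F1 F2.
by exists b, b', e; split; apply: peq1_normalized.
Qed.

Lemma edge_cases X : nzp X -> edge X ->
  exists e : bool, X = act1 false e (X.1 + X.2, 0) /\ X.1 + X.2 != 0.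
Proof.
case: X => u v; rewrite /nzp /edge /= => nz /eqP; rewrite mulf_eq0 => /orP[]/eqP E.
  by exists true; move: nz; rewrite E eqxx /act1 /= add0r.
by exists false; move: nz; rewrite E eqxx orbF /act1 /= addr0.
Qed.

Section Degenerate.
Variables a0 a1 a2 a3 : C.
Hypothesis L : Lv a0 a1 a2 a3 != 0.
Hypotheses (a0n : a0 != 0) (a1n : a1 != 0) (a2n : a2 != 0) (a3n : a3 != 0).

Lemma crit0 X (g h q : C) : ~ edge X -> q = 0 -> crit g h q X.1 X.2 -> g = 0 /\ h = 0.
Proof.
move=> /noedgeP[u0 v0] -> []; rewrite !mulr0 !addr0 => /eqP H0 /eqP H1.
move: H0 H1; rewrite !mulf_eq0 (negbTE n2) (negbTE u0) (negbTE v0) /= => /eqP H0 /eqP H1.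
by split; apply: (mulfI n2); [lincomb (lcD H0 H1) | lincomb (lcD H0 (lcM (-1) H1))].
Qed.

Lemma noedge_sd X : ~ edge X -> sv X.1 X.2 = 0 -> dv X.1 X.2 = 0 -> False.
Proof.
move=> /noedgeP[u0 v0]; rewrite /sv /dv => s d; case/eqP: u0; apply/eqP.
by rewrite -sqrf_eq0; apply/eqP; apply: (mulfI n2); lincomb (lcD s d).
Qed.

(** Away from the edges all six numbers g, h vanish. This forces the three values of s to be
    nonzero, while a combination of the equations is 2 a0 times their product. *)
Lemma degenerate_has_edge X Y Z : ~ edge X -> ~ edge Y -> ~ edge Z ->
  ~ sing3 a0 a1 a2 a3 0 X Y Z.
Proof.
move=> eX eY eZ [/(crit0 eX) H0 /(crit0 eY) H1 /(crit0 eZ) H2].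
have [g0 k0] : _ /\ _ := H0 ltac:(by rewrite !mul0r).
have [g1 k1] : _ /\ _ := H1 ltac:(by rewrite !mul0r).
have [g2 k2] : _ /\ _ := H2 ltac:(by rewrite !mul0r).
move: g0 k0 g1 k1 g2 k2 {H0 H1 H2}; rewrite /gv /hv.
move: (noedge_sd eX) (noedge_sd eY) (noedge_sd eZ).
set sX := sv X.1 _; set dX := dv X.1 _; set sY := sv Y.1 _; set dY := dv Y.1 _.
set sZ := sv Z.1 _; set dZ := dv Z.1 _ => nX nY nZ g0 k0 g1 k1 g2 k2.
have key (a b c d s t u v : C) : b != 0 -> c != 0 -> (s = 0 -> t = 0 -> False) ->
    (u = 0 -> v = 0 -> False) -> a * u * s + b * v * t = 0 -> c * u * t + d * v * s = 0 -> s <> 0.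
  move=> bn cn st uv E F s0; move: E F; rewrite s0 !mulr0 add0r addr0 => /eqP E /eqP F.
  move: E F; rewrite !mulf_eq0 (negbTE bn) (negbTE cn) /=.
  by case: (eqVneq t 0) => [/(st s0)//|_]; rewrite !orbF => /eqP ? /eqP ?; apply: uv.
have sX0 := key _ _ _ _ _ _ _ _ a2n a3n nX nZ g1 k1.
have sY0 := key _ _ _ _ _ _ _ _ a3n a1n nY nX g2 k2.
have sZ0 := key _ _ _ _ _ _ _ _ a1n a2n nZ nY g0 k0.
have : 2 * a0 * (sX * sY * sZ) = 0.
  lincomb (lcD (lcM sY g1) (lcD (lcM sZ g2) (lcM (- dX) k0))).
move/eqP; rewrite !mulf_eq0 (negbTE n2) (negbTE a0n) /=.
by case/orP => [/orP[]|] /eqP.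
Qed.

(* A singular point over x = (1 : 0) (e = false) or x = (0 : 1) (e = true). *)
Lemma degenerate_edge X Y Z (e : bool) (r : C) : r != 0 -> X = act1 false e (r, 0) ->
  ~ edge Y -> ~ edge Z -> sing3 a0 a1 a2 a3 0 X Y Z ->
  [/\ a0 * sv Y.1 Y.2 = - ((-1) ^+ e * a3 * dv Y.1 Y.2),
      a0 * sv Z.1 Z.2 = - ((-1) ^+ e * a2 * dv Z.1 Z.2),
      a0 * a1 = a2 * a3,
      dv Y.1 Y.2 != 0 & dv Z.1 Z.2 != 0].
Proof.
move=> r0 EX eY eZ [_ /(crit0 eY) H1 /(crit0 eZ) H2].
have [g1 k1] : _ /\ _ := H1 ltac:(by rewrite !mul0r).
have [g2 k2] : _ /\ _ := H2 ltac:(by rewrite !mul0r).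
move: g1 k1 g2 k2 {H1 H2}; rewrite /gv /hv EX sv_act dv_act /=.
have -> : sv r 0 = r ^+ 2 by rewrite /sv expr0n addr0.
have -> : dv r 0 = r ^+ 2 by rewrite /dv expr0n subr0.
move: (noedge_sd eY) (noedge_sd eZ).
set sY := sv Y.1 _; set dY := dv Y.1 _.
set sZ := sv Z.1 _; set dZ := dv Z.1 _ => nY nZ g1 k1 g2 k2.
have r2 : r ^+ 2 != 0 by rewrite sqrf_eq0.
have A : a0 * sY = - ((-1) ^+ e * a3 * dY) by apply: (mulIf r2); lincomb g2.
have B : a0 * sZ = - ((-1) ^+ e * a2 * dZ) by apply: (mulIf r2); lincomb g1.
have D : a3 * sZ = - ((-1) ^+ e * a1 * dZ).
  apply: (mulIf r2); case: e {EX A B g1 g2} k1 k2 => k1 k2.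
    by rewrite expr1 in k1 *; lincomb (lcM (-1) k1).
  by rewrite expr0 in k1 *; lincomb k1.
have dn (x y d : C) : (x = 0 -> d = 0 -> False) -> a0 * x = - ((-1) ^+ e * y * d) -> d != 0.
  move=> nn E; apply/eqP => d0; apply: (nn _ d0); apply: (mulfI a0n).
  by rewrite E d0 !mulr0 oppr0.
have dYn := dn _ _ _ nY A; have dZn := dn _ _ _ nZ B.
split=> //; apply: (mulIf dZn); have sn : (-1) ^+ e != 0 :> C by rewrite signr_eq0.
apply: (mulfI sn).
lincomb (lcD (lcM (- a3) B) (lcM a0 D)).
Qed.

Hypothesis M1 : a0 * a1 = a2 * a3.

(** After the substitution a1 = a2 a3 / a0 the product L is, up to a power of a0, the product of the
    squares of these four forms. The same substitution shows that the other two minors do not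
    vanish. *)
Lemma M1_neq : [/\ a0 + a2 != 0, a0 - a2 != 0, a0 + a3 != 0 & a0 - a3 != 0].
Proof.
have E : Lv a0 a1 a2 a3 = (a0 + a2) ^+ 2 * (a0 - a2) ^+ 2 * (a0 + a3) ^+ 2 * (a0 - a3) ^+ 2 / a0 ^+ 4.
  have -> : a1 = a2 * a3 / a0 by rewrite -M1; field.
  by rewrite /Lv; field.
by split; apply: contraNneq L => h; rewrite E h expr0n !(mulr0, mul0r).
Qed.

Lemma M2_neq : a0 * a2 - a1 * a3 != 0.
Proof.
have [_ _ p m] := M1_neq.
have -> : a0 * a2 - a1 * a3 = a2 / a0 * (a0 + a3) * (a0 - a3).
  have -> : a1 = a2 * a3 / a0 by rewrite -M1; field.
  by field.
by rewrite !mulf_neq0 ?invr_eq0.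
Qed.

Lemma M3_neq : a0 * a3 - a1 * a2 != 0.
Proof.
have [p m _ _] := M1_neq.
have -> : a0 * a3 - a1 * a2 = a3 / a0 * (a0 + a2) * (a0 - a2).
  have -> : a1 = a2 * a3 / a0 by rewrite -M1; field.
  by field.
by rewrite !mulf_neq0 ?invr_eq0.
Qed.
End Degenerate.

Lemma edge_dec X : edge X \/ ~ edge X. Proof. exact: classic. Qed.

(** Exactly one factor lies on an edge; an edge in Y or in Z would make M_2 or M_3 vanish. *)
Lemma degenerate_only_X (a0 a1 a2 a3 : C) X Y Z : Lv a0 a1 a2 a3 != 0 ->
  a0 != 0 -> a1 != 0 -> a2 != 0 -> a3 != 0 ->
  a0 * a2 - a1 * a3 != 0 -> a0 * a3 - a1 * a2 != 0 ->
  nzp X -> nzp Y -> nzp Z -> sing3 a0 a1 a2 a3 0 X Y Z ->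
  [/\ edge X, ~ edge Y & ~ edge Z].
Proof.
move=> L n0 n1 n2' n3 M2 M3 nX nY nZ S.
have S' := sing3_rot S; have S'' := sing3_rot S'.
have L' : Lv a0 a2 a3 a1 != 0 by rewrite Lv_rot.
have L'' : Lv a0 a3 a1 a2 != 0 by rewrite Lv_rot Lv_rot.
have [eX|eX] := edge_dec X.
  split=> // e; first exact: (sing3_two_edges L nX nY nZ S eX e).
  exact: (sing3_two_edges L'' nZ nX nY S'' e eX).
have [eY|eY] := edge_dec Y; have [eZ|eZ] := edge_dec Z; exfalso.
- exact: (sing3_two_edges L' nY nZ nX S' eY eZ).
- have [e [EY r0]] := edge_cases nY eY.
  have [_ _ M _ _] := degenerate_edge n0 r0 EY eZ eX S'.
  by case/eqP: M2; lincomb M.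
- have [e [EZ r0]] := edge_cases nZ eZ.
  have [_ _ M _ _] := degenerate_edge n0 r0 EZ eX eY S''.
  by case/eqP: M3; lincomb M.
- exact: (degenerate_has_edge n0 n1 n2' n3 eX eY eZ S).
Qed.

Lemma peq1_degenerate X (z : C) (c d : C) (e : bool) : c + d != 0 -> c - d != 0 ->
  z ^+ 2 = (d - c) / (c + d) ->
  c * sv X.1 X.2 = - ((-1) ^+ e * d * dv X.1 X.2) ->
  exists b : bool, peq1 X (act1 b e (z, 1)).
Proof.
case: X => u v; rewrite /sv /dv /peq1 /act1 /= => p m hz H.
have /eqP : (if e then v else u) ^+ 2 = (z * (if e then u else v)) ^+ 2.
  apply: (mulfI p); rewrite exprMn hz; case: e H => /=; rewrite ?expr1 ?expr0 => H.
    by apply: (lc H); field.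
  by apply: (lc H); field.
rewrite eqf_sqr => /orP[]/eqP E; [exists false|exists true]; case: e E {H} => /= ->; ring.
Qed.

Lemma one_node_orbit_M1 (a0 a1 a2 a3 : C) : Lv a0 a1 a2 a3 != 0 ->
  a0 != 0 -> a1 != 0 -> a2 != 0 -> a3 != 0 -> a0 * a1 = a2 * a3 ->
  one_node_orbit a0 a1 a2 a3 0.
Proof.
move=> L n0 n1 n2' n3 M1.
have [p2 m2 p3 m3] := M1_neq L n0 M1.
pose z := sqrtC ((a2 - a0) / (a0 + a2)); pose y := sqrtC ((a3 - a0) / (a0 + a3)).
have hz : z ^+ 2 = (a2 - a0) / (a0 + a2) by rewrite sqrtCK.
have hy : y ^+ 2 = (a3 - a0) / (a0 + a3) by rewrite sqrtCK.
have nz1 (x : C) : nzp (x, 1) by rewrite /nzp /= oner_neq0 orbT.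
exists (1, 0), (y, 1), (z, 1); split=> //.
- by rewrite /nzp /= oner_neq0.
- have a1E : a1 = a2 * a3 / a0 by rewrite -M1; field.
  by rewrite /sing3 /sing6 /crit /gv /hv /sv /dv /= hz hy a1E; do 2!split; field; rewrite ?n0 ?p2 ?p3.
move=> X Y Z nX nY nZ S.
have [eX eY eZ] := degenerate_only_X L n0 n1 n2' n3 (M2_neq L n0 n2' M1) (M3_neq L n0 n3 M1) nX nY nZ S.
have [e [EX r0]] := edge_cases nX eX.
have [A B _ dYn dZn] := degenerate_edge n0 r0 EX eY eZ S.
split.
  have [by_ Hy] := peq1_degenerate p3 m3 hy A; have [bz Hz] := peq1_degenerate p2 m2 hz B.
  (* e_1 fixes X, so the bit of the first factor is free and is chosen to make that of the third
     equal to [bz]. *)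
  exists (by_ (+) bz), by_, e; split=> //; last by rewrite addbC addKb.
  by rewrite EX /peq1 /act1; case: e {EX A B Hy Hz} => /=; case: (_ (+) _) => /=; ring.
have sg2 : (-1) ^+ e * (-1) ^+ e = 1 :> C by rewrite -expr2 sqrr_sign.
have sgn : ((-1) ^+ e : C) = 1 \/ ((-1) ^+ e : C) = -1.
  by case: (e); [right; rewrite expr1 | left; rewrite expr0].
have cX : chart1 X = (- (-1) ^+ e, 0, X.1 + X.2).
  rewrite {1}EX; case: e {EX A B sg2 sgn}; rewrite /chart1 /act1 /=.
    by rewrite r0 expr1 opprK.
  by rewrite eqxx expr0.
move: (X.1 + X.2) r0 cX {EX} => r r0 cX.
have := Lv_sign L sgn sgn; move: ((-1) ^+ e) A B sg2 cX {sgn} => t A B t2 cX LL.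
have [u1 v1] := noedgeP eY; have [u2 v2] := noedgeP eZ.
rewrite /hdet3 /q0 /q1 /q2 cX !chart1_noedge // /cq /cq' /cq'' /triv5 /= !mul1r.
set sY := sv Y.1 _ in A *; set dY := dv Y.1 _ in A dYn *.
set sZ := sv Z.1 _ in B *; set dZ := dv Z.1 _ in B dZn *.
have -> : sv 0 r = r ^+ 2 by rewrite /sv expr0n add0r.
have -> : - t * dv 0 r = t * r ^+ 2 by rewrite /dv expr0n sub0r mulrNN.
have B' : a1 * dZ + t * a3 * sZ = 0.
  by apply: (mulfI n0); apply: (lc (lcD (lcM (dZ) M1) (lcD (lcM (t * a3) B) (lcM (- a2 * a3 * dZ) t2)))); ring.
have A' : a1 * dY + t * a2 * sY = 0.
  by apply: (mulfI n0); apply: (lc (lcD (lcM (dY) M1) (lcD (lcM (t * a2) A) (lcM (- a2 * a3 * dY) t2)))); ring.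
(* The Hessian splits into h00 and an antidiagonal block in y, z, so its determinant is - h00 h12^2.
   Up to units, h12 is a factor of L. *)
set h00 := (X in det3 X); set h11 := (X in det3 _ X); set h22 := (X in det3 _ _ X).
set h01 := (X in det3 _ _ _ X); set h02 := (X in det3 _ _ _ _ X); set h12 := (X in det3 _ _ _ _ _ X).
have -> : h01 = 0 by rewrite /h01; ring.
have -> : h02 = 0 by rewrite /h02; ring.
have -> : h11 = 0 by rewrite /h11; lincomb (lcD (lcM (2 * r ^+ 2) B) (lcM (2 * r ^+ 2) B')).
have -> : h22 = 0 by rewrite /h22; lincomb (lcD (lcM (2 * r ^+ 2) A) (lcM (2 * r ^+ 2) A')).
have H12 : h12 = 4 * (Y.1 * Z.1 * r ^+ 2) * (a0 + t * t * a1 + t * a2 + t * a3).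
  by rewrite /h12 t2; ring.
have H00 : a0 * h00 = 8 * (a0 * a1 * (dY * dZ)).
  rewrite /h00; lincomb (lcD (lcM (2 * a0 * sZ - 2 * t * a2 * dZ) A)
    (lcD (lcM (- 4 * t * a3 * dY) B) (lcD (lcM (- 6 * dY * dZ) M1) (lcM (6 * a2 * a3 * dY * dZ) t2)))).
have h00n : h00 != 0.
  apply: contraNneq n0 => h; move/eqP: H00; rewrite h mulr0 eq_sym.
  by rewrite !mulf_eq0 (negbTE n1) (negbTE dYn) (negbTE dZn) pnatr_eq0 /= !orbF.
have h12n : h12 != 0 by rewrite H12 !mulf_neq0 // ?expf_neq0 // pnatr_eq0.
rewrite (_ : det3 _ _ _ _ _ _ = - (h00 * h12 ^+ 2)); last by rewrite /det3; ring.
by rewrite oppr_eq0 mulf_neq0 // expf_neq0.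
Qed.
End Nodes.

(** * General position in terms of Psi *)

Section GeneralPosition.
Variable C : numClosedFieldType.
Implicit Types (p : pt C) (X Y Z : C * C).

Let n2 : (2 : C) != 0. Proof. by rewrite pnatr_eq0. Qed.

Lemma exactlyE (I : finType) n (P : pt C -> Prop) : #|I| = n ->
  (exists f : I -> pt C, (forall i, valid (f i) /\ P (f i)) /\
    (forall i j, peq (f i) (f j) -> i = j) /\
    (forall x, valid x -> P x -> exists i, peq x (f i))) -> exactly n P.
Proof.
move=> cI [f [fP [fI fS]]]; exists (fun i => f (enum_val (cast_ord (esym cI) i))); split=> //.
split=> [i j /fI/enum_val_inj/cast_ord_inj //|x vx Px].
have [i pi] := fS x vx Px; exists (cast_ord cI (enum_rank i)).
by rewrite cast_ordK enum_rankK.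
Qed.

Lemma card_bool3 : #|{: bool * bool * bool}| = 8%N.
Proof. by rewrite !card_prod card_bool. Qed.

Lemma peq1_trans X Y Z : nzp Y -> peq1 X Y -> peq1 Y Z -> peq1 X Z.
Proof.
case: X Y Z => x0 x1 [y0 y1] [z0 z1]; rewrite /nzp /peq1 /= => /orP[] n h h'; apply: (mulfI n).
  lincomb (lcD (lcM x0 h') (lcM z0 h)).
lincomb (lcD (lcM x1 h') (lcM z1 h)).
Qed.

Definition pv X := X.1 * X.2.
Definition onZ5 (a0 a1 a2 a3 w : C) X Y Z :=
  triv5 a0 a1 a2 a3 w (sv X.1 X.2, dv X.1 X.2, pv X) (sv Y.1 Y.2, dv Y.1 Y.2, pv Y)
    (sv Z.1 Z.2, dv Z.1 Z.2, pv Z).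

Lemma onZ5E (a : 'I_5 -> C) p : onZ a p <->
  onZ5 (a (inord 0)) (a (inord 1)) (a (inord 2)) (a (inord 3)) (a (inord 4))
    (pr p 0) (pr p 1) (pr p 2) = 0.
Proof. exact: onZ3E. Qed.

Definition pe (b : bool) : C * C := if b then (0, 1) else (1, 0).

Lemma pe_edge b : edge (pe b). Proof. by case: b; rewrite /edge /= ?mul0r ?mulr0. Qed.
Lemma nzp_pe b : nzp (pe b). Proof. by case: b; rewrite /nzp /= oner_neq0 ?orbT. Qed.
Lemma edge_pe X : nzp X -> edge X -> peq1 X (pe (X.2 != 0)).
Proof.
rewrite /edge /peq1; case: (eqVneq X.2 0) => /= [-> _ _|v0 _ /eqP]; first by rewrite !mulr0 mul0r.
by rewrite mulf_eq0 (negbTE v0) orbF => /eqP ->; rewrite mul0r mulr0.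
Qed.
Lemma pe_inj b b' : peq1 (pe b) (pe b') -> b = b'.
Proof.
case: b; case: b' => //; rewrite /peq1 /= ?mulr0 ?mul0r ?mulr1 ?mul1r => /eqP.
  by rewrite eq_sym oner_eq0.
by rewrite oner_eq0.
Qed.

(* The values of F at the fixed points of G_0: on the curve x = pe b, y = pe b'
   F restricts to Kv b b' false z_0^2 + Kv b b' true z_1^2 up to a unit. *)
Definition Kv (a0 a1 a2 a3 : C) (b b' c : bool) :=
  a0 + (-1) ^+ (b (+) b') * a3 + (-1) ^+ c * ((-1) ^+ b' * a1 + (-1) ^+ b * a2).

(** Only four of the eight values differ, because K b b' c depends on b + b' and b + c alone; they
    are the factors of L. *)
Lemma Kv_Lv a0 a1 a2 a3 :
  (forall b b' c, Kv a0 a1 a2 a3 b b' c != 0) <-> Lv a0 a1 a2 a3 != 0.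
Proof.
have E1 : a0 + a1 + a2 + a3 = Kv a0 a1 a2 a3 false false false by rewrite /Kv /=; ring.
have E2 : a0 - a1 - a2 + a3 = Kv a0 a1 a2 a3 false false true by rewrite /Kv /=; ring.
have E3 : a0 - a1 + a2 - a3 = Kv a0 a1 a2 a3 false true false by rewrite /Kv /=; ring.
have E4 : a0 + a1 - a2 - a3 = Kv a0 a1 a2 a3 false true true by rewrite /Kv /=; ring.
rewrite /Lv !mulf_eq0 !negb_or E1 E2 E3 E4; split=> [H|/andP[/andP[/andP[L1 L2] L3] L4] b b' c].
  by rewrite !H.
have -> : Kv a0 a1 a2 a3 b b' c = Kv a0 a1 a2 a3 false (b (+) b') (b (+) c).
  by case: b; case: b'; case: c; rewrite /Kv /=; ring.
by case: (b (+) b'); case: (b (+) c).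
Qed.

Lemma onZ5_pe (a0 a1 a2 a3 w : C) X Y Z (b b' : bool) : peq1 X (pe b) -> peq1 Y (pe b') ->
  onZ5 a0 a1 a2 a3 w X Y Z = sv X.1 X.2 * sv Y.1 Y.2 *
  (Kv a0 a1 a2 a3 b b' false * Z.1 ^+ 2 + Kv a0 a1 a2 a3 b b' true * Z.2 ^+ 2).
Proof.
have key U (c : bool) : peq1 U (pe c) -> pv U = 0 /\ dv U.1 U.2 = (-1) ^+ c * sv U.1 U.2.
  case: U => u v; rewrite /peq1 /pv /sv /dv; case: c => /=; rewrite ?mulr0 ?mulr1 => H.
    by rewrite H; split; ring.
  by rewrite -H; split; ring.
move=> /key[pX dX] /key[pY dY].
by rewrite /onZ5 /triv5 /= pX pY dX dY /Kv {2}/sv {2}/dv /sv /dv signr_addb /= expr0 expr1; ring.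
Qed.

Lemma sv_pe X b : nzp X -> peq1 X (pe b) -> sv X.1 X.2 != 0.
Proof.
case: X => u v; rewrite /nzp /peq1 /sv; case: b => /=; rewrite ?mulr0 ?mulr1 => n E.
  by move: n; rewrite E eqxx expr0n add0r /= sqrf_eq0.
by move: n; rewrite -E eqxx orbF expr0n addr0 sqrf_eq0.
Qed.

Section FixedCurves.
Variables a0 a1 a2 a3 w : C.
Let K := Kv a0 a1 a2 a3.

Definition zeta b b' := sqrtC (- K b b' true / K b b' false).

(** The fixed locus of (e_1, e_1, 1) consists of four curves, indexed by two bits; the third bit
    selects one of the two roots on each. *)
Definition fixpt (i : bool * bool * bool) : (C * C) * (C * C) * (C * C) :=
  (pe i.1.1, pe i.1.2, ((-1) ^+ i.2 * zeta i.1.1 i.1.2, 1)).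

Lemma onZ5_fixed X Y Z b b' : nzp X -> nzp Y -> peq1 X (pe b) -> peq1 Y (pe b') ->
  onZ5 a0 a1 a2 a3 w X Y Z = 0 <-> K b b' false * Z.1 ^+ 2 + K b b' true * Z.2 ^+ 2 = 0.
Proof.
move=> nX nY eX eY; rewrite (onZ5_pe _ _ _ _ _ _ eX eY); split=> [/eqP|->]; last by rewrite mulr0.
by rewrite !mulf_eq0 (negbTE (sv_pe nX eX)) (negbTE (sv_pe nY eY)) => /eqP.
Qed.

Lemma quad_root (k l z : C) Z : k != 0 -> z ^+ 2 = - l / k ->
  k * Z.1 ^+ 2 + l * Z.2 ^+ 2 = 0 -> peq1 Z (z, 1) \/ peq1 Z (- z, 1).
Proof.
move=> kn hz H; have /eqP : Z.1 ^+ 2 = (z * Z.2) ^+ 2.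
  by apply: (mulfI kn); rewrite exprMn hz; apply: (lc H); field.
by rewrite eqf_sqr /peq1 /= !mulr1 => /orP[]/eqP ->; [left|right]; ring.
Qed.

Lemma fixpt_spec : Lv a0 a1 a2 a3 != 0 ->
  [/\ forall i, [/\ nzp (fixpt i).1.1, nzp (fixpt i).1.2, nzp (fixpt i).2,
         edge (fixpt i).1.1 & edge (fixpt i).1.2] /\
         onZ5 a0 a1 a2 a3 w (fixpt i).1.1 (fixpt i).1.2 (fixpt i).2 = 0,
      forall i j, [/\ peq1 (fixpt i).1.1 (fixpt j).1.1, peq1 (fixpt i).1.2 (fixpt j).1.2
         & peq1 (fixpt i).2 (fixpt j).2] -> i = j &
      forall X Y Z, nzp X -> nzp Y -> nzp Z -> edge X -> edge Y ->
         onZ5 a0 a1 a2 a3 w X Y Z = 0 ->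
         exists i, [/\ peq1 X (fixpt i).1.1, peq1 Y (fixpt i).1.2 & peq1 Z (fixpt i).2]].
Proof.
move=> /Kv_Lv Kn.
have z2 b b' : zeta b b' ^+ 2 = - K b b' true / K b b' false by rewrite sqrtCK.
have zn b b' : zeta b b' != 0 by rewrite -sqrf_eq0 z2 mulf_neq0 ?invr_eq0 ?oppr_eq0.
split.
- case=> -[b b'] c; rewrite /fixpt /=; split.
    by split; rewrite ?nzp_pe //; first [exact: pe_edge | rewrite /nzp /= oner_neq0 orbT].
  apply/(onZ5_fixed _ (nzp_pe b) (nzp_pe b') (peq1_refl _) (peq1_refl _)) => /=.
  rewrite exprMn z2 sqrr_sign; field.
  exact: Kn.
- case=> -[b b'] c [[d d'] f] /= [/pe_inj-> /pe_inj->]; rewrite /peq1 /= mulr1 mul1r.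
  by move=> /(mulIf (zn _ _)) /signr_inj ->.
move=> X Y Z nX nY nZ /(edge_pe nX) eX /(edge_pe nY) eY /(onZ5_fixed _ nX nY eX eY) H.
have [h|h] := quad_root (Kn _ _ _) (z2 _ _) H.
  by exists (X.2 != 0, Y.2 != 0, false); split=> //=; rewrite expr0 mul1r.
by exists (X.2 != 0, Y.2 != 0, true); split=> //=; rewrite expr1 mulN1r.
Qed.
End FixedCurves.

Lemma fixed_edge X : peq1 (act1 true false X) X <-> edge X.
Proof.
case: X => u v; rewrite /peq1 /act1 /edge /=; split=> H; last by lincomb (lcM 2 H).
by apply: (mulfI n2); lincomb H.
Qed.

(** Rotating the factors reduces the other two nonidentity elements of G_0 to (e_1, e_1, 1). *)
Lemma gen_pos_fixed (a : 'I_5 -> C) :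
  Lv (a (inord 0)) (a (inord 1)) (a (inord 2)) (a (inord 3)) != 0 ->
  forall g, in_G0 g -> g != gid -> exactly 8 (fun p => onZ a p /\ peq (act g p) p).
Proof.
move=> L [[b b'] [//|]] _ gn.
set a0 := a _ in L; set a1 := a _ in L; set a2 := a _ in L; set a3 := a _ in L; set w := a (inord 4).
apply: (exactlyE card_bool3).
have fx p : peq (act (b, b', false) p) p <->
    [/\ b -> edge (pr p 0), b' -> edge (pr p 1) & b (+) b' -> edge (pr p 2)].
  rewrite peqE !pr_act //= /gbit /=.
  have one (c : bool) X : peq1 (act1 c false X) X <-> (c -> edge X).
    by case: c; [rewrite fixed_edge; split=> // h; apply: h | split=> // _; apply: peq1_refl].
  by split=> -[/one h0 /one h1 /one h2]; split=> //; apply/one.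
have L' : Lv a0 a2 a3 a1 != 0 by rewrite Lv_rot.
have L'' : Lv a0 a3 a1 a2 != 0 by rewrite Lv_rot Lv_rot.
have rot a0' a1' a2' a3' X Y Z : onZ5 a0' a1' a2' a3' w X Y Z = onZ5 a0' a2' a3' a1' w Y Z X.
  by rewrite /onZ5 -[LHS]triv5_rot.
case: b b' gn fx => -[] // _ fx.
- have [F1 F2 F3] := fixpt_spec w L; set F := fixpt _ _ _ _ in F1 F2 F3.
  exists (fun i => mkp (F i).1.1 (F i).1.2 (F i).2); split; [|split].
  + move=> i; have [[? ? ? ? ?] ?] := F1 i.
    by rewrite validE fx onZ5E !pr_mkp.
  + by move=> i j; rewrite peqE !pr_mkp => /F2.
  move=> x /validE[v0 v1 v2] [/onZ5E o /fx[/(_ isT) e0 /(_ isT) e1 _]].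
  by have [i Hi] := F3 _ _ _ v0 v1 v2 e0 e1 o; exists i; rewrite peqE !pr_mkp.
- have [F1 F2 F3] := fixpt_spec w L''; set F := fixpt _ _ _ _ in F1 F2 F3.
  exists (fun i => mkp (F i).1.2 (F i).2 (F i).1.1); split; [|split].
  + move=> i; have [[? ? ? ? ?] o] := F1 i.
    by rewrite validE fx onZ5E !pr_mkp -/a0 -/a1 -/a2 -/a3 -/w rot rot.
  + by move=> i j; rewrite peqE !pr_mkp => -[? ? ?]; apply: F2.
  move=> x /validE[v0 v1 v2] [/onZ5E o /fx[/(_ isT) e0 _ /(_ isT) e1]].
  have [|i [Hi Hj Hk]] := F3 _ _ _ v2 v0 v1 e1 e0; first by rewrite rot.
  by exists i; rewrite peqE !pr_mkp.
- have [F1 F2 F3] := fixpt_spec w L'; set F := fixpt _ _ _ _ in F1 F2 F3.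
  exists (fun i => mkp (F i).2 (F i).1.1 (F i).1.2); split; [|split].
  + move=> i; have [[? ? ? ? ?] o] := F1 i.
    by rewrite validE fx onZ5E !pr_mkp -/a0 -/a1 -/a2 -/a3 -/w rot.
  + by move=> i j; rewrite peqE !pr_mkp => -[? ? ?]; apply: F2.
  move=> x /validE[v0 v1 v2] [/onZ5E o /fx[_ /(_ isT) e0 /(_ isT) e1]].
  have [|i [Hi Hj Hk]] := F3 _ _ _ v1 v2 v0 e0 e1; first by rewrite rot rot.
  by exists i; rewrite peqE !pr_mkp.
Qed.

Definition psiv (a0 a1 a2 a3 w : C) := Lv a0 a1 a2 a3 *
  ((64 * a0 ^+ 2 - w ^+ 2) * (64 * a1 ^+ 2 - w ^+ 2)
   * (64 * a2 ^+ 2 - w ^+ 2) * (64 * a3 ^+ 2 - w ^+ 2)).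

Lemma psivP (a0 a1 a2 a3 w : C) : psiv a0 a1 a2 a3 w != 0 <->
  Lv a0 a1 a2 a3 != 0 /\
  [/\ 64 * a0 ^+ 2 - w ^+ 2 != 0, 64 * a1 ^+ 2 - w ^+ 2 != 0,
      64 * a2 ^+ 2 - w ^+ 2 != 0 & 64 * a3 ^+ 2 - w ^+ 2 != 0].
Proof.
rewrite /psiv; split=> [|[? [? ? ? ?]]]; last by do 4!(apply: mulf_neq0 => //).
by rewrite mulf_eq0 negb_or => /andP[->]; rewrite !mulf_eq0 !negb_or => /andP[/andP[/andP[-> ->] ->] ->].
Qed.

(** The fixed points are (1 : 1), (1 : -1) for e_2 and (1 : i), (1 : -i) for e_2 e_1. *)
Lemma fixed_swap (b : bool) X : nzp X -> peq1 (act1 b true X) X ->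
  pv X != 0 /\ (if b then sv X.1 X.2 = 0 /\ dv X.1 X.2 ^+ 2 = - 4 * pv X ^+ 2
                else dv X.1 X.2 = 0 /\ sv X.1 X.2 ^+ 2 = 4 * pv X ^+ 2).
Proof.
case: X => u v; rewrite /nzp /peq1 /act1 /pv /sv /dv; case: b => /= n E.
  have E' : u ^+ 2 = - v ^+ 2 by lincomb (lcM (-1) E).
  have v0 : v != 0.
    apply: contraTneq n => z; have -> : u = 0 by apply/eqP; rewrite -sqrf_eq0 E' z expr0n oppr0.
    by rewrite z eqxx.
  have u0 : u != 0 by rewrite -sqrf_eq0 E' oppr_eq0 sqrf_eq0.
  by split; [rewrite mulf_neq0|split; rewrite ?exprMn E'; ring].
have E' : u ^+ 2 = v ^+ 2 by lincomb (lcM (-1) E).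
have v0 : v != 0.
  apply: contraTneq n => z; have -> : u = 0 by apply/eqP; rewrite -sqrf_eq0 E' z expr0n.
  by rewrite z eqxx.
have u0 : u != 0 by rewrite -sqrf_eq0 E' sqrf_eq0.
by split; [rewrite mulf_neq0|split; rewrite ?exprMn E'; ring].
Qed.

(** At such a fixed point only one of the first four terms of F survives. With P the product of the
    three values of p, it is a_i q with q^2 = 64 P^2, so F = 0 would give 64 a_i^2 = w^2. *)
Lemma gen_pos_free (a : 'I_5 -> C) :
  [/\ 64 * a (inord 0) ^+ 2 - a (inord 4) ^+ 2 != 0,
      64 * a (inord 1) ^+ 2 - a (inord 4) ^+ 2 != 0,
      64 * a (inord 2) ^+ 2 - a (inord 4) ^+ 2 != 0 &
      64 * a (inord 3) ^+ 2 - a (inord 4) ^+ 2 != 0] ->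
  forall g, ~~ in_G0 g -> forall p, valid p -> onZ a p -> ~ peq (act g p) p.
Proof.
move=> [N0 N1 N2 N3] [[b b'] [_|//]] p /validE[v0 v1 v2] /onZ5E o.
rewrite peqE !pr_act //= /gbit /= => -[/(fixed_swap v0) [p0 F0] /(fixed_swap v1) [p1 F1]].
move=> /(fixed_swap v2) [p2 F2].
have pn : (pv (pr p 0) * pv (pr p 1) * pv (pr p 2)) ^+ 2 != 0.
  by apply: expf_neq0; do 2!(apply: mulf_neq0 => //).
move: o; rewrite /onZ5 /triv5 /=.
move: p0 p1 p2 F0 F1 F2 pn.
set s0 := sv _ _; set d0 := dv _ _; set s1 := sv _ _; set d1 := dv _ _; set s2 := sv _ _; set d2 := dv _ _.
set P0 := pv _; set P1 := pv _; set P2 := pv _ => p0 p1 p2 F0 F1 F2 pn o.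
have fin (c q : C) : 64 * c ^+ 2 - a (inord 4) ^+ 2 != 0 -> q ^+ 2 = 64 * (P0 * P1 * P2) ^+ 2 ->
    c * q + a (inord 4) * (P0 * P1 * P2) = 0 -> False.
  move=> cn hq h; case/eqP: (mulf_neq0 cn pn).
  have E : a (inord 4) * (P0 * P1 * P2) = - (c * q) by lincomb h.
  transitivity (64 * c ^+ 2 * (P0 * P1 * P2) ^+ 2 - (a (inord 4) * (P0 * P1 * P2)) ^+ 2); first by ring.
  by rewrite E; lincomb (lcM (- c ^+ 2) hq).
case: b F0 o F2; case: b' F1 => /= -[z1 q1] [z0 q0]; rewrite z0 z1 => o [z2 q2]; rewrite z2 in o.
- apply: (fin _ (d0 * d1 * s2) N3); first by rewrite [LHS]exprMn [X in X * _]exprMn q0 q1 q2; ring.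
  by rewrite -[RHS]o; ring.
- apply: (fin _ (d0 * s1 * d2) N2); first by rewrite [LHS]exprMn [X in X * _]exprMn q0 q1 q2; ring.
  by rewrite -[RHS]o; ring.
- apply: (fin _ (s0 * d1 * d2) N1); first by rewrite [LHS]exprMn [X in X * _]exprMn q0 q1 q2; ring.
  by rewrite -[RHS]o; ring.
- apply: (fin _ (s0 * s1 * s2) N0); first by rewrite [LHS]exprMn [X in X * _]exprMn q0 q1 q2; ring.
  by rewrite -[RHS]o; ring.
Qed.

Lemma gen_pos_psi_free (a : 'I_5 -> C) :
  (forall g, ~~ in_G0 g -> forall p, valid p -> onZ a p -> ~ peq (act g p) p) ->
  [/\ 64 * a (inord 0) ^+ 2 - a (inord 4) ^+ 2 != 0,
      64 * a (inord 1) ^+ 2 - a (inord 4) ^+ 2 != 0,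
      64 * a (inord 2) ^+ 2 - a (inord 4) ^+ 2 != 0 &
      64 * a (inord 3) ^+ 2 - a (inord 4) ^+ 2 != 0].
Proof.
move=> H.
(* The sign bit c, used in the first factor only, decides between 8 a_i = w and 8 a_i = - w. *)
pose fp (b c : bool) : C * C := (1, (if b then 'i else 1) * (-1) ^+ c).
have i2 : 'i * 'i = -1 :> C by rewrite -expr2 sqrCi.
have fpE b c : [/\ nzp (fp b c), peq1 (act1 b true (fp b c)) (fp b c),
    sv (fp b c).1 (fp b c).2 = (if b then 0 else 2), dv (fp b c).1 (fp b c).2 = (if b then 2 else 0) &
    pv (fp b c) = (if b then 'i else 1) * (-1) ^+ c].
  rewrite /nzp /peq1 /act1 /pv /sv /dv /fp /= oner_neq0 expr1n exprMn sqrr_sign mulr1 mul1r.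
  by case: b; split=> //=; rewrite ?sqrCi ?expr1n ?mul1r ?mulr1; try ring;
    case: c => /=; rewrite ?expr1 ?expr0 ?mulr1 ?mulrN ?mulNr ?mulr1 ?i2 ?mulrNN ?opprK ?mulr1.
have key b b' : forall c, onZ a (mkp (fp b c) (fp b' false) (fp (b (+) b') false)) -> False.
  move=> c o; apply: (H (b, b', true) isT _ _ o).
    by rewrite validE !pr_mkp; have [? _ _ _ _] := fpE b c; have [? _ _ _ _] := fpE b' false;
      have [? _ _ _ _] := fpE (b (+) b') false.
  by rewrite peqE !pr_act // !pr_mkp; have [_ ? _ _ _] := fpE b c; have [_ ? _ _ _] := fpE b' false;
      have [_ ? _ _ _] := fpE (b (+) b') false.
have two (x w : C) : 64 * x ^+ 2 - w ^+ 2 = 0 -> exists c : bool, 8 * x = (-1) ^+ c * w.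
  move=> E; have /eqP : (8 * x) ^+ 2 = w ^+ 2 by lincomb E.
  by rewrite eqf_sqr => /orP[]/eqP->; [exists false|exists true]; rewrite ?expr0 ?expr1; ring.
have sgN (c : bool) : (-1) ^+ (~~ c) = - (-1) ^+ c :> C by case: c; rewrite ?expr0 ?expr1 ?opprK.
split; apply/eqP => /two[c E].
- apply: (key false false (~~ c)); apply/onZ5E; rewrite !pr_mkp /onZ5 /triv5.
  have [_ _ -> -> ->] := fpE false (~~ c); have [_ _ -> -> ->] := fpE false false.
  by rewrite /= sgN expr0; lincomb E.
- apply: (key false true c); apply/onZ5E; rewrite !pr_mkp /onZ5 /triv5.
  have [_ _ -> -> ->] := fpE false c; have [_ _ -> -> ->] := fpE true false.
  by rewrite /= expr0; apply: (lc (lcD E (lcM ((-1) ^+ c * a (inord 4)) i2))); ring.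
- apply: (key true false c); apply/onZ5E; rewrite !pr_mkp /onZ5 /triv5.
  have [_ _ -> -> ->] := fpE true c; have [_ _ -> -> ->] := fpE false false.
  have [_ _ -> -> ->] := fpE true false.
  by rewrite /= expr0; apply: (lc (lcD E (lcM ((-1) ^+ c * a (inord 4)) i2))); ring.
- apply: (key true true c); apply/onZ5E; rewrite !pr_mkp /onZ5 /triv5.
  have [_ _ -> -> ->] := fpE true c; have [_ _ -> -> ->] := fpE true false.
  have [_ _ -> -> ->] := fpE false false.
  by rewrite /= expr0; apply: (lc (lcD E (lcM ((-1) ^+ c * a (inord 4)) i2))); ring.
Qed.
End GeneralPosition.

(** * N is the locus Phi = 0, Psi <> 0 *)

Section Characterization.
Variable C : numClosedFieldType.
Implicit Types (p : pt C) (X Y Z : C * C).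
Arguments pr : simpl never.

(** A vanishing K b b' c either puts a whole fixed curve on Z or makes its two intersection points
    coincide; both contradict the count of eight. *)
Lemma exactly_Lv (a : 'I_5 -> C) :
  exactly 8 (fun p => onZ a p /\ peq (act (true, true, false) p) p) ->
  Lv (a (inord 0)) (a (inord 1)) (a (inord 2)) (a (inord 3)) != 0.
Proof.
set a0 := a _; set a1 := a _; set a2 := a _; set a3 := a _.
pose K := Kv a0 a1 a2 a3; pose w := a (inord 4).
move=> [f [fP [fI fS]]].
have fx p : peq (act (true, true, false) p) p <-> edge (pr p 0) /\ edge (pr p 1).
  rewrite peqE !pr_act //; split=> [[/fixed_edge ? /fixed_edge ? _]|[? ?]] //.
  by split; [apply/fixed_edge|apply/fixed_edge|apply: peq1_refl].
pose b i := (pr (f i) 0).2 != 0; pose b' i := (pr (f i) 1).2 != 0.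
have D i : [/\ peq1 (pr (f i) 0) (pe C (b i)), peq1 (pr (f i) 1) (pe C (b' i)), nzp (pr (f i) 2) &
    K (b i) (b' i) false * (pr (f i) 2).1 ^+ 2 + K (b i) (b' i) true * (pr (f i) 2).2 ^+ 2 = 0].
  have [/validE[v0 v1 v2] [/onZ5E o /fx[e0 e1]]] := fP i.
  have E0 := edge_pe v0 e0; have E1 := edge_pe v1 e1.
  by split=> //; apply/(onZ5_fixed _ _ _ _ w _ v0 v1 E0 E1).
have nK c c' : K c c' false = 0 -> K c c' true = 0 -> False.
  (* Nine distinct points of a fixed curve contained in Z are too many. *)
  move=> z z'; pose q (n : 'I_9) := mkp (pe C c) (pe C c') (1, (n : nat)%:R).
  have qP n : exists i, peq (q n) (f i).
    have nz1 : nzp (1, (n : nat)%:R : C) by rewrite /nzp /= oner_neq0.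
    apply: fS; first by rewrite validE !pr_mkp !nzp_pe nz1.
    rewrite fx onZ5E !pr_mkp; split; last by split; apply: pe_edge.
    apply/(onZ5_fixed _ _ _ _ _ _ (nzp_pe _ c) (nzp_pe _ c') (peq1_refl _) (peq1_refl _)).
    by rewrite -/a0 -/a1 -/a2 -/a3 -/K z z' !mul0r addr0.
  have [h hP] := choice _ qP.
  have hI : injective h.
    move=> m n mn; have /peqE[_ _ M] := hP m; have /peqE[_ _ N] := hP n.
    rewrite mn in M; have /validE[_ _ v2] := proj1 (fP (h n)).
    have := peq1_trans v2 M (peq1_sym N); rewrite !pr_mkp /peq1 /= mul1r mulr1 => /eqP.
    by rewrite eqr_nat => /eqP E; apply: val_inj.
  by have := leq_card h hI; rewrite !card_ord.
(* The bit tells the two roots on a curve apart; where they coincide it is [true] by convention, so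
   the label with bit [false] is missed there. *)
pose r i := if (K (b i) (b' i) false != 0) && (K (b i) (b' i) true != 0)
  then (pr (f i) 2).1 == zeta a0 a1 a2 a3 (b i) (b' i) * (pr (f i) 2).2 else true.
pose lab i : bool * bool * bool := (b i, b' i, r i).
have labI : injective lab.
  move=> i j Eij; have Eb : b i = b j := congr1 (fun t => t.1.1) Eij.
  have Eb' : b' i = b' j := congr1 (fun t => t.1.2) Eij.
  have : r i = r j := congr1 snd Eij.
  have [X1 Y1 n1 Z1] := D i; have [X2 Y2 n2' Z2] := D j.
  rewrite /r; rewrite -Eb -Eb' in X2 Y2 Z2 *; move: (b i) (b' i) X1 Y1 Z1 X2 Y2 Z2 => c c' X1 Y1 Z1 X2 Y2 Z2 T.
  apply: fI; apply/peqE; split.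
  - exact: peq1_trans (nzp_pe _ _) X1 (peq1_sym X2).
  - exact: peq1_trans (nzp_pe _ _) Y1 (peq1_sym Y2).
  move: T Z1 Z2; have := nK c c'.
  move: (pr (f i) 2) (pr (f j) 2) n1 n2' => [u v] [u' v'] _ _ /=; rewrite /peq1 /=.
  case: (eqVneq (K c c' false) 0) => [z|k0] /=; case: (eqVneq (K c c' true) 0) => [z'|k1] /= nn T.
  - by case: nn.
  - rewrite z !mul0r !add0r => /eqP; rewrite mulf_eq0 (negbTE k1) sqrf_eq0 => /eqP -> /eqP.
    by rewrite mulf_eq0 (negbTE k1) sqrf_eq0 => /eqP ->; rewrite mulr0 mul0r.
  - rewrite z' !mul0r !addr0 => /eqP; rewrite mulf_eq0 (negbTE k0) sqrf_eq0 => /eqP -> /eqP.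
    by rewrite mulf_eq0 (negbTE k0) sqrf_eq0 => /eqP ->; rewrite mulr0 mul0r.
  have z2 : zeta a0 a1 a2 a3 c c' ^+ 2 = - K c c' true / K c c' false by rewrite sqrtCK.
  move: (zeta _ _ _ _ c c') z2 T => t z2 T.
  move=> /(@quad_root _ _ _ _ (u, v) k0 z2); rewrite /peq1 /= !mulr1 => H1.
  move=> /(@quad_root _ _ _ _ (u', v') k0 z2); rewrite /peq1 /= !mulr1 => H2.
  have [E1|E1] := eqVneq u (t * v).
    by move: T; rewrite E1 eqxx => /esym/eqP ->; ring.
  have E2 : u' <> t * v' by move=> E; move: T; rewrite E eqxx (negbTE E1).
  have -> : u = v * - t by case: H1 => // E; case/eqP: E1; rewrite E mulrC.
  have -> : u' = v' * - t by case: H2 => // E; case: E2; rewrite E mulrC.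
  ring.
(* Eight points with distinct labels use all eight labels, so no curve has a double root. *)
have onto := inj_card_onto labI; rewrite card_bool3 card_ord leqnn in onto.
apply/Kv_Lv => c c' d; apply/eqP => z.
have /codomP[i] := onto isT (c, c', false).
rewrite /lab /r => -[<- <-]; rewrite -/K in z.
by case: d z => ->; rewrite eqxx ?andbF.
Qed.

Definition gadd (g h : gelt) : gelt := (g.1.1 (+) h.1.1, g.1.2 (+) h.1.2, g.2 (+) h.2).

Lemma gbit_add g h k : gbit (gadd g h) k = gbit g k (+) gbit h k.
Proof.
by case: g h => [[b1 b2] e] [[c1 c2] f]; rewrite /gbit /=; case: k => [|[|k]] //=; rewrite addbACA.
Qed.

Lemma peq_act g h p : peq (act g p) (act h p) -> peq (act (gadd g h) p) p.
Proof.
rewrite !peqE !pr_act // !gbit_add => -[H0 H1 H2].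
by split; apply: peq1_act.
Qed.

Lemma valid_act g p : valid p -> valid (act g p).
Proof. by rewrite !validE !pr_act // !nzp_act. Qed.

Lemma sing_act (a : 'I_5 -> C) g p : singZ a p -> singZ a (act g p).
Proof. by rewrite !sing3E !pr_act // => S; case: g => [[b b'] e]; apply: sing3_act. Qed.

Lemma card_gelt : #|{: gelt}| = 8%N. Proof. exact: card_bool3. Qed.

(** Stabilizers are trivial: elements outside G_0 act freely on Z, and a nonidentity element of G_0
    fixing a singular point would put it on two edges. *)
Lemma one_node_orbit_eight (a : 'I_5 -> C) :
  psiv (a (inord 0)) (a (inord 1)) (a (inord 2)) (a (inord 3)) (a (inord 4)) != 0 ->
  one_node_orbit (a (inord 0)) (a (inord 1)) (a (inord 2)) (a (inord 3)) (a (inord 4)) ->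
  eight_nodes a.
Proof.
move=> /psivP[L N] [X0 [Y0 [Z0 [nX nY nZ S H]]]].
pose p0 := mkp X0 Y0 Z0.
have v0 : valid p0 by rewrite validE !pr_mkp.
have s0 : singZ a p0 by rewrite sing3E !pr_mkp.
have orb p : valid p -> singZ a p -> exists g, peq p (act g p0).
  move=> /validE[x y z] /sing3E S'; have [[b [b' [e [P Q R]]]] _] := H _ _ _ x y z S'.
  by exists (b, b', e); rewrite peqE !pr_act // !pr_mkp.
split; last first.
  split; last by exists p0.
  move=> p /validE[x y z] sp; split=> //; rewrite hdet3E.
  by move/sing3E: sp => S'; have [_] := H _ _ _ x y z S'.
apply: (exactlyE card_gelt); exists (fun g => act g p0); split; [|split] => //.
  by move=> g; split; [apply: valid_act | apply: sing_act].
move=> g h /peq_act gh.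
have e2 : (gadd g h).2 = false.
  apply/negbTE/negP => e.
  have n : ~~ in_G0 (gadd g h) by rewrite /in_G0 negbK.
  exact: (gen_pos_free N n v0 (proj1 s0) gh).
have L' : Lv (a (inord 0)) (a (inord 2)) (a (inord 3)) (a (inord 1)) != 0 by rewrite Lv_rot.
have L'' : Lv (a (inord 0)) (a (inord 3)) (a (inord 1)) (a (inord 2)) != 0 by rewrite Lv_rot Lv_rot.
have E (c : bool) X : peq1 (act1 c false X) X -> c -> edge X by case: c => // /fixed_edge.
have : gadd g h = gid.
  move: e2 gh; case: (gadd g h) => [[c c'] e] /= ->; rewrite peqE !pr_act // !pr_mkp.
  case=> /E E0 /E E1 /E E2; move: E0 E1 E2; rewrite /gbit /=.
  case: c; case: c' => //= E0 E1 E2; exfalso.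
  - exact: (sing3_two_edges L nX nY nZ S (E0 isT) (E1 isT)).
  - exact: (sing3_two_edges L'' nZ nX nY (sing3_rot (sing3_rot S)) (E2 isT) (E0 isT)).
  - exact: (sing3_two_edges L' nY nZ nX (sing3_rot S) (E1 isT) (E2 isT)).
case: g h {gh e2} => [[b b'] e] [[c c'] f] [] /=.
have x (u v : bool) : u (+) v = false -> u = v by case: u; case: v.
by move=> /x -> /x -> /x ->.
Qed.

Definition phiv (a0 a1 a2 a3 w : C) := w ^+ 2 * Lv a0 a1 a2 a3
  - 256 * ((a0 * a1 - a2 * a3) * (a0 * a2 - a1 * a3) * (a0 * a3 - a1 * a2)).

Lemma phiv_disc (a0 a1 a2 a3 w : C) : w != 0 ->
  let b0 := 8 * a0 / w in let b1 := 8 * a1 / w in let b2 := 8 * a2 / w in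
  let b3 := 8 * a3 / w in
  phiv a0 a1 a2 a3 w = 0 <->
  (2 - b0 ^+ 2 - b1 ^+ 2 - b2 ^+ 2 - b3 ^+ 2 + 2 * (b0 * b1 * b2 * b3)) ^+ 2
  = 4 * ((1 - b0 ^+ 2) * (1 - b1 ^+ 2) * (1 - b2 ^+ 2) * (1 - b3 ^+ 2)).
Proof.
move=> w0 b0 b1 b2 b3.
have n : 4096 / w ^+ 6 != 0 by rewrite mulf_neq0 ?invr_eq0 ?expf_neq0 // pnatr_eq0.
have E : (2 - b0 ^+ 2 - b1 ^+ 2 - b2 ^+ 2 - b3 ^+ 2 + 2 * (b0 * b1 * b2 * b3)) ^+ 2
  - 4 * ((1 - b0 ^+ 2) * (1 - b1 ^+ 2) * (1 - b2 ^+ 2) * (1 - b3 ^+ 2)) =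
  4096 / w ^+ 6 * phiv a0 a1 a2 a3 w.
  by rewrite /b0 /b1 /b2 /b3 /phiv /Lv; field.
split=> H; first by apply/eqP; rewrite -subr_eq0 E H mulr0.
by move/eqP: H; rewrite -subr_eq0 E mulf_eq0 (negbTE n) => /eqP.
Qed.

Lemma sin_neq1 (x w : C) : w != 0 -> 64 * x ^+ 2 - w ^+ 2 != 0 -> (8 * x / w) ^+ 2 != 1.
Proof.
move=> w0; apply: contraNneq => H; apply/eqP; apply: (lc (lcM (w ^+ 2) H)); field.
exact: w0.
Qed.

Lemma NsetE (a : 'I_5 -> C) : Nset a <->
  phiv (a (inord 0)) (a (inord 1)) (a (inord 2)) (a (inord 3)) (a (inord 4)) = 0 /\
  psiv (a (inord 0)) (a (inord 1)) (a (inord 2)) (a (inord 3)) (a (inord 4)) != 0.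
Proof.
have neq0 (x : C) : 64 * x ^+ 2 - (0 : C) ^+ 2 != 0 -> x != 0.
  by apply: contraNneq => ->; rewrite expr0n subr0 mulr0.
split=> [[na [[G0 G1] [_ [_ [p [v [s _]]]]]]]|[phi0 psi0]].
  have L := exactly_Lv (G0 (true, true, false) isT isT).
  have N := gen_pos_psi_free G1; split; last by apply/psivP.
  move: N L; move/sing3E: s; move/validE: v => [].
  move: (pr p 0) (pr p 1) (pr p 2) => X Y Z nX nY nZ.
  move: (a (inord 0)) (a (inord 1)) (a (inord 2)) (a (inord 3)) (a (inord 4)) => a0 a1 a2 a3 w.
  move=> S [N0 N1 N2 N3] L; have [w0|w0] := eqVneq w 0.
    subst w; move/neq0: N0 => N0; move/neq0: N1 => N1; move/neq0: N2 => N2; move/neq0: N3 => N3.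
    rewrite /phiv expr0n mul0r sub0r.
    (* If neither M_2 nor M_3 vanishes, the singular point lies on an edge in X, which forces M_1 =
       0. *)
    have [->|M2] := eqVneq (a0 * a2 - a1 * a3) 0; first by rewrite mulr0 mul0r mulr0 oppr0.
    have [->|M3] := eqVneq (a0 * a3 - a1 * a2) 0; first by rewrite !mulr0 oppr0.
    have [eX eY eZ] := degenerate_only_X L N0 N1 N2 N3 M2 M3 nX nY nZ S.
    have [e [EX r0]] := edge_cases nX eX.
    have [_ _ -> _ _] := degenerate_edge N0 r0 EX eY eZ S.
    by rewrite subrr !mul0r mulr0 oppr0.
  apply/(phiv_disc _ _ _ _ w0).
  have eX := sing3_noedge_w L w0 nX nY nZ S.
  have eY : ~ edge Y by apply: (sing3_noedge_w _ w0 nY nZ nX (sing3_rot S)); rewrite Lv_rot.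
  have eZ : ~ edge Z.
    by apply: (sing3_noedge_w _ w0 nZ nX nY (sing3_rot (sing3_rot S))); rewrite Lv_rot Lv_rot.
  have T := proj1 (sing3_trp _ _ _ _ w0 eX eY eZ) S.
  by apply: (trp_disc _ _ _ _ T); apply: sin_neq1.
have [L N] := proj1 (psivP _ _ _ _ _) psi0.
split.
  have [N0 _ _ _] := N; have [z|z] := eqVneq (a (inord 4)) 0; last by exists (inord 4).
  by rewrite z in N0; exists (inord 0); apply: neq0.
split; first by split; [exact: gen_pos_fixed | exact: gen_pos_free].
apply: one_node_orbit_eight => //.
move: N L phi0; move: (a (inord 0)) (a (inord 1)) (a (inord 2)) (a (inord 3)) (a (inord 4)).
move=> a0 a1 a2 a3 w [N0 N1 N2 N3] L phi0; have [w0|w0] := eqVneq w 0; last first.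
  by apply: one_node_orbit_generic; rewrite ?sin_neq1 //; apply/phiv_disc.
subst w; move/neq0: N0 => N0; move/neq0: N1 => N1; move/neq0: N2 => N2; move/neq0: N3 => N3.
have n256 : (256 : C) != 0 by rewrite pnatr_eq0.
move/eqP: phi0; rewrite /phiv expr0n mul0r sub0r oppr_eq0 !mulf_eq0 (negbTE n256) /=.
case/orP=> [/orP[]|]; rewrite subr_eq0 => /eqP M.
- exact: one_node_orbit_M1.
- apply: one_node_orbit_rot; apply: one_node_orbit_M1 => //; first by rewrite Lv_rot.
  by rewrite M mulrC.
- apply: one_node_orbit_rot; apply: one_node_orbit_rot; apply: one_node_orbit_M1 => //.
  by rewrite Lv_rot Lv_rot.
Qed.
End Characterization.

(** * Pseudo-division by Phi *)

Section Hypersurface.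
Variable C : numClosedFieldType.
Implicit Types (a : 'I_5 -> C).

Lemma meval_mwiden n (r : {mpoly C[n]}) v x : (mwiden r).@[snoc v x] = r.@[v].
Proof.
rewrite {1}(mpolyE r) (raddf_sum (@mwiden n C)) (raddf_sum (meval _)) /= [RHS]mevalE; apply: eq_bigr => m _.
rewrite mwidenZ mwidenX mevalZ mevalX; congr (_ * _).
rewrite big_ord_recr /= mnmwiden_ordmax expr0 mulr1.
by apply: eq_bigr => i _; rewrite snoc_widen mnmwiden_widen.
Qed.

Lemma snocE n (v : 'I_n.+1 -> C) :
  v =1 snoc (fun i => v (widen_ord (leqnSn n) i)) (v ord_max).
Proof.
move=> i; case: (unliftP ord_max i) => [j ->|->]; last by rewrite snoc_max.
by rewrite /snoc liftK; congr v; apply: val_inj; rewrite /= /bump leqNgt ltn_ord.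
Qed.

Lemma pdivD_ring (R : comNzRingType) (L L' F f g q q' w x0 x1 y0 y1 : R) :
  L * f = F * q + (x1 * w + x0) -> L' * g = F * q' + (y1 * w + y0) ->
  L * L' * (f + g) = F * (L' * q + L * q') + ((L' * x1 + L * y1) * w + (L' * x0 + L * y0)).
Proof. by move=> E E'; lincomb (lcD (lcM L' E) (lcM L E')). Qed.

(** The product of two linear remainders has a term in w^2; one more factor L reduces it by w^2 L =
    (w^2 L - M) + M. *)
Lemma pdivM_ring (R : comNzRingType) (L M K K' f g q q' w x0 x1 y0 y1 : R) :
  K * f = (w ^+ 2 * L - M) * q + (x1 * w + x0) ->
  K' * g = (w ^+ 2 * L - M) * q' + (y1 * w + y0) ->
  L * (K * K') * (f * g) =
  (w ^+ 2 * L - M) * (L * (q * (K' * g) + (x1 * w + x0) * q') + x1 * y1)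
  + (L * (x1 * y0 + x0 * y1) * w + (M * x1 * y1 + L * x0 * y0)).
Proof. by move=> E E'; lincomb (lcD (lcM (L * K' * g) E) (lcM (L * (x1 * w + x0)) E')). Qed.

Section PseudoDivision.
Variables (n : nat) (l m : {mpoly C[n]}).
Let L : {mpoly C[n.+1]} := mwiden l.
Let M : {mpoly C[n.+1]} := mwiden m.
Let W : {mpoly C[n.+1]} := 'X_ord_max.

Definition pdiv (f : {mpoly C[n.+1]}) := exists k q r0 r1,
  L ^+ k * f = (W ^+ 2 * L - M) * q + (mwiden r1 * W + mwiden r0).

Lemma pdiv_widen r : pdiv (mwiden r).
Proof. by exists 0%N, 0, r, 0; rewrite mwiden0 expr0 mul1r mulr0 mul0r !add0r. Qed.

Lemma pdivD f g : pdiv f -> pdiv g -> pdiv (f + g).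
Proof.
move=> [k [q [r0 [r1 E]]]] [k' [q' [r0' [r1' E']]]].
exists (k + k')%N, (L ^+ k' * q + L ^+ k * q'), (l ^+ k' * r0 + l ^+ k * r0'),
  (l ^+ k' * r1 + l ^+ k * r1').
rewrite !(mwidenD, mwidenM) !rmorphXn /= -/L exprD; exact: pdivD_ring.
Qed.

Lemma pdivM f g : pdiv f -> pdiv g -> pdiv (f * g).
Proof.
move=> [k [q [r0 [r1 E]]]] [k' [q' [r0' [r1' E']]]].
pose A := mwiden r1 * W + mwiden r0.
exists (k + k').+1, (L * (q * (L ^+ k' * g) + A * q') + mwiden r1 * mwiden r1'),
  (m * r1 * r1' + l * r0 * r0'), (l * (r1 * r0' + r0 * r1')).
rewrite !(mwidenD, mwidenM) -/L -/M exprS exprD; exact: pdivM_ring.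
Qed.

Lemma pdiv_all f : pdiv f.
Proof.
rewrite (mpolyE f); apply: (big_ind pdiv) => [|f1 f2|u _]; last 1 first.
- rewrite -mul_mpolyC; apply: pdivM; first by rewrite -mwidenC; apply: pdiv_widen.
  rewrite mpolyXE_id; apply: (big_ind pdiv) => [|f1 f2|i _]; last 1 first.
  + elim: (u i) => [|j IH]; first by rewrite expr0 -mwiden1; apply: pdiv_widen.
    rewrite exprS; apply: pdivM IH; case: (unliftP ord_max i) => [i' ->|->].
      have -> : lift ord_max i' = widen_ord (leqnSn n) i'.
        by apply: val_inj; rewrite /= /bump leqNgt ltn_ord.
      by rewrite -mnmwiden1 -mwidenX; apply: pdiv_widen.
    exists 0%N, 0, 0, 1; rewrite mwiden0 mwiden1 expr0 /W; ring.
  + by rewrite -mwiden1; apply: pdiv_widen.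
  + exact: pdivM.
- by rewrite -(mwiden0 n C); apply: pdiv_widen.
- exact: pdivD.
Qed.

(* If f vanishes at both points (v, w) and (v, -w) of W^2 L = M for generic v,
   its remainder r1 W + r0 vanishes. *)
Lemma pdiv_exact f (g : {mpoly C[n]}) : g != 0 ->
  (forall v w, g.@[v] != 0 -> w ^+ 2 * l.@[v] = m.@[v] -> w != 0 /\ f.@[snoc v w] = 0) ->
  (forall v, g.@[v] != 0 -> l.@[v] != 0) ->
  exists k q, L ^+ k * f = (W ^+ 2 * L - M) * q.
Proof.
move=> g0 H lg; have [k [q [r0 [r1 E]]]] := pdiv_all f; exists k, q.
have key v : g.@[v] != 0 -> r1.@[v] = 0 /\ r0.@[v] = 0.
  move=> gv; pose w := sqrtC (m.@[v] / l.@[v]).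
  have w2 : w ^+ 2 * l.@[v] = m.@[v] by rewrite sqrtCK divfK // lg.
  have ev x : x ^+ 2 * l.@[v] = m.@[v] -> r1.@[v] * x + r0.@[v] = 0.
    move=> hx; have [_ fx] := H v x gv hx.
    have := congr1 (meval (snoc v x)) E.
    rewrite !(mevalM, mevalD, mevalN) fx mulr0 !meval_mwiden !mevalXU snoc_max.
    by rewrite -expr2 hx subrr mul0r add0r => <-.
  have n2 : (2 : C) != 0 by rewrite pnatr_eq0.
  have e1 := ev w w2; have e2 := ev (- w) (etrans (congr1 (fun y => y * _) (sqrrN w)) w2).
  have [w0 _] := H v w gv w2; split.
    by apply: (mulIf w0); apply: (mulfI n2); lincomb (lcD e1 (lcM (-1) e2)).
  by apply: (mulfI n2); lincomb (lcD e1 e2).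
have z r : (forall v, g.@[v] != 0 -> r.@[v] = 0) -> r = 0.
  move=> hr; apply/eqP; rewrite -[_ == 0]orFb -(negbTE g0) -mulf_eq0; apply/eqP.
  apply: meval_eq0 => v; rewrite mevalM; have [->|gv] := eqVneq g.@[v] 0; first by rewrite mul0r.
  by rewrite hr // mulr0.
have r10 : r1 = 0 by apply: z => v /key[].
have r00 : r0 = 0 by apply: z => v /key[].
by rewrite E r10 r00 mwiden0 mul0r !addr0.
Qed.
End PseudoDivision.

Definition Av (j : nat) : {mpoly C[4]} := 'X_(inord j).
Definition Lpoly : {mpoly C[4]} :=
  (Av 0 + Av 1 + Av 2 + Av 3) * (Av 0 - Av 1 - Av 2 + Av 3)
  * (Av 0 - Av 1 + Av 2 - Av 3) * (Av 0 + Av 1 - Av 2 - Av 3).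
Definition Mpoly : {mpoly C[4]} :=
  256 *: ((Av 0 * Av 1 - Av 2 * Av 3) * (Av 0 * Av 2 - Av 1 * Av 3) * (Av 0 * Av 3 - Av 1 * Av 2)).
Definition Wv : {mpoly C[5]} := 'X_ord_max.
Definition Phi : {mpoly C[5]} := Wv ^+ 2 * mwiden Lpoly - mwiden Mpoly.
Definition Bv (j : nat) : {mpoly C[5]} := 'X_(inord j).
Definition Psi : {mpoly C[5]} := mwiden Lpoly *
  ((64 *: Bv 0 ^+ 2 - Bv 4 ^+ 2) * (64 *: Bv 1 ^+ 2 - Bv 4 ^+ 2)
   * (64 *: Bv 2 ^+ 2 - Bv 4 ^+ 2) * (64 *: Bv 3 ^+ 2 - Bv 4 ^+ 2)).

Lemma inord4 : (inord 4 : 'I_5) = ord_max.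
Proof. by apply: val_inj; rewrite /= inordK. Qed.

Lemma widen_inord j : (j < 4)%N -> widen_ord (leqnSn 4) (inord j) = inord j.
Proof. by move=> hj; apply: val_inj; rewrite /= !inordK // ltnW. Qed.

Lemma mevalX2 n (f : {mpoly C[n]}) k v : (f ^+ k).@[v] = f.@[v] ^+ k.
Proof. exact: rmorphXn. Qed.

Lemma LpolyE v : Lpoly.@[v] = Lv (v (inord 0)) (v (inord 1)) (v (inord 2)) (v (inord 3)).
Proof. by rewrite /Lpoly /Av !(mevalM, mevalD, mevalN, mevalXU). Qed.

Lemma MpolyE v : Mpoly.@[v] = 256 *
  ((v (inord 0) * v (inord 1) - v (inord 2) * v (inord 3))
   * (v (inord 0) * v (inord 2) - v (inord 1) * v (inord 3))
   * (v (inord 0) * v (inord 3) - v (inord 1) * v (inord 2))).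
Proof. by rewrite /Mpoly /Av !(mevalZ, mevalM, mevalD, mevalN, mevalXU). Qed.

Lemma mwiden_evalE (r : {mpoly C[4]}) a :
  (mwiden r).@[a] = r.@[fun i => a (widen_ord (leqnSn 4) i)].
Proof. by rewrite (meval_eq _ (snocE a)) meval_mwiden. Qed.

Definition phia a := phiv (a (inord 0)) (a (inord 1)) (a (inord 2)) (a (inord 3)) (a (inord 4)).
Definition psia a := psiv (a (inord 0)) (a (inord 1)) (a (inord 2)) (a (inord 3)) (a (inord 4)).

Lemma PhiE a : Phi.@[a] = phia a.
Proof.
rewrite /Phi mevalD mevalN mevalM mevalX2 !mwiden_evalE LpolyE MpolyE mevalXU -inord4.
by rewrite !widen_inord.
Qed.

Lemma PsiE a : Psi.@[a] = psia a.
Proof.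
rewrite /Psi /psia /psiv mevalM mwiden_evalE LpolyE !widen_inord //; congr (_ * _).
by rewrite !mevalM !mevalD !mevalN !mevalZ !mevalX2 !mevalXU.
Qed.

Lemma NE a : Nset a <-> phia a = 0 /\ psia a != 0.
Proof. exact: NsetE. Qed.

Lemma phia_scale c a : phia (fun i => c * a i) = c ^+ 6 * phia a.
Proof. by rewrite /phia /phiv /Lv; ring. Qed.

Lemma psia_scale c a : psia (fun i => c * a i) = c ^+ 12 * psia a.
Proof. by rewrite /psia /psiv /Lv; ring. Qed.

Lemma Nset_scale c a : c != 0 -> Nset a -> Nset (fun i => c * a i).
Proof.
move=> c0 /NE[p q]; apply/NE; rewrite phia_scale psia_scale p mulr0; split=> //.
by rewrite mulf_neq0 // expf_neq0.
Qed.

(** N is stable under nonzero scalars only, whereas [pvanish] includes the scalar 0; a polynomial in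
    l that vanishes off 0 vanishes everywhere. *)
Lemma pvanish_generic m (f : {mpoly C[m]}) (a : 'I_m -> C) :
  (forall l, l != 0 -> f.@[fun i => l * a i] = 0) -> pvanish f a.
Proof.
move=> H l; pose ln : 'I_m -> {mpoly C[1]} := fun i => a i *: 'X_ord0.
have E v : (compm f ln).@[v] = f.@[fun i => v ord0 * a i].
  by rewrite meval_comp; apply: meval_eq => i; rewrite mevalZ mevalXU mulrC.
have X0 : ('X_ord0 : {mpoly C[1]}) != 0.
  by apply: (@neq0_of_meval _ _ _ (fun=> 1)); rewrite mevalXU oner_neq0.
have : 'X_ord0 * compm f ln = 0.
  apply: meval_eq0 => v; rewrite mevalM mevalXU E.
  by have [->|v0] := eqVneq (v ord0) 0; rewrite ?mul0r // H // mulr0.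
move/eqP; rewrite mulf_eq0 (negbTE X0) /= => /eqP E0.
by have := E (fun=> l); rewrite E0 meval0 => <-.
Qed.

Lemma in_ideal_of_mult f k q : mwiden Lpoly ^+ k * f = Phi * q -> in_ideal (@Nset C) f.
Proof.
move=> E a _ Na; apply: pvanish_generic => l l0.
have /NE[p /psivP[L _]] := Nset_scale l0 Na.
have := congr1 (meval (fun i => l * a i)) E.
rewrite !mevalM PhiE p mul0r mevalX2 mwiden_evalE LpolyE !widen_inord // => /eqP.
by rewrite mulf_eq0 expf_eq0 (negbTE L) andbF => /eqP.
Qed.

(** On w^2 L = M this is L (64 a_j^2 - w^2). Hence [genpoly] <> 0 ensures that both points of Phi =
    0 over v lie in N and have w <> 0. *)
Definition gfac (j : nat) : {mpoly C[4]} := 64 *: (Av j ^+ 2 * Lpoly) - Mpoly.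
Definition genpoly : {mpoly C[4]} := Lpoly * Mpoly * (gfac 0 * gfac 1 * gfac 2 * gfac 3).

Lemma gfacE j v :
  (gfac j).@[v] = 64 * v (inord j) ^+ 2 * Lpoly.@[v] - Mpoly.@[v].
Proof. by rewrite /gfac mevalD mevalN mevalZ mevalM mevalX2 mevalXU mulrA. Qed.

Lemma genpolyE v : genpoly.@[v] = Lpoly.@[v] * Mpoly.@[v] *
  ((gfac 0).@[v] * (gfac 1).@[v] * (gfac 2).@[v] * (gfac 3).@[v]).
Proof.
have E (a b c d e f : {mpoly C[4]}) : (a * b * (c * d * e * f)).@[v] =
    a.@[v] * b.@[v] * (c.@[v] * d.@[v] * e.@[v] * f.@[v]) by rewrite !mevalM.
exact: E.
Qed.

Lemma genpoly_neq0 : genpoly != 0.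
Proof.
(* A point with L > 0 and M < 0, so that every [gfac] is positive there. *)
pose vs : seq C := [:: 1; 2; 3; 5]; pose v : 'I_4 -> C := fun i => vs`_i.
apply: (@neq0_of_meval _ _ _ v).
have vE j : (j < 4)%N -> v (inord j) = vs`_j by move=> hj; rewrite /v inordK.
have EL : Lpoly.@[v] = 165 by rewrite LpolyE !vE //= /Lv; ring.
have EM : Mpoly.@[v] = - (256 * 91) by rewrite MpolyE !vE //=; ring.
have F j (k : nat) : (j < 4)%N -> vs`_j = k%:R -> (gfac j).@[v] != 0.
  move=> hj E; rewrite gfacE EL EM vE // E.
  have -> : 64 * k%:R ^+ 2 * 165 - - (256 * 91) = 64 * (165 * k%:R ^+ 2 + 364) :> C by ring.
  rewrite mulf_neq0 ?pnatr_eq0 // lt0r_neq0 // ltr_wpDl ?ltr0n //.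
  by rewrite mulr_ge0 ?ler0n ?exprn_ge0.
rewrite genpolyE EL EM !mulf_neq0 ?oppr_eq0 ?mulf_neq0 ?pnatr_eq0 //.
- exact: (F 0%N 1%N).
- exact: (F 1%N 2).
- exact: (F 2 3).
- exact: (F 3 5).
Qed.

(** Points with w <> 0 suffice, and these are the ones that the torus reaches. *)
Lemma mult_of_vanish f : (forall a, Nset a -> a (inord 4) != 0 -> f.@[a] = 0) ->
  exists k q, mwiden Lpoly ^+ k * f = Phi * q.
Proof.
move=> H; apply: (pdiv_exact genpoly_neq0) => [v w|v]; last first.
  by rewrite genpolyE 2!mulf_eq0 !negb_or => /andP[/andP[]].
rewrite genpolyE => g0 hw.
have [l0 [m0 h]] : Lpoly.@[v] != 0 /\ (Mpoly.@[v] != 0) /\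
    (forall j, (j < 4)%N -> 64 * v (inord j) ^+ 2 * Lpoly.@[v] - Mpoly.@[v] != 0).
  move: g0; rewrite mulf_eq0 negb_or => /andP[]; rewrite mulf_eq0 negb_or => /andP[-> ->].
  rewrite 3!mulf_eq0 !negb_or => /andP[/andP[/andP[g0 g1] g2] g3]; split=> //; split=> //.
  rewrite !gfacE in g0 g1 g2 g3; by case=> [|[|[|[|j]]]].
have w0 : w != 0 by apply: contraNneq m0 => z; rewrite -hw z expr0n mul0r.
split=> //; apply: H; last by rewrite inord4 snoc_max.
have sv j : (j < 4)%N -> snoc v w (inord j) = v (inord j).
  by move=> hj; rewrite -widen_inord // snoc_widen.
apply/NE; split.
  rewrite -PhiE /Phi mevalD mevalN mevalM mevalX2 !meval_mwiden mevalXU snoc_max hw.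
  by rewrite subrr.
apply/psivP; rewrite (sv 0%N) // (sv 1%N) // (sv 2) // (sv 3) // inord4 snoc_max -LpolyE; split=> //.
have k j : (j < 4)%N -> 64 * v (inord j) ^+ 2 - w ^+ 2 != 0.
  move=> /h; apply: contraNneq => E; rewrite -hw -mulrBl E mul0r //.
by split; apply: k.
Qed.
End Hypersurface.

(** * Parametrization, irreducibility and unirationality *)

Section MainTheorem.
Variable C : numClosedFieldType.
Implicit Types (a : 'I_5 -> C).

Definition vec5 (T : Type) (x0 x1 x2 x3 x4 : T) : 'I_5 -> T :=
  fun i => nth x0 [:: x0; x1; x2; x3; x4] i.

Lemma vec5E (T : Type) (x0 x1 x2 x3 x4 : T) :
  (vec5 x0 x1 x2 x3 x4 (inord 0) = x0) * (vec5 x0 x1 x2 x3 x4 (inord 1) = x1) *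
  (vec5 x0 x1 x2 x3 x4 (inord 2) = x2) * (vec5 x0 x1 x2 x3 x4 (inord 3) = x3) *
  (vec5 x0 x1 x2 x3 x4 (inord 4) = x4).
Proof. by rewrite /vec5 !inordK. Qed.

Lemma vec5_ind (P : 'I_5 -> Prop) :
  P (inord 0) -> P (inord 1) -> P (inord 2) -> P (inord 3) -> P (inord 4) -> forall i, P i.
Proof.
move=> p0 p1 p2 p3 p4 i; have -> : i = inord i by rewrite inord_val.
by case: i => -[|[|[|[|[|]]]]].
Qed.

Definition Tv (j : nat) : {mpoly C[4]} := 'X_(inord j).

(* With T_1, T_2, T_3 = exp(i theta_j) (j = 0, 1, 2), T_0 = 1 and sum theta_j = 0,
   this is a multiple of (sin theta_0, ..., sin theta_3, 8). *)
Definition torus : 'I_5 -> {mpoly C[4]} := vec5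
  ((Tv 1 ^+ 2 - Tv 0 ^+ 2) * Tv 0 ^+ 2 * Tv 2 * Tv 3)
  ((Tv 2 ^+ 2 - Tv 0 ^+ 2) * Tv 0 ^+ 2 * Tv 1 * Tv 3)
  ((Tv 3 ^+ 2 - Tv 0 ^+ 2) * Tv 0 ^+ 2 * Tv 1 * Tv 2)
  (Tv 0 ^+ 6 - Tv 1 ^+ 2 * Tv 2 ^+ 2 * Tv 3 ^+ 2)
  ((16 * 'i) *: (Tv 0 ^+ 3 * Tv 1 * Tv 2 * Tv 3)).

Definition torusv (x0 x1 x2 x3 : C) : 'I_5 -> C := vec5
  ((x1 ^+ 2 - x0 ^+ 2) * x0 ^+ 2 * x2 * x3)
  ((x2 ^+ 2 - x0 ^+ 2) * x0 ^+ 2 * x1 * x3)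
  ((x3 ^+ 2 - x0 ^+ 2) * x0 ^+ 2 * x1 * x2)
  (x0 ^+ 6 - x1 ^+ 2 * x2 ^+ 2 * x3 ^+ 2)
  ((16 * 'i) * (x0 ^+ 3 * x1 * x2 * x3)).

Lemma torusE (t : 'I_4 -> C) : (fun i => (torus i).@[t]) =1
  torusv (t (inord 0)) (t (inord 1)) (t (inord 2)) (t (inord 3)).
Proof.
apply: vec5_ind; rewrite /torus /torusv !vec5E /Tv;
  rewrite ?mevalZ !(mevalM, mevalD, mevalN, mevalX2, mevalXU) //.
Qed.

Lemma torus_homog i : torus i \is 6.-homog.
Proof.
have hX j : Tv j \is 1.-homog by rewrite dhomogX /= mdeg1.
have hXn j k : Tv j ^+ k \is k.-homog by rewrite -[in X in X.-homog](mul1n k); apply: dhomogMn.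
have dM d e d' (p q : {mpoly C[4]}) : (d + e)%N = d' -> p \is d.-homog -> q \is e.-homog -> p * q \is d'.-homog.
  by move=> <-; apply: dhomogM.
move: i; apply: vec5_ind; rewrite /torus !vec5E.
1-3: by apply: (dM 5 1) => //; apply: (dM 4 1) => //; apply: (dM 2 2) => //; rewrite rpredB.
- by rewrite rpredB //; apply: (dM 4 2) => //; apply: (dM 2 2).
- by rewrite rpredZ //; apply: (dM 5 1) => //; apply: (dM 4 1) => //; apply: (dM 3 1).
Qed.

Lemma phia_torus (x0 x1 x2 x3 : C) : phia (torusv x0 x1 x2 x3) = 0.
Proof.
rewrite /phia /torusv !vec5E /phiv.
have -> : (16 * 'i * (x0 ^+ 3 * x1 * x2 * x3)) ^+ 2 = - 256 * (x0 ^+ 3 * x1 * x2 * x3) ^+ 2.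
  by rewrite !exprMn sqrCi; ring.
rewrite /Lv; ring.
Qed.

Lemma phia_ext a b : a =1 b -> phia a = phia b.
Proof. by move=> e; rewrite /phia !e. Qed.
Lemma psia_ext a b : a =1 b -> psia a = psia b.
Proof. by move=> e; rewrite /psia !e. Qed.

Lemma torus_onto a : Nset a -> a (inord 4) != 0 ->
  exists t c, c != 0 /\ a =1 (fun i => c * (torus i).@[t]).
Proof.
move=> /NE[p _] w0.
have := proj1 (phiv_disc _ _ _ _ w0) p; set w := a (inord 4) in w0 *.
have bE j : a (inord j) = 8 * a (inord j) / w * (w / 8) by field.
move: (bE 0%N) (bE 1%N) (bE 2) (bE 3).
move: (8 * a (inord 0) / w) (8 * a (inord 1) / w) (8 * a (inord 2) / w) (8 * a (inord 3) / w).
move=> b0 b1 b2 b3 A0 A1 A2 A3 /disc_cos [k0 [k1 [k2 [k3 [[K0 K1 K2 K3] [E R]]]]]].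
have i2 : 'i * 'i = -1 :> C by rewrite -expr2 sqrCi.
have i0 : 'i != 0 :> C by apply: neq0Ci.
(* z is exp(i theta), and changing the sign of b inverts it. *)
pose z (k b : C) := k + 'i * b.
have zz k b : k ^+ 2 = 1 - b ^+ 2 -> z k b * z k (- b) = 1.
  by move=> H; rewrite /z; apply: (lc (lcD H (lcM (- b ^+ 2) i2))); ring.
have zb k b : z k b - z k (- b) = 2 * 'i * b by rewrite /z; ring.
have [Z0 Z1 Z2 Z3] : [/\ _ = 1 :> C, _ = 1 :> C, _ = 1 :> C & _ = 1 :> C] :=
  And4 (zz _ _ K0) (zz _ _ K1) (zz _ _ K2) (zz _ _ K3).
have D : z k0 b0 * z k1 b1 * z k2 b2 = z k3 (- b3).
  transitivity (z k2 (- b2) * z k3 (- b3) * z k2 b2); last by lincomb (lcM (z k3 (- b3)) Z2).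
  congr (_ * _); rewrite /z; apply: (lc (lcD E (lcD (lcM 'i R) (lcM (b0 * b1 - b2 * b3) i2)))); ring.
have dn : z k3 (- b3) != 0 by apply: contraTneq (oner_neq0 C) => e; rewrite -Z3 e mulr0 eqxx.
move: (zb k0 b0) (zb k1 b1) (zb k2 b2) (zb k3 b3) Z0 Z1 Z2 Z3 D dn.
move: (z k0 b0) (z k1 b1) (z k2 b2) (z k3 b3) (z k0 (- b0)) (z k1 (- b1)) (z k2 (- b2)) (z k3 (- b3)).
move=> z0 z1 z2 z3 y0 y1 y2 y3 B0 B1 B2 B3 Z0 Z1 Z2 Z3 D dn.
pose t : 'I_4 -> C := fun i => [:: 1; z0; z1; z2]`_i.
(* Because the angles add up to 0, the last torus coordinate at t is 16 i z0 z1 z2 = 16 i y3; the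
   scalar turns it into w. *)
exists t, (w / (16 * 'i * y3)); split.
  by rewrite mulf_neq0 ?invr_eq0 ?mulf_neq0 // pnatr_eq0.
have tE j : (j < 4)%N -> t (inord j) = [:: 1; z0; z1; z2]`_j by move=> hj; rewrite /t inordK.
have c0 (b zz' yy : C) : zz' - yy = 2 * 'i * b -> b * (w / 8) = w / (16 * 'i * y3) * (y3 * (zz' - yy)).
  by move=> ->; field; rewrite i0 dn.
apply: vec5_ind; rewrite torusE /torusv !vec5E !tE //= ?expr1n.
- by rewrite A0 (c0 _ _ _ B0); congr (_ * _); lincomb (lcD (lcM (- (z0 - y0)) D) (lcM (- (z1 * z2)) Z0)).
- by rewrite A1 (c0 _ _ _ B1); congr (_ * _); lincomb (lcD (lcM (- (z1 - y1)) D) (lcM (- (z0 * z2)) Z1)).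
- by rewrite A2 (c0 _ _ _ B2); congr (_ * _); lincomb (lcD (lcM (- (z2 - y2)) D) (lcM (- (z0 * z1)) Z2)).
- rewrite A3 (c0 _ _ _ B3); congr (_ * _).
  lincomb (lcD Z3 (lcM (z0 * z1 * z2 + y3) D)).
- rewrite -/w !mul1r D; field; rewrite i0 dn; done.
Qed.

Definition vec4 (x0 x1 x2 x3 : C) : 'I_4 -> C := fun i => [:: x0; x1; x2; x3]`_i.
Lemma vec4E x0 x1 x2 x3 : (vec4 x0 x1 x2 x3 (inord 0) = x0) * (vec4 x0 x1 x2 x3 (inord 1) = x1) *
  (vec4 x0 x1 x2 x3 (inord 2) = x2) * (vec4 x0 x1 x2 x3 (inord 3) = x3).
Proof. by rewrite /vec4 !inordK. Qed.

Definition ev t := fun i => (torus i).@[t].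

Lemma phia_ev t : phia (ev t) = 0.
Proof. by rewrite (phia_ext (torusE t)) phia_torus. Qed.

Lemma torus_in t : (Psi C).@[ev t] != 0 -> nzv (ev t) /\ Nset (ev t).
Proof.
rewrite PsiE => h; have N : Nset (ev t) by apply/NE; rewrite phia_ev.
by split=> //; case: N.
Qed.

Lemma torus_generic : exists t, (Psi C).@[ev t] != 0 /\ ev t (inord 4) != 0.
Proof.
(* Here a is (45, 80, 144, -899, 480 i), so w^2 < 0 and each 64 a_j^2 - w^2 is positive. *)
exists (vec4 1 2 3 5); have e := torusE (vec4 1 2 3 5).
rewrite PsiE (psia_ext e) /ev e !vec4E /psia /torusv !vec5E.
split; last first.
  by rewrite !mulf_neq0 ?neq0Ci ?expf_neq0 ?oner_neq0 ?pnatr_eq0.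
have W : (16 * 'i * (1 ^+ 3 * 2 * 3 * 5)) ^+ 2 = - (480 ^+ 2) :> C by rewrite !exprMn sqrCi; ring.
have pos (x : C) n : x ^+ 2 = n%:R ^+ 2 -> 64 * x ^+ 2 - - 480 ^+ 2 != 0.
  by move=> ->; rewrite opprK lt0r_neq0 // ltr_wpDl ?mulr_ge0 ?exprn_ge0 ?exprn_gt0 ?ler0n ?ltr0n.
apply/psivP; rewrite W; split.
  have k (x : C) n : x = n%:R \/ x = - n%:R -> n != 0%N -> x != 0.
    by case=> ->; rewrite ?oppr_eq0 pnatr_eq0.
  by rewrite /Lv; do 3?apply: mulf_neq0; [apply: (k _ 630)|apply: (k _ 1078)|apply: (k _ 1008)|apply: (k _ 880)];
    first [by [] | left; ring | right; ring].
by split; [apply: (pos _ 45)|apply: (pos _ 80)|apply: (pos _ 144)|apply: (pos _ 899)]; ring.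
Qed.

Lemma torus_dense f : (forall t, (Psi C).@[ev t] != 0 -> pvanish f (ev t)) -> in_ideal (@Nset C) f.
Proof.
move=> H; have [k [q E]] : exists k q, mwiden (Lpoly C) ^+ k * f = Phi C * q; last exact: in_ideal_of_mult E.
apply: mult_of_vanish => a Na w0.
have [t [c [c0 e]]] := torus_onto Na w0.
have h : (Psi C).@[ev t] != 0.
  have /NE[_] := Na; rewrite (psia_ext e) psia_scale mulf_eq0 negb_or => /andP[_].
  by rewrite PsiE.
by rewrite (meval_eq _ e); apply: H.
Qed.

Lemma N_irreducible : irreducible (@Nset C).
Proof.
apply: (irreducible_image torus_in _ torus_dense).
by have [t []] := torus_generic; exists t.
Qed.

Lemma N_quasi_projective : quasi_projective (@Nset C).
Proof.
exists (fun a => pvanish (Phi C) a), (fun a => pvanish (Psi C) a).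
split; [exact: zclosed1|split; [exact: zclosed1|]] => a na; rewrite NE; split=> [[p q]|[p q]].
  split=> [l|h]; first by rewrite PhiE phia_scale p mulr0.
  have := h 1; rewrite PsiE psia_scale expr1n mul1r => z; by rewrite z eqxx in q.
split; first by have := p 1; rewrite PhiE phia_scale expr1n mul1r.
by apply/eqP => z; apply: q => l; rewrite PsiE psia_scale z mulr0.
Qed.

Lemma Phi_in_ideal : in_ideal (@Nset C) (Phi C).
Proof. by apply: (@in_ideal_of_mult _ _ 0 1); rewrite expr0 mul1r mulr1. Qed.

Lemma N_unirational : unirational (@Nset C).
Proof.
exists 3, 6, torus; split; first exact: torus_homog.
have [t0 [h0 _]] := torus_generic; have [n0 _] := torus_in h0.
split; first by exists t0.
move=> f; split=> [H|H t nt l].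
  by apply: torus_dense => t /torus_in[nt _]; apply: H.
(* Where Psi vanishes the image may leave N, but F times the pullback of Psi is identically zero, so
   F is. *)
pose F := compm f (fun i => l *: torus i).
have FE t' : F.@[t'] = f.@[fun i => l * ev t' i].
  by rewrite meval_comp; apply: meval_eq => i; rewrite mevalZ.
suff F0 : F = 0 by rewrite -FE F0 meval0.
have P0 : compm (Psi C) torus != 0 by apply: (@neq0_of_meval _ _ _ t0); rewrite meval_comp.
apply/eqP; rewrite -[_ == 0]orFb -(negbTE P0) -mulf_eq0; apply/eqP/meval_eq0 => t'.
rewrite mevalM FE meval_comp; have [->|/torus_in[nt' Nt']] := eqVneq ((Psi C).@[ev t']) 0.
  by rewrite mul0r.
by rewrite (H _ nt' Nt') mulr0.
Qed.

(** * The differential of Phi and smoothness *)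

Lemma mderiv_mwiden n (r : {mpoly C[n]}) : mderiv ord_max (mwiden r) = 0.
Proof.
rewrite (mpolyE r) (raddf_sum (@mwiden n C)) (raddf_sum (mderiv _)) /= big1 // => m _.
by rewrite mwidenZ mwidenX mderivZ mderivX mnmwiden_ordmax scale0r scaler0.
Qed.

Lemma dPhi_w a : (mderiv ord_max (Phi C)).@[a] =
  2 * a (inord 4) * Lv (a (inord 0)) (a (inord 1)) (a (inord 2)) (a (inord 3)).
Proof.
have -> : mderiv ord_max (Phi C) = 2%:R *: (Wv C * mwiden (Lpoly C)).
  rewrite /Phi mderivB mderivM !mderiv_mwiden mulr0 addr0 subr0 expr2 mderivM.
  by rewrite /Wv mderivXU eqxx mul1r mulr1 mulrDl -mulr2n scaler_nat.
by rewrite mevalZ mevalM mevalXU mwiden_evalE LpolyE !widen_inord // -inord4 mulrA.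
Qed.

Lemma mderiv_mwiden_lift n (r : {mpoly C[n]}) i :
  mderiv (widen_ord (leqnSn n) i) (mwiden r) = mwiden (mderiv i r).
Proof.
rewrite (mpolyE r) (raddf_sum (@mwiden n C)) !(raddf_sum (mderiv _)) (raddf_sum (@mwiden n C)).
apply: eq_bigr => m _; rewrite /= mwidenZ mwidenX !mderivZ mwidenZ !mderivX mwidenZ mwidenX.
rewrite mnmwiden_widen; congr (_ *: (_ *: 'X_[_])); apply/mnmP => j.
rewrite mnmBE mnm1E; case: (unliftP ord_max j) => [k ->|->]; last first.
  by rewrite !mnmwiden_ordmax.
have -> : lift ord_max k = widen_ord (leqnSn n) k.
  by apply: val_inj; rewrite /= /bump leqNgt ltn_ord.
by rewrite !mnmwiden_widen mnmBE mnm1E.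
Qed.

Lemma dMpoly v : (mderiv (inord 0) (Mpoly C)).@[v] = 256 *
  (v (inord 1) * (v (inord 0) * v (inord 2) - v (inord 1) * v (inord 3))
               * (v (inord 0) * v (inord 3) - v (inord 1) * v (inord 2))
   + (v (inord 0) * v (inord 1) - v (inord 2) * v (inord 3)) * v (inord 2)
               * (v (inord 0) * v (inord 3) - v (inord 1) * v (inord 2))
   + (v (inord 0) * v (inord 1) - v (inord 2) * v (inord 3))
               * (v (inord 0) * v (inord 2) - v (inord 1) * v (inord 3)) * v (inord 3)).
Proof.
have leib (f g h : {mpoly C[4]}) : (mderiv (inord 0) (256 *: (f * g * h))).@[v] =
  256 * ((mderiv (inord 0) f).@[v] * g.@[v] * h.@[v] + f.@[v] * (mderiv (inord 0) g).@[v] * h.@[v]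
   + f.@[v] * g.@[v] * (mderiv (inord 0) h).@[v]).
  by rewrite mderivZ !mderivM mevalZ !mevalD !mevalM !mevalD !mevalM; ring.
have d j : (j < 4)%N -> mderiv (inord 0) (Av C j) = (j == 0)%:R.
  by move=> hj; rewrite /Av mderivXU -val_eqE /= !inordK.
have dq i j k : (0 < i < 4)%N -> (0 < j < 4)%N -> (0 < k < 4)%N ->
    mderiv (inord 0) (Av C 0 * Av C i - Av C j * Av C k) = Av C i.
  case: i j k => [//|i] [//|j] [//|k] hi hj hk.
  rewrite mderivB !mderivM !d //=; ring.
have eq i j k l : (Av C i * Av C j - Av C k * Av C l).@[v] =
    v (inord i) * v (inord j) - v (inord k) * v (inord l).
  by rewrite mevalB !mevalM /Av !mevalXU.
have e1 i : (Av C i).@[v] = v (inord i) by rewrite /Av mevalXU.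
by rewrite /Mpoly leib !dq // !eq !e1.
Qed.

(** For w <> 0 the derivative 2 w L in w works. For w = 0 exactly one minor vanishes, so the
    derivative of the product of minors by a_0 keeps a single term: some a_i times the other two
    minors. *)
Lemma N_grad a : Nset a -> exists i, (mderiv i (Phi C)).@[a] != 0.
Proof.
move=> Na; have /NE[p /psivP[L N]] := Na.
have [w0|w0] := eqVneq (a (inord 4)) 0; last first.
  by exists ord_max; rewrite dPhi_w; apply: mulf_neq0 L; rewrite mulf_neq0 // pnatr_eq0.
exists (widen_ord (leqnSn 4) (inord 0)).
have -> : (mderiv (widen_ord (leqnSn 4) (inord 0)) (Phi C)).@[a] =
    - (mderiv (inord 0) (Mpoly C)).@[fun i => a (widen_ord (leqnSn 4) i)].
  have sq0 j (g h : {mpoly C[5]}) : g.@[a] = 0 -> (mderiv j (g ^+ 2 * h)).@[a] = 0.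
    by move=> g0; rewrite expr2 -mulrA mderivM mevalD !mevalM g0 !(mul0r, mulr0) addr0.
  rewrite /Phi mderivB mevalB sq0 ?sub0r; last by rewrite mevalXU -inord4.
  by rewrite mderiv_mwiden_lift mwiden_evalE.
rewrite dMpoly !widen_inord // oppr_eq0.
move: p L N; rewrite /phia w0; move: (a (inord 0)) (a (inord 1)) (a (inord 2)) (a (inord 3)).
move=> a0 a1 a2 a3 p L [N0 N1 N2 N3].
have n (x : C) : 64 * x ^+ 2 - (0 : C) ^+ 2 != 0 -> x != 0.
  by apply: contraNneq => ->; rewrite expr0n subr0 mulr0.
move/n: N0 => N0; move/n: N1 => N1; move/n: N2 => N2; move/n: N3 => N3.
have n256 : (256 : C) != 0 by rewrite pnatr_eq0.
rewrite mulf_neq0 //; move/eqP: p.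
rewrite /phiv expr0n mul0r sub0r oppr_eq0 !mulf_eq0 (negbTE n256) /=.
case/orP=> [/orP[]|]; rewrite subr_eq0 => /eqP M.
- have M2 := M2_neq L N0 N2 M; have M3 := M3_neq L N0 N3 M.
  by rewrite M subrr !mul0r !addr0 !mulf_neq0.
- have L' : Lv a0 a2 a3 a1 != 0 by rewrite Lv_rot.
  have M' : a0 * a2 = a3 * a1 by rewrite M mulrC.
  have M2 := M2_neq L' N0 N3 M'; have M3 := M3_neq L' N0 N1 M'.
  rewrite M subrr !(mulr0, mul0r) add0r addr0 !mulf_neq0 //.
  by rewrite [a1 * a2]mulrC.
- have L' : Lv a0 a3 a1 a2 != 0 by rewrite Lv_rot Lv_rot.
  have M2 := M2_neq L' N0 N1 M; have M3 := M3_neq L' N0 N2 M.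
  rewrite M subrr !(mulr0, mul0r) !add0r !mulf_neq0 //.
    by rewrite [a2 * a3]mulrC.
  by rewrite [a1 * a3]mulrC.
Qed.

Lemma N_smooth : smooth_of_dim (@Nset C) 3.
Proof.
move=> a na Na; exists [:: Phi C].
have gE : gradmx [:: Phi C] a = grad (Phi C) a :> 'rV_5.
  by apply/rowP => j; rewrite !mxE.
split; first by move=> f; rewrite inE => /eqP->; apply: Phi_in_ideal.
split.
  rewrite [gradmx _ _]gE rank_rV; have [i hi] := N_grad Na.
  by rewrite (_ : grad _ _ != 0) //; apply: contraNneq hi => /rowP/(_ i); rewrite !mxE => ->.
move=> f If; rewrite [gradmx _ _]gE.
have [k [q E]] := mult_of_vanish (fun b Nb _ => etrans (meval_eq _ (fun i => esym (mul1r _))) (If b (proj1 Nb) Nb 1)).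
have /NE[p /psivP[L _]] := Na.
have fa : f.@[a] = 0 by rewrite -(If a na Na 1); apply: meval_eq => i; rewrite mul1r.
have L0 : (mwiden (Lpoly C) ^+ k).@[a] != 0.
  by rewrite mevalX2 expf_neq0 // mwiden_evalE LpolyE !widen_inord.
(* Differentiate L^k f = Phi q at a point where f and Phi both vanish. *)
have -> : grad f a = (q.@[a] / (mwiden (Lpoly C) ^+ k).@[a]) *: grad (Phi C) a.
  apply/rowP => j; rewrite !mxE; have := congr1 (fun g => (mderiv j g).@[a]) E.
  rewrite !mderivM !mevalD !mevalM fa PhiE p mulr0 mul0r add0r addr0 => H.
  by apply: (mulfI L0); rewrite H; field.
exact: scalemx_sub.
Qed.

(** * A chain of length three and the dimension *)

Definition sub_by (fs : seq {mpoly C[5]}) a := Nset a /\ forall f, f \in fs -> pvanish f a.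

Lemma sub_by_relclosed fs : relclosed (@Nset C) (sub_by fs).
Proof. by exists (fun a => forall f, f \in fs -> pvanish f a); split; [exists fs|]. Qed.

Definition Xw : {mpoly C[5]} := 'X_(inord 4).
Definition Bc (j : nat) : {mpoly C[5]} := 'X_(inord j).
Definition quadric := Bc 0 * Bc 1 - Bc 2 * Bc 3.
Definition lin (c : C) i j := Bc i - c *: Bc j.

(** Equations within N of the point (1 : 6 : 2 : 3 : 0), of a line through it on the quadric M_1 = 0
    in the hyperplane w = 0, of this quadric, and of N itself. *)
Definition flag (i : nat) : seq {mpoly C[5]} :=
  match i with
  | 0 => [:: Xw; lin 6 1 0; lin 2 2 0; lin 3 3 0]
  | 1 => [:: Xw; lin 2 2 0; lin 2 1 3]
  | 2 => [:: Xw; quadric]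
  | _ => [::]
  end.

Lemma pvanish_Xw a : pvanish Xw a <-> a (inord 4) = 0.
Proof.
split=> [/(_ 1)|h l]; rewrite mevalXU ?mul1r // h mulr0 //.
Qed.

Lemma pvanish_lin c i j a : pvanish (lin c i j) a <-> a (inord i) = c * a (inord j).
Proof.
have E l : (lin c i j).@[fun k => l * a k] = l * (a (inord i) - c * a (inord j)).
  by rewrite mevalB mevalZ !mevalXU; ring.
split=> [/(_ 1)|h l]; last by rewrite E h subrr mulr0.
by rewrite E mul1r => /eqP; rewrite subr_eq0 => /eqP.
Qed.

Lemma pvanish_quadric a : pvanish quadric a <->
  a (inord 0) * a (inord 1) = a (inord 2) * a (inord 3).
Proof.
have E l : quadric.@[fun k => l * a k] =
    l ^+ 2 * (a (inord 0) * a (inord 1) - a (inord 2) * a (inord 3)).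
  by rewrite mevalB !mevalM !mevalXU; ring.
split=> [/(_ 1)|h l]; last by rewrite E h subrr mulr0.
by rewrite E expr1n mul1r => /eqP; rewrite subr_eq0 => /eqP.
Qed.

Lemma forall_in2 (T : eqType) (P : T -> Prop) (x y : T) :
  (forall f, f \in [:: x; y] -> P f) <-> P x /\ P y.
Proof.
split=> [h|[hx hy] f]; first by split; apply: h; rewrite !inE eqxx ?orbT.
by rewrite !inE => /orP[]/eqP->.
Qed.
Lemma forall_in3 (T : eqType) (P : T -> Prop) (x y z : T) :
  (forall f, f \in [:: x; y; z] -> P f) <-> [/\ P x, P y & P z].
Proof.
split=> [h|[hx hy hz] f]; first by split; apply: h; rewrite !inE eqxx ?orbT.
by rewrite !inE => /or3P[]/eqP->.
Qed.
Lemma forall_in4 (T : eqType) (P : T -> Prop) (x y z t : T) :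
  (forall f, f \in [:: x; y; z; t] -> P f) <-> [/\ P x, P y, P z & P t].
Proof.
split=> [h|[hx hy hz ht] f]; first by split; apply: h; rewrite !inE eqxx ?orbT.
by rewrite !inE => /or4P[]/eqP->.
Qed.

Lemma flagE i a : (forall f, f \in flag i -> pvanish f a) <->
  match i with
  | 0 => a =1 vec5 (a (inord 0)) (6 * a (inord 0)) (2 * a (inord 0)) (3 * a (inord 0)) 0
  | 1 => a =1 vec5 (a (inord 0)) (2 * a (inord 3)) (2 * a (inord 0)) (a (inord 3)) 0
  | 2 => a (inord 4) = 0 /\ a (inord 0) * a (inord 1) = a (inord 2) * a (inord 3)
  | _ => True
  end.
Proof.
case: i => [|[|[|i]]] //=.
- rewrite forall_in4; split=> [[/pvanish_Xw h4 /pvanish_lin h1 /pvanish_lin h2 /pvanish_lin h3]|e].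
    by apply: vec5_ind; rewrite !vec5E.
  by split; [apply/pvanish_Xw|apply/pvanish_lin|apply/pvanish_lin|apply/pvanish_lin]; rewrite e vec5E.
- rewrite forall_in3; split=> [[/pvanish_Xw h4 /pvanish_lin h2 /pvanish_lin h1]|e].
    by apply: vec5_ind; rewrite !vec5E.
  by split; [apply/pvanish_Xw|apply/pvanish_lin|apply/pvanish_lin]; rewrite e vec5E.
by rewrite forall_in2; split=> [[/pvanish_Xw ? /pvanish_quadric ?]|[? ?]] //; split; [apply/pvanish_Xw|apply/pvanish_quadric].
Qed.

Definition Uv (j : nat) : {mpoly C[3]} := 'X_(inord j).
Definition par (i : nat) : 'I_5 -> {mpoly C[3]} :=
  match i with
  | 0 => vec5 (Uv 0) (6 *: Uv 0) (2 *: Uv 0) (3 *: Uv 0) 0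
  | 1 => vec5 (Uv 0) (2 *: Uv 1) (2 *: Uv 0) (Uv 1) 0
  | _ => vec5 (Uv 0) (Uv 1 * Uv 2) (Uv 0 * Uv 2) (Uv 1) 0
  end.

Definition parv (i : nat) (x y z : C) : 'I_5 -> C :=
  match i with
  | 0 => vec5 x (6 * x) (2 * x) (3 * x) 0
  | 1 => vec5 x (2 * y) (2 * x) y 0
  | _ => vec5 x (y * z) (x * z) y 0
  end.

Lemma parE i (t : 'I_3 -> C) :
  (fun k => (par i k).@[t]) =1 parv i (t (inord 0)) (t (inord 1)) (t (inord 2)).
Proof.
by case: i => [|[|i]]; apply: vec5_ind;
  rewrite /par /parv !vec5E /Uv ?meval0 ?mevalZ ?mevalM ?mevalXU.
Qed.

Definition vec3 (x y z : C) : 'I_3 -> C := fun i => [:: x; y; z]`_i.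
Lemma vec3E x y z : (vec3 x y z (inord 0) = x) * (vec3 x y z (inord 1) = y) *
  (vec3 x y z (inord 2) = z).
Proof. by rewrite /vec3 !inordK. Qed.

(** In this parametrization of the quadric the factors of L split as (u + v)(1 + q), (u + v)(1 - q),
    (u - v)(1 + q), (u - v)(1 - q). *)
Lemma psia_degenerate (u v q : C) : u * v * q != 0 ->
  (u ^+ 2 - v ^+ 2) * (1 - q ^+ 2) != 0 -> psia (parv 2 u v q) != 0.
Proof.
move=> n0 n1; have -> : psia (parv 2 u v q) =
    64 ^+ 4 * (u * v * q) ^+ 4 * ((u ^+ 2 - v ^+ 2) * (1 - q ^+ 2)) ^+ 2.
  by rewrite /psia /parv !vec5E /psiv /Lv; ring.
by rewrite mulf_neq0 ?expf_neq0 // mulf_neq0 ?expf_neq0 // pnatr_eq0.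
Qed.

Lemma psia_parv (u v : nat) : (1 < u)%N -> (1 < v)%N -> psia (parv 2 1 u%:R v%:R) != 0.
Proof.
have sq n : (1 < n)%N -> 1 - n%:R ^+ 2 != 0 :> C.
  move=> hn; rewrite subr_eq0 eq_sym -natrX pnatr_eq1.
  by rewrite -(exp1n 2) eqn_sqr neq_ltn hn orbT.
move=> hu hv; apply: psia_degenerate; rewrite ?expr1n !mulf_neq0 ?oner_neq0 ?sq //.
  by rewrite pnatr_eq0 -lt0n ltnW.
by rewrite pnatr_eq0 -lt0n ltnW.
Qed.

Lemma flag_in i (t : 'I_3 -> C) : (i < 3)%N -> (Psi C).@[fun k => (par i k).@[t]] != 0 ->
  nzv (fun k => (par i k).@[t]) /\ sub_by (flag i) (fun k => (par i k).@[t]).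
Proof.
move=> i3; rewrite PsiE => h.
have N : Nset (fun k => (par i k).@[t]).
  apply/NE; split=> //; rewrite (phia_ext (parE i t)).
  by case: i {h i3} => [|[|i]]; rewrite /phia /parv !vec5E /phiv; ring.
split; first by case: N.
split=> //; apply/flagE; rewrite !(parE i t).
case: i i3 {h N} => [|[|[|i]]] // _.
- by move=> k; rewrite !(parE 0 t) /parv !vec5E.
- by move=> k; rewrite !(parE 1 t) /parv !vec5E.
by rewrite ?(parE 2 t) /parv !vec5E; split=> //; ring.
Qed.

Lemma flag_dense i f : (i < 3)%N ->
  (forall t, (Psi C).@[fun k => (par i k).@[t]] != 0 -> pvanish f (fun k => (par i k).@[t])) ->
  in_ideal (sub_by (flag i)) f.
Proof.
move=> i3 H a na [Na /flagE Fa].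
have /NE[_ pa] := Na.
have [t e] : exists t, a =1 (fun k => (par i k).@[t]).
  have a0n : i = 2 -> a (inord 0) != 0.
    move=> i2; rewrite i2 in Fa; have [w0 _] := Fa; have /psivP[_ [N0 _ _ _]] := pa.
    by apply: contraNneq N0 => z; rewrite z w0 !expr0n mulr0 subrr.
  (* On the quadric w = 0, so 64 a_0^2 <> w^2 makes the quotient meaningful. *)
  exists (vec3 (a (inord 0)) (a (inord 3)) (a (inord 2) / a (inord 0))) => k.
  rewrite parE !vec3E; case: i i3 Fa a0n {H} => [|[|[|i]]] // _ Fa a0n; rewrite ?Fa //.
  have [w0 M] := Fa; have {}a0n := a0n erefl.
  by move: k; apply: vec5_ind; rewrite /parv !vec5E //; apply: (mulfI a0n); rewrite ?M; field.
move=> l; rewrite (meval_eq _ (fun k => congr1 (fun x => l * x) (e k))).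
by apply: H; rewrite PsiE -(psia_ext e).
Qed.

(** Supplies points that make the inclusions strict: v = 2 describes the line, and u = 3 in addition
    its distinguished point. *)
Lemma flag_point i u v : (i < 3)%N -> (1 < u)%N -> (1 < v)%N ->
  (if i == 0%N then (u = 3) else True) -> (if (i < 2)%N then (v = 2) else True) ->
  sub_by (flag i) (parv 2 1 u%:R v%:R).
Proof.
move=> i3 hu hv Hu Hv.
split; first by apply/NE; split; [rewrite /phia /parv !vec5E /phiv; ring | exact: psia_parv].
apply/flagE; case: i i3 Hu Hv => [|[|[|i]]] //= _ Hu Hv; rewrite ?Hu ?Hv.
- by apply: vec5_ind; rewrite /parv !vec5E; ring.
- by apply: vec5_ind; rewrite /parv !vec5E; ring.
by rewrite /parv !vec5E; split=> //; ring.
Qed.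

Lemma flag_irreducible i : irreducible (sub_by (flag i)).
Proof.
have [i3|i3] := ltnP i 3.
  apply: (irreducible_image (phi := par i) (psi := Psi C)).
  - by move=> t; apply: flag_in.
  - exists (vec3 1 3 2); rewrite PsiE (psia_ext (parE i _)) !vec3E.
    have := psia_parv (u := 3) (v := 2) isT isT.
    rewrite (@psia_ext _ (parv i 1 3 2)) //; case: i i3 => [|[|[|i]]] // _;
      by apply: vec5_ind; rewrite /parv !vec5E; ring.
  - by move=> f; apply: flag_dense.
have E a : sub_by (flag i) a <-> Nset a.
  by case: i i3 => [|[|[|i]]] // _; split=> [[]|].
have [[a [na Na]] H] := N_irreducible; split; first by exists a; split=> //; apply/E.
move=> X Y hX hY cov; have [|h|h] := H X Y hX hY.
- by move=> b nb Nb; apply: cov => //; apply/E.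
- by left=> b nb /E; apply: h.
- by right=> b nb /E; apply: h.
Qed.

Lemma N_has_dim : has_dim (@Nset C) 3.
Proof.
split; last first.
  have Phi0 : Phi C != 0.
    have [t [h _]] := torus_generic; have [_ Nt] := torus_in h.
    have [i hi] := N_grad Nt; apply: contraNneq hi => ->.
    by rewrite mderiv0 meval0.
  (* A chain of length 4 in five variables would need 5 < 5. *)
  by move=> /(chain_length Phi0 Phi_in_ideal).
exists (fun i => sub_by (flag i)); split=> [i _|i i3].
  by split; [exact: flag_irreducible | exact: sub_by_relclosed].
have nz (u v : nat) : nzv (parv 2 1 u%:R v%:R).
  by exists (inord 0); rewrite /parv vec5E oner_neq0.
have ne (m n : nat) : m != n -> m%:R = n%:R :> C -> False.
  by move=> mn /eqP; rewrite eqr_nat (negbTE mn).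
case: i i3 => [|[|[|i]]] // _; split.
- move=> a na [Na /flagE e]; split=> //; apply/flagE.
  have := e (inord 3); rewrite vec5E => e3.
  by apply: vec5_ind; rewrite [LHS]e !vec5E ?e3 //; ring.
- move=> /(_ _ (nz 5 2) (@flag_point 1 5 2 isT isT isT I erefl)) [_ /flagE/(_ (inord 3))].
  by rewrite /parv !vec5E mulr1 => /(ne _ _ _); apply.
- move=> a na [Na /flagE e]; split=> //; apply/flagE.
  by rewrite (e (inord 1)) (e (inord 2)) (e (inord 4)) !vec5E; split=> //; ring.
- move=> /(_ _ (nz 5 3) (@flag_point 2 5 3 isT isT isT I I)) [_ /flagE/(_ (inord 2))].
  by rewrite /parv !vec5E mul1r mulr1 => /(ne _ _ _); apply.
- by move=> a na [Na _].
(* A torus point with w <> 0 lies in N but not on the quadric. *)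
- have [t [h w0]] := torus_generic; have [nt Nt] := torus_in h.
  move=> /(_ _ nt (conj Nt _)) []; first by move=> f; rewrite in_nil.
  by move=> _ /flagE[/eqP]; rewrite (negbTE w0).
Qed.
End MainTheorem.

Theorem theorem6p1 (C : numClosedFieldType) :
  quasi_projective (@Nset C) /\ irreducible (@Nset C) /\ has_dim (@Nset C) 3 /\
  smooth_of_dim (@Nset C) 3 /\ unirational (@Nset C).
Proof.
split; [exact: N_quasi_projective|split; [exact: N_irreducible|split; [exact: N_has_dim|]]].
by split; [exact: N_smooth|exact: N_unirational].
Qed.
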